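(* Let $H=L^2(\mu_{(0,1)};\mathbb R)$ with its usual norm and inner product, where $\mu_{(0,1)}$ is Lebesgue–Borel measure on $(0,1)$, let $T,\eta,\nu\in(0,\infty)$, $r\in[0,\infty)$, $\delta\in\mathbb R$, $\beta\in(\frac14,\frac12)$, let $(\Omega,\mathcal F,\mathbb P,(\mathcal F_t)_{t\in[0,T]})$ be a stochastic basis, let $(W_t)_{t\in[0,T]}$ be an $\mathrm{Id}_H$-cylindrical $(\mathcal F_t)_{t\in[0,T]}$-Wiener process, let $(b_n)_{n\in\mathbb Z}\subseteq H$ satisfy for all $n\in\mathbb N=\{1,2,\dots\}$ that $b_0=[\{1\}_{x\in(0,1)}]$, $b_n=[\{\sqrt2\cos(2n\pi x)\}_{x\in(0,1)}]$, $b_{-n}=[\{\sqrt2\sin(2n\pi x)\}_{x\in(0,1)}]$, let $A\colon D(A)\subseteq H\to H$ be the linear operator with $D(A)=\{v\in H\colon\sum_{n\in\mathbb Z}|n^2\langle b_n,v\rangle_H|^2<\infty\}$ and $Av=-\nu\sum_{n\in\mathbb Z}n^2\langle b_n,v\rangle_Hb_n$ for all $v\in D(A)$, let $(H_q,\|\cdot\|_{H_q},\langle\cdot,\cdot\rangle_{H_q})$, $q\in\mathbb R$, be a family of interpolation spaces associated to $\eta-A$, let $\xi\colon\Omega\to H_\delta$ be $\mathcal F_0/\mathcal B(H_\delta)$-measurable, let $B\in L(H,HS(H,H_{-\beta}))$ satisfy for all $v\in\mathcal L^2(\mu_{(0,1)};\mathbb R)$ and all continuous $u\colon[0,1]\to\mathbb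 R$ that $B([v])[u|_{(0,1)}]=[\{v(x)\cdot u(x)\}_{x\in(0,1)}]$, and let $X\colon[0,T]\times\Omega\to H_\delta$ be an $(\mathcal F_t)_{t\in[0,T]}$-predictable stochastic process which satisfies for all $t\in(0,T]$ that $X((0,T]\times\Omega)\subseteq H$, that $$\mathbb E\big[\|e^{tA}\xi\|^2_{H_{-r}}\big]+\int_0^t\mathbb E\big[\|e^{(t-s)A}B(X_s)\|^2_{HS(H,H_{-r})}\big]\,ds<\infty,$$ and $\mathbb P$-a.s. that $X_t=e^{tA}\xi+\int_0^te^{(t-s)A}B(X_s)\,dW_s$. Then (i) $\mathbb P(\xi\in H_{-1/2})=1$ and (ii) for all $t\in(0,T]$, $$2^{-1/2}\,\eta^{-r}\,(1-e^{-2\eta t})^{1/2}\,\|\xi\|_{L^2(\mathbb P;H_{-1/2})}\le\|X_t\|_{L^2(\mathbb P;H_{-r})}<\infty.$$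
   Context: $[\cdot]$ denotes the equivalence class modulo $\mu_{(0,1)}$-a.e. equality; $\mathcal L^2(\mu_{(0,1)};\mathbb R)$ is the set of square-integrable measurable functions. A stochastic basis is a probability space with a normal filtration (right-continuous, with $\mathcal F_0$ containing all $\mathbb P$-null sets). A process is $(\mathcal F_t)$-predictable if it is measurable with respect to the sigma-algebra on $[0,T]\times\Omega$ generated by the sets $(s,t]\times C$ with $s<t$ in $[0,T]$, $C\in\mathcal F_s$, and $\{0\}\times C$ with $C\in\mathcal F_0$. Interpolation spaces associated to $\eta-A$: for $q\ge0$, $H_q=D((\eta-A)^q)$ with $\|v\|_{H_q}=\|(\eta-A)^qv\|_H$; for $q<0$, $H_q$ is the completion of $H$ with respect to $\|v\|_{H_q}=\|(\eta-A)^qv\|_H$; the semigroup operators $e^{tA}$ are extended to the spaces $H_q$ in the usual way. The spaces are nested ($H_q\subseteq H_{q'}$ for $q\ge q'$). $L(V,W)$ is the space of bounded linear operators and $HS(V,W)$ the space of Hilbert–Schmidt operators from $V$ to $W$. $\|Z\|_{L^2(\mathbb P;V)}=(\mathbb E\|Z\|_V^2)^{1/2}$. *)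

(* Defs.v *)
From HB Require Import structures.
From mathcomp Require Import all_boot all_order all_algebra finmap.
From mathcomp Require Import all_classical all_reals all_analysis.
From mathcomp Require Import measurable_realfun showcase.summability.

Set Implicit Arguments.
Unset Strict Implicit.
Unset Printing Implicit Defensive.

Import Order.TTheory GRing.Theory Num.Theory.
Import numFieldNormedType.Exports.

Local Open Scope classical_set_scope.
Local Open Scope ring_scope.

Section mu01.
Variable R : realType.

Definition mu01 : {measure set (measurableTypeR R) -> \bar R} :=
  mrestr (@lebesgue_measure R) (measurable_itv `]0%R, 1%R[).

Lemma le12 : (1 <= 2%:E :> \bar R)%E.
Proof. by rewrite lee_fin ler1n. Qed.

(* A function on (0,1) is represented by any function on R extending it. *)
Definition sqint := LfunType mu01 le12.

Definition sqint_eq (f g : sqint) : bool := `[< {ae mu01, forall x, f x = g x} >].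

Lemma sqint_eq_refl : reflexive sqint_eq.
Proof. by move=> f; apply/asboolP; exact: aeW. Qed.

Lemma sqint_eq_sym : symmetric sqint_eq.
Proof.
have H f g : sqint_eq f g -> sqint_eq g f.
  by move=> /asboolP h; apply/asboolP; apply: filterS h => x ->.
by move=> f g; apply/idP/idP; exact: H.
Qed.

Lemma sqint_eq_trans : transitive sqint_eq.
Proof.
move=> g f h /asboolP fg /asboolP gh; apply/asboolP.
by apply: filterS2 fg gh => x -> ->.
Qed.

Canonical sqint_equiv :=
  EquivRel sqint_eq sqint_eq_refl sqint_eq_sym sqint_eq_trans.

(* L^2(mu01) as a quotient; the library type [LspaceType] carries no vector
   space structure. *)
Definition L2 : Type := {eq_quot sqint_eq}%qT.
HB.instance Definition _ := Choice.on L2.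
HB.instance Definition _ := EqQuotient.on L2.

Definition L2class (f : sqint) : L2 := (\pi_L2 f)%qT.

Definition L2rep (h : L2) : sqint := repr h.

Lemma L2repK : cancel L2rep L2class.
Proof. exact: reprK. Qed.

Lemma L2classP (f g : sqint) :
  L2class f = L2class g <-> {ae mu01, forall x, f x = g x}.
Proof.
split; first by move/eqP; rewrite /L2class eqmodE => /asboolP.
by move=> fg; apply/eqP; rewrite /L2class eqmodE; apply/asboolP.
Qed.

Lemma L2rep_class f : {ae mu01, forall x, L2rep (L2class f) x = f x}.
Proof. by apply/L2classP; rewrite L2repK. Qed.

Definition L2zero : L2 := L2class 0.
Definition L2opp (h : L2) : L2 := L2class (- L2rep h).
Definition L2add (h k : L2) : L2 := L2class (L2rep h + L2rep k).
Definition L2scale (a : R) (h : L2) : L2 := L2class (a *: L2rep h).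

Lemma L2addE f g : L2add (L2class f) (L2class g) = L2class (f + g).
Proof.
apply/L2classP; apply: filterS2 (L2rep_class f) (L2rep_class g) => x fx gx.
by rewrite -[LHS]/(L2rep _ x + L2rep _ x) fx gx.
Qed.

Lemma L2oppE f : L2opp (L2class f) = L2class (- f).
Proof.
apply/L2classP; apply: filterS (L2rep_class f) => x fx.
by rewrite -[LHS]/(- L2rep _ x) fx.
Qed.

Lemma L2scaleE a f : L2scale a (L2class f) = L2class (a *: f).
Proof.
apply/L2classP; apply: filterS (L2rep_class f) => x fx.
by rewrite -[LHS]/(a *: L2rep _ x) fx.
Qed.

Lemma L2addA : associative L2add.
Proof.
move=> f g h; rewrite -(L2repK f) -(L2repK g) -(L2repK h).
by rewrite !L2addE addrA.
Qed.

Lemma L2addC : commutative L2add.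
Proof. by move=> f g; rewrite /L2add addrC. Qed.

Lemma L2add0 : left_id L2zero L2add.
Proof. by move=> f; rewrite -(L2repK f) L2addE add0r. Qed.

Lemma L2addN : left_inverse L2zero L2opp L2add.
Proof. by move=> f; rewrite -(L2repK f) L2oppE L2addE addNr. Qed.

HB.instance Definition _ :=
  GRing.isZmodule.Build L2 L2addA L2addC L2add0 L2addN.

Lemma L2scaleA a b v : L2scale a (L2scale b v) = L2scale (a * b) v.
Proof. by rewrite -(L2repK v) !L2scaleE scalerA. Qed.

Lemma L2scale1 : left_id 1 L2scale.
Proof. by move=> v; rewrite -(L2repK v) L2scaleE scale1r. Qed.

Lemma L2scaleDr : right_distributive L2scale +%R.
Proof.
move=> a u v; rewrite -(L2repK u) -(L2repK v).
by rewrite /GRing.add/= L2addE !L2scaleE L2addE scalerDr.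
Qed.

Lemma L2scaleDl v : {morph L2scale^~ v : a b / a + b}.
Proof.
move=> a b; rewrite -(L2repK v).
by rewrite [RHS]/GRing.add/= !L2scaleE L2addE scalerDl.
Qed.

HB.instance Definition _ := GRing.Zmodule_isLmodule.Build R L2
  L2scaleA L2scale1 L2scaleDr L2scaleDl.

Lemma L2classD f g : L2class (f + g) = L2class f + L2class g.
Proof. by rewrite -L2addE. Qed.

Lemma L2classZ a f : L2class (a *: f) = a *: L2class f.
Proof. by rewrite -L2scaleE. Qed.

Definition sqint_norm (f : sqint) : R := fine ('N[mu01]_2%:E [EFin \o f])%E.

Lemma sqint_norm_ae (f g : sqint) : {ae mu01, forall x, f x = g x} ->
  sqint_norm f = sqint_norm g.
Proof.
move=> fg; rewrite /sqint_norm unlock; congr (fine (poweR _ _)).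
have mF (h : sqint) : measurable_fun setT (fun x => `|(EFin \o h) x| `^ 2)%E.
  apply: (measurableT_comp (measurable_poweR _)).
  by apply: measurableT_comp => //; exact/measurable_EFinP.
apply: ae_eq_integral => //; apply: filterS fg => x /= -> //.
Qed.

Definition L2norm (h : L2) : R := sqint_norm (L2rep h).

Lemma L2normE f : L2norm (L2class f) = sqint_norm f.
Proof. exact/sqint_norm_ae/L2rep_class. Qed.

Lemma L2norm_triangle u v : L2norm (u + v) <= L2norm u + L2norm v.
Proof.
rewrite -(L2repK u) -(L2repK v) -L2classD !L2normE; exact: ler_LnormD.
Qed.

Lemma L2normZ a u : L2norm (a *: u) = `|a| * L2norm u.
Proof.
rewrite -(L2repK u) -L2classZ !L2normE /sqint_norm.
by rewrite (LnormZ (L2rep u) a) fineM// -finite_norm_fine.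
Qed.

Lemma L2norm_eq0 u : L2norm u = 0 -> u = 0.
Proof.
rewrite -(L2repK u) L2normE => /fine_Lnormr_eq0 u0.
by apply/L2classP; apply: filterS u0 => x /(_ I).
Qed.

HB.instance Definition _ := Lmodule_isNormed.Build R L2
  L2norm_triangle L2normZ L2norm_eq0.

(* The class of a function, with value 0 when it is not square-integrable. *)
Definition cls (f : R -> R) : L2 := L2class (insubd (0 : sqint) f).

Definition dot (h k : L2) : R :=
  Rintegral mu01 setT (fun x => L2rep h x * L2rep k x).

End mu01.

Section diagonal_calculus.
Variables (R : realType) (b : int -> L2 R) (A : L2 R -> L2 R).

(* For an operator A diagonal with respect to the orthonormal basis b, the
   eigenvalue belonging to b n is <b n, A (b n)>. *)
Definition eigval (n : int) : R := dot (b n) (A (b n)).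

Definition fcalc_dom (f : R -> R) : set (L2 R) :=
  [set v | (\esum_(n in [set: int])
              (`|f (eigval n) * dot (b n) v| ^+ 2)%:E < +oo)%E].

(* [sum] is the unconditional sum, along the filter of finite index sets. *)
Definition fcalc (f : R -> R) (v : L2 R) : L2 R :=
  sum (fun n : int => (f (eigval n) * dot (b n) v) *: b n).

Definition fracpow_dom (eta q : R) := fcalc_dom (fun a => (eta - a) `^ q).
Definition fracpow (eta q : R) := fcalc (fun a => (eta - a) `^ q).

Definition semigroup (t : R) := fcalc (fun a => expR (t * a)).

End diagonal_calculus.

(* A family (H_q) of interpolation spaces associated to eta - A. All the spaces
   are realized inside one vector space [amb], through the injections [emb q],
   and H itself through [iota], so that the inclusions H_q <= H_q' make sense;
   [amb] carries no topology. *)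
Record interpolation_family (R : realType) (b : int -> L2 R)
    (A : L2 R -> L2 R) (eta : R) := InterpolationFamily {
  amb : lmodType R;
  iota_ : {linear L2 R -> amb};
  iota_inj : injective iota_;
  sp : R -> completeNormedModType R;
  emb : forall q, {linear sp q -> amb};
  emb_inj : forall q, injective (emb q);
  sp_nested : forall q q', q' <= q ->
    exists j : {linear sp q -> sp q'},
      continuous j /\ forall x, emb q' (j x) = emb q x;
  sp_ge0 : forall q, 0 <= q ->
    range (emb q) = iota_ @` fracpow_dom b A eta q;
  sp_lt0_dense : forall q, q < 0 ->
    range iota_ `<=` range (emb q) /\ dense (emb q @^-1` range iota_);
  sp_norm : forall q (x : sp q) (v : L2 R), emb q x = iota_ v ->
    `|x| = `|fracpow b A eta q v|
}.

Section operators.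
Variables (R : realType) (b : int -> L2 R) (A : L2 R -> L2 R) (eta : R).
Variable HH : interpolation_family b A eta.

(* The H_q-norm of an element of [amb]; it is +oo outside H_q. *)
Definition enorm (q : R) (x : amb HH) : \bar R :=
  ereal_inf [set `|y|%:E | y in emb HH q @^-1` [set x]].

Definition toH (x : amb HH) : L2 R := xget 0 (iota_ HH @^-1` [set x]).

Definition semigroup_extension (S : forall q, R -> sp HH q -> sp HH q) :=
  forall q t, 0 <= t ->
    [/\ linear (S q t), continuous (S q t) &
        forall x v, emb HH q x = iota_ HH v ->
          emb HH q (S q t x) = iota_ HH (semigroup b A t v)].

(* The squared norm of HS(H, H_q), computed in the orthonormal basis b. *)
Definition HSnorm2 (q : R) (Phi : L2 R -> amb HH) : \bar R :=
  (\esum_(n in [set: int]) enorm q (Phi (b n)) ^+ 2)%E.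

Definition HSop (q : R) (Phi : L2 R -> sp HH q) :=
  [/\ linear Phi, continuous Phi & (HSnorm2 q (emb HH q \o Phi) < +oo)%E].

Definition bounded_to_HS (q : R) (B : L2 R -> L2 R -> sp HH q) :=
  [/\ forall v, HSop (B v),
      forall a v w h, B (a *: v + w) h = a *: B v h + B w h &
      exists C : R, forall v,
        (HSnorm2 q (emb HH q \o B v) <= (C * `|v| ^+ 2)%:E)%E].

(* The process s |-> e^{(t-s)A} B(Y_s), as an operator from H into [amb]. *)
Definition mild_integrand (Omega : Type) (q delta : R)
    (S : forall q, R -> sp HH q -> sp HH q) (B : L2 R -> L2 R -> sp HH q)
    (Y : R -> Omega -> sp HH delta) (t s : R) (w : Omega) (h : L2 R) : amb HH :=
  emb HH q (S q (t - s) (B (toH (emb HH delta (Y s w))) h)).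

Definition rv_norm (d : measure_display) (Omega : measurableType d)
    (P : probability Omega R) (q : R) (Z : Omega -> amb HH) : \bar R :=
  ('N[P]_2%:E[enorm q \o Z])%E.

End operators.

Section stochastics.
Variables (R : realType) (d : measure_display) (Omega : measurableType d).
Variable P : probability Omega R.
Variable T : R.

Definition normal_filtration (F : R -> set (set Omega)) :=
  [/\ forall t, 0 <= t <= T -> sigma_algebra setT (F t) /\ F t `<=` measurable,
      forall s t, 0 <= s -> s <= t -> t <= T -> F s `<=` F t,
      forall t, 0 <= t < T ->
        F t = \bigcap_(s in [set s | t < s <= T]) F s &
      forall N, measurable N -> P N = 0%E -> F 0 N].

Variable F : R -> set (set Omega).

Definition predictable_sigma : set (set (R * Omega)) :=
  <<s `[0, T] `*` setT,
      [set G | (exists s t C,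
                  [/\ 0 <= s, s < t, t <= T, F s C & G = `]s, t] `*` C]) \/
               (exists2 C, F 0 C & G = [set 0] `*` C)] >>.

Definition predictable (V : normedModType R) (X : R -> Omega -> V) :=
  forall O, <<s (@open V) >> O ->
    predictable_sigma [set p | 0 <= p.1 <= T /\ O (X p.1 p.2)].

Definition increment (W : R -> L2 R -> Omega -> R) (s t : R) (h : L2 R)
  (w : Omega) : R := W t h w - W s h w.

(* W t h stands for <h, W_t>. The law of the increments is only prescribed
   for h <> 0 since [normal_prob _ 0] is not the Dirac measure. *)
Record cylindrical_wiener (W : R -> L2 R -> Omega -> R) : Prop := {
  wiener_adapted : forall (t : R) (h : L2 R) (D : set (measurableTypeR R)), 0 <= t <= T ->
    measurable D -> F t (W t h @^-1` D);
  wiener_linear : forall (t a : R) (h k : L2 R), 0 <= t <= T ->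
    {ae P, forall w, W t (a *: h + k) w = a * W t h w + W t k w};
  wiener_0 : forall h, {ae P, forall w, W 0 h w = 0};
  wiener_continuous : forall h,
    {ae P, forall w, {within `[0, T], continuous (fun t => W t h w)}};
  wiener_normal : forall (s t : R) (h : L2 R) (D : set (measurableTypeR R)),
    0 <= s -> s < t -> t <= T -> h != 0 -> measurable D ->
    P (increment W s t h @^-1` D) =
    normal_prob 0 (Num.sqrt (t - s) * `|h|) D;
  wiener_indep : forall (s t : R) (h : L2 R) (C : set Omega) (D : set (measurableTypeR R)),
    0 <= s -> s < t -> t <= T -> F s C -> measurable D ->
    P (C `&` increment W s t h @^-1` D) =
    (P C * P (increment W s t h @^-1` D))%E
}.

End stochastics.

Section ito_integral.
Variables (R : realType) (b : int -> L2 R) (A : L2 R -> L2 R) (eta : R).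
Variable HH : interpolation_family b A eta.
Variables (d : measure_display) (Omega : measurableType d).
Variable P : probability Omega R.

(* The finite-rank elementary process
     sum_i 1_(el_l i, el_r i] 1_(el_C i) <el_h i, .> el_x i. *)
Record elementary (q : R) := Elementary {
  el_size : nat;
  el_l : 'I_el_size -> R;
  el_r : 'I_el_size -> R;
  el_C : 'I_el_size -> set Omega;
  el_h : 'I_el_size -> L2 R;
  el_x : 'I_el_size -> sp HH q
}.

Definition el_adapted (F : R -> set (set Omega)) (t q : R) (G : elementary q) :=
  forall i : 'I_(el_size G),
    [/\ 0 <= el_l i, el_l i <= el_r i, el_r i <= t &
        F (el_l i) (el_C i)].

Definition el_eval (q : R) (G : elementary q) (s : R) (w : Omega) (h : L2 R) :=
  \sum_(i < el_size G)
    (\1_(`]el_l i, el_r i]) s * \1_(el_C i) w * dot (el_h i) h)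
      *: el_x i.

Definition el_integral (q : R) (W : R -> L2 R -> Omega -> R) (G : elementary q)
    (w : Omega) : sp HH q :=
  \sum_(i < el_size G)
    (\1_(el_C i) w * (W (el_r i) (el_h i) w - W (el_l i) (el_h i) w))
      *: el_x i.

(* I is (a version of) the Ito integral int_0^t Phi_s dW_s in H_q of a
   predictable HS(H, H_q)-valued process Phi: the limit in L^2(P; H_q) of the
   integrals of elementary processes that converge to Phi in
   L^2([0,t] x Omega; HS(H, H_q)). *)
Definition is_ito_integral (F : R -> set (set Omega))
    (W : R -> L2 R -> Omega -> R) (q t : R)
    (Phi : R -> Omega -> L2 R -> amb HH) (I : Omega -> sp HH q) :=
  (forall O, <<s (@open (sp HH q)) >> O -> measurable (I @^-1` O)) /\
  exists G : nat -> elementary q,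
    [/\ forall k, el_adapted F t (G k),
        (fun k => \int[lebesgue_measure]_(s in `]0%R, t[) \int[P]_w
           HSnorm2 q (fun h => Phi s w h - emb HH q (el_eval (G k) s w h))%R)%E
          @ \oo --> 0%E &
        (fun k => \int[P]_w (`|I w - el_integral W (G k) w|%R ^+ 2)%:E)%E
          @ \oo --> 0%E].

End ito_integral.

(* Main.v *)
(** Let [c n] be the coordinate along [b n], extended to a space H_q0 that contains
    all the spaces at hand.  The stochastic integral is centred and uncorrelated
    with the initial value, so E<b_n, X_s>^2 >= e^(2 s lam_n) E<b_n, xi>^2.  The
    semigroup fixes the constant function b_0 and B(X_s) is multiplication by
    X_s, so the coordinate along b_0 of the integrand is h |-> <h, X_s>, and the
    Ito isometry gives
      E<b_0, X_t>^2 >= int_0^t E|X_s|^2 ds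
                    >= sum_n (int_0^t e^(-2 (eta - lam_n) s) ds) E<b_n, xi>^2
                    >= (1 - e^(-2 eta t)) / 2 * E|xi|^2 in H_(-1/2),
    while |X_t| in H_(-r) is at least eta^(-r) |<b_0, X_t>|.  The isometry is only
    needed for elementary processes: both inequalities survive the limit that
    defines the stochastic integral. *)

Require Import Defs.
From HB Require Import structures.
From mathcomp Require Import all_boot all_order all_algebra finmap.
From mathcomp Require Import all_classical all_reals all_analysis.
From mathcomp Require Import measurable_realfun showcase.summability.
From mathcomp Require Import ring lra.

Set Implicit Arguments.
Unset Strict Implicit.
Unset Printing Implicit Defensive.

Import Order.TTheory GRing.Theory Num.Theory.
Import numFieldNormedType.Exports.

Local Open Scope classical_set_scope.
Local Open Scope ring_scope.

(** * The inner product of L2 *)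

(** No measurability of [enorm] or [HSnorm2] along random elements is established. Integrals of
    these norms are therefore compared by monotonicity alone, while additivity, exchange of sum and
    integral and monotone convergence are applied to sums of squared real coordinates, which are
    measurable. Neither completeness of H nor totality of [b] is given: both are drawn from the norm
    and the completeness of H_0. The initial value, the solution, the values of [B] and the
    stochastic integral live in different spaces H_q; coordinates on one larger space let their
    equations be tested in the real numbers. Limits are taken with one elementary process at a time,
    through (x + z)^2 <= (1 + e) x^2 + (1 + 1/e) z^2, so second moments may be infinite until
    finiteness is proved. The exponent -1/2 arises as follows. Replacing e^(2 s lam_n) by the
    smaller e^(-2 a s), with a = eta - lam_n > 0, makes the time integral (1 - e^(-2 a t)) / (2 a).
    The factor 1/a is the squared weight of H_(-1/2), and 1/2 becomes 2^(-1/2) after the square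
    root. The shift by eta is uniform in n and covers lam_0 = 0. *)

Section L2_inner_product.
Variable R : realType.
Local Notation mu := (@mu01 R).
Implicit Types u v w : L2 R.
Let aeF : Filter (almost_everywhere mu) := ae_filter_ringOfSetsType mu.
Local Notation aeS := (@filterS _ _ aeF).
Local Notation aeS2 := (@filterS2 _ _ aeF).

Lemma L2rep_Lfun u : (L2rep u : R -> R) \in Lfun mu 2%:E.
Proof. exact: LfunP. Qed.

Lemma Lfun2_measurable (f : R -> R) : f \in Lfun mu 2%:E ->
  measurable_fun [set: measurableTypeR R] f.
Proof. by rewrite inE => /andP[+ _]; rewrite inE. Qed.

Lemma L2rep_measurable u : measurable_fun [set: measurableTypeR R] (L2rep u : R -> R).
Proof. exact: (Lfun2_measurable (L2rep_Lfun u)). Qed.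

Lemma Lfun2M_integrable (f g : R -> R) : f \in Lfun mu 2%:E -> g \in Lfun mu 2%:E ->
  mu.-integrable setT (EFin \o (fun x => f x * g x)).
Proof. by move=> hf hg; apply/Lfun1_integrable; exact: Lfun2_mul_Lfun1. Qed.

Lemma ae_eq_Rintegral (f g : R -> R) :
  measurable_fun [set: measurableTypeR R] f ->
  measurable_fun [set: measurableTypeR R] g ->
  {ae mu, forall x, f x = g x} ->
  Rintegral mu setT f = Rintegral mu setT g.
Proof.
move=> mf mg fg; congr fine; apply: ae_eq_integral => //.
- exact/measurable_EFinP.
- exact/measurable_EFinP.
- by apply: aeS fg => x /= -> _.
Qed.

Lemma cls_ae (f : R -> R) : f \in Lfun mu 2%:E ->
  {ae mu, forall x, L2rep (cls f) x = f x}.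
Proof.
move=> hf; rewrite /cls; have -> : insubd (0 : sqint R) f = Lfun_Sub (@le12 R) hf.
  by apply: val_inj; rewrite insubdK.
exact: L2rep_class.
Qed.

Lemma cls_eq_ae (f g : R -> R) : f \in Lfun mu 2%:E -> g \in Lfun mu 2%:E ->
  {ae mu, forall x, f x = g x} -> cls f = cls g.
Proof.
move=> hf hg fg; rewrite -[cls f]L2repK -[cls g]L2repK; apply/L2classP.
by apply: (@filterS3 _ _ aeF _ _ _ _ _ (cls_ae hf) (cls_ae hg) fg) => x -> ->.
Qed.

Lemma L2rep_cls u : cls (L2rep u : R -> R) = u.
Proof.
rewrite -[RHS]L2repK -[LHS]L2repK; apply/L2classP.
exact: (cls_ae (L2rep_Lfun u)).
Qed.

Lemma dot_cls (f g : R -> R) : f \in Lfun mu 2%:E -> g \in Lfun mu 2%:E ->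
  dot (cls f) (cls g) = Rintegral mu setT (fun x => f x * g x).
Proof.
move=> hf hg; apply: ae_eq_Rintegral.
- by apply: measurable_funM; exact: L2rep_measurable.
- by apply: measurable_funM; exact: Lfun2_measurable.
- by apply: aeS2 (cls_ae hf) (cls_ae hg) => x -> ->.
Qed.

Lemma dotC u v : dot u v = dot v u.
Proof. by apply: eq_Rintegral => x _; rewrite mulrC. Qed.

Lemma dotDl u v w : dot (u + v) w = dot u w + dot v w.
Proof.
have iM a b : mu.-integrable setT (EFin \o (fun x => L2rep a x * L2rep b x)).
  by apply: Lfun2M_integrable; exact: L2rep_Lfun.
rewrite /dot -RintegralD//; apply: ae_eq_Rintegral.
- by apply: measurable_funM; exact: L2rep_measurable.
- by apply: measurable_funD; apply: measurable_funM; exact: L2rep_measurable.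
- have := L2rep_class (L2rep u + L2rep v); rewrite L2classD !L2repK => uv.
  by apply: aeS uv => x ->; rewrite -mulrDl.
Qed.

Lemma dotZl a u v : dot (a *: u) v = a * dot u v.
Proof.
have iM : mu.-integrable setT (EFin \o (fun x => L2rep u x * L2rep v x)).
  by apply: Lfun2M_integrable; exact: L2rep_Lfun.
rewrite /dot -RintegralZl//; apply: ae_eq_Rintegral.
- by apply: measurable_funM; exact: L2rep_measurable.
- by apply: measurable_funM => //; apply: measurable_funM; exact: L2rep_measurable.
- have := L2rep_class (a *: L2rep u); rewrite L2classZ !L2repK => uv.
  by apply: aeS uv => x ->; rewrite mulrA.
Qed.

Lemma dot_normE u : dot u u = `|u| ^+ 2.
Proof.
rewrite -[ `|u| ]/(sqint_norm (L2rep u)) /sqint_norm unlock /dot /Rintegral.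
set f := L2rep u.
have fin : (\int[mu]_x `|(f x)%:E| `^ 2)%E = (\int[mu]_x (f x * f x)%:E)%E.
  apply: eq_integral => x _; rewrite abse_EFin poweR_EFin powR_mulrn//.
  by rewrite real_normK ?num_real// expr2.
rewrite fin.
have /integrable_fin_num -/(_ measurableT) := Lfun2M_integrable (L2rep_Lfun u) (L2rep_Lfun u).
have : (0 <= \int[mu]_x (f x * f x)%:E)%E.
  by apply: integral_ge0 => x _; rewrite lee_fin -expr2 sqr_ge0.
rewrite /comp -/f; case: (integral _ _ _) => //= a; rewrite lee_fin => a0 _.
by rewrite -powR_mulrn ?powR_ge0// -powRrM mulVf// powRr1.
Qed.

Lemma dotDr u v w : dot u (v + w) = dot u v + dot u w.
Proof. by rewrite dotC dotDl !(dotC _ u). Qed.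

Lemma dotZr a u v : dot u (a *: v) = a * dot u v.
Proof. by rewrite dotC dotZl dotC. Qed.

Lemma dotNl u v : dot (- u) v = - dot u v.
Proof. by rewrite -scaleN1r dotZl mulN1r. Qed.

Lemma dotNr u v : dot u (- v) = - dot u v.
Proof. by rewrite dotC dotNl dotC. Qed.

Lemma dotBl u v w : dot (u - v) w = dot u w - dot v w.
Proof. by rewrite dotDl dotNl. Qed.

Lemma dotBr u v w : dot u (v - w) = dot u v - dot u w.
Proof. by rewrite dotDr dotNr. Qed.

Lemma dot0l v : dot 0 v = 0.
Proof. by rewrite -(scale0r 0) dotZl mul0r. Qed.

Lemma dot0r v : dot v 0 = 0.
Proof. by rewrite dotC dot0l. Qed.

Lemma dot_suml (I : Type) (s : seq I) (P : pred I) (f : I -> L2 R) v :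
  dot (\sum_(i <- s | P i) f i) v = \sum_(i <- s | P i) dot (f i) v.
Proof. by elim/big_ind2: _ => [|x a y b <- <-|//]; rewrite ?dot0l ?dotDl. Qed.

Lemma dot_sumr (I : Type) (s : seq I) (P : pred I) (f : I -> L2 R) v :
  dot v (\sum_(i <- s | P i) f i) = \sum_(i <- s | P i) dot v (f i).
Proof. by rewrite dotC dot_suml; apply: eq_bigr => i _; rewrite dotC. Qed.

Lemma dot_CS u v : `|dot u v| <= `|u| * `|v|.
Proof.
have [->|v0] := eqVneq v 0; first by rewrite dot0r !normr0 mulr0.
have nv : 0 < `|v| ^+ 2 by rewrite exprn_gt0// normr_gt0.
rewrite -ler_sqr ?nnegrE ?mulr_ge0// real_normK ?num_real// exprMn.
(* The part of [u] orthogonal to [v], multiplied by |v|^2 to avoid a division. *)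
pose z := (`|v| ^+ 2) *: u - dot u v *: v.
have : 0 <= dot z z by rewrite dot_normE sqr_ge0.
rewrite /z dotBl !dotBr !dotZl !dotZr !dot_normE (dotC v u).
set a := `|u| ^+ 2; set c := `|v| ^+ 2 in nv *; set e := dot u v => H.
have : 0 <= c * (c * a - e ^+ 2) by apply: le_trans H _; lra.
by rewrite pmulr_rge0// subr_ge0 mulrC.
Qed.

End L2_inner_product.

(** * The trigonometric system *)

Section trigonometric_system.
Variable R : realType.
Local Notation mu := (@mu01 R).
Local Notation leb := (@lebesgue_measure R).

Lemma integral_FTC (F f : R -> R) (a c : R) : a < c ->
  (forall x, is_derive x (1 : R) F (f x)) -> continuous f ->
  (\int[leb]_(x in `[a, c]) (f x)%:E)%E = (F c - F a)%:E.
Proof.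
move=> ac dF cf; have cF : continuous F.
  by move=> x; apply/differentiable_continuous/derivable1_diffP; have [] := dF x.
rewrite (@continuous_FTC2 _ f F)//.
- exact: continuous_subspaceT.
- split=> [x _||]; first by have [] := dF x.
  + exact: cvg_at_right_filter (cF a).
  + exact: cvg_at_left_filter (cF c).
- by move=> x _; rewrite derive1E; have [_ ->] := dF x.
Qed.

(** The endpoints are null; the closed interval is the form in which the fundamental theorem of
    calculus applies. *)
Lemma mu01_integral (f : R -> R) : measurable_fun [set: measurableTypeR R] f ->
  (\int[mu]_x (f x)%:E = \int[leb]_(x in `[0%R, 1%R]) (f x)%:E)%E.
Proof.
move=> mf; pose D : set (measurableTypeR R) := `]0%R, 1%R[%classic.
have mD : measurable D by exact: measurable_itv.
have mfE : measurable_fun [set: measurableTypeR R] (EFin \o f) by exact/measurable_EFinP.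
transitivity (\int[mu]_(x in D) (f x)%:E)%E.
  rewrite [RHS]integral_mkcond/=; apply: ae_eq_integral => //.
    apply/(measurable_restrictT _ _).1 => //; exact: measurable_funTS.
  exists (~` D); split => //.
  - exact: measurableC.
  - by rewrite /mu01 /= /mrestr setICl measure0.
  - by move=> x /= h Dx; apply: h => _; rewrite patchE mem_set.
transitivity (\int[leb]_(x in D) (f x)%:E)%E.
  by apply: eq_measure_integral => A mA AD; rewrite /mu01 /= /mrestr setIidl.
by have := @integral_itv_bndoo R 0 1 (EFin \o f) true false => ->; rewrite ?/D//; exact: measurable_funTS.
Qed.

Lemma Rintegral_mu01_FTC (F f : R -> R) :
  (forall x, is_derive x (1 : R) F (f x)) -> continuous f ->
  Rintegral mu setT f = F 1 - F 0.
Proof.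
move=> dF cf; rewrite /Rintegral mu01_integral; last exact: continuous_measurable_fun.
by rewrite (integral_FTC _ dF).
Qed.

Lemma mu01_fin : mu [set: measurableTypeR R] = 1%E.
Proof. by rewrite /mu01 /= /mrestr setTI lebesgue_measure_itv/= lte01 oppr0 adde0. Qed.

Lemma Lfun2_bounded_mul (f g : R -> R) (M : R) :
  measurable_fun [set: measurableTypeR R] f -> (forall x, `|f x| <= M) ->
  g \in Lfun mu 2%:E -> (fun x => g x * f x) \in Lfun mu 2%:E.
Proof.
move=> mf fM hg; have M0 : 0 <= M := le_trans (normr_ge0 _) (fM 0).
have mg := Lfun2_measurable hg.
rewrite inE; apply/andP; split; rewrite inE/=; first exact: measurable_funM.
rewrite /finite_norm unlock poweR_lty//.
have := Lfun_integrable (ler1n _ 2) hg => /integrableP[mi].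
have E0 (h : R -> R) x : (`|(EFin \o h) x| `^ 2)%E = (`|h x| ^+ 2)%:E.
  by rewrite /= powR_mulrn.
under eq_integral => x _ do rewrite gee0_abs ?lee_fin ?powR_ge0// powR_mulrn//.
have mg2 : measurable_fun [set: measurableTypeR R] (fun x => `|g x| ^+ 2).
  by apply: measurable_funX; exact: measurableT_comp.
move=> fin; under eq_integral => x _ do rewrite E0.
apply: (@le_lt_trans _ _ (\int[mu]_x ((M ^+ 2)%:E * (`|g x| ^+ 2)%:E))%E).
  apply: ge0_le_integral => //.
  - apply/measurable_EFinP/measurable_funX; apply: measurableT_comp => //.
    exact: measurable_funM.
  - by apply/measurable_EFinP/measurable_funM.
  - move=> x _; rewrite -EFinM lee_fin normrM exprMn mulrC ler_wpM2r ?sqr_ge0//.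
    by rewrite ler_sqr ?nnegrE.
rewrite ge0_integralZl//=; last 2 first.
- exact/measurable_EFinP.
- by rewrite lee_fin sqr_ge0.
by rewrite lte_mul_pinfty// lee_fin sqr_ge0.
Qed.

Lemma Lfun2_cst1 : (fun=> 1) \in Lfun mu 2%:E.
Proof.
rewrite inE; apply/andP; split; rewrite inE//=.
rewrite /finite_norm unlock poweR_lty//.
under eq_integral => x _ do rewrite /= normr1 powR1.
by rewrite integral_cst// mul1e [X in (X < _)%E](_ : _ = 1%E) ?ltry//; exact: mu01_fin.
Qed.

Lemma Lfun2_bounded (f : R -> R) (M : R) :
  measurable_fun [set: measurableTypeR R] f -> (forall x, `|f x| <= M) ->
  f \in Lfun mu 2%:E.
Proof.
move=> mf fM; have := Lfun2_bounded_mul mf fM Lfun2_cst1.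
by under eq_fun => x do rewrite mul1r.
Qed.

Definition freq (k : int) : R := 2 * k%:~R * pi.

Lemma freqD k l : freq (k + l) = freq k + freq l.
Proof. by rewrite /freq intrD; ring. Qed.

Lemma freqN k : freq (- k) = - freq k.
Proof. by rewrite /freq intrN; ring. Qed.

(** The unit interval contains a whole number of periods, so the boundary terms at 1 equal those at
    0 in the integrals below. *)
Lemma cos_sin_freq k : (cos (freq k) = 1) * (sin (freq k) = 0).
Proof.
have nat_case (n : nat) : (cos (freq n) = 1) * (sin (freq n) = 0).
  have -> : freq n = 0 + (pi *+ 2) *+ n.
    by rewrite add0r /freq -pmulrn -[RHS]mulr_natr -[pi *+ 2]mulr_natr; ring.
  by rewrite (periodicn (@cosD2pi R)) (periodicn (@sinD2pi R)) cos0 sin0.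
case: (intP k) => [|n|n]; rewrite ?freqN ?cosN ?sinN ?(nat_case n.+1) ?oppr0//.
exact: (nat_case 0%N).
Qed.

Lemma is_derive_mull (a x : R) : is_derive x (1 : R) (fun y : R => a * y) a.
Proof. by have := @is_deriveZ R R R id a x 1 1; rewrite [a *: 1]mulr1; apply. Qed.

Lemma continuous_mull (a : R) : continuous (fun y : R => a * y).
Proof. by move=> x; apply: cvgM; [exact: cvg_cst|exact: cvg_id]. Qed.

Lemma continuous_cos_freq k : continuous (fun x : R => cos (freq k * x)).
Proof.
move=> x; apply: (@continuous_comp _ _ _ (fun y : R => freq k * y) cos).
  exact: continuous_mull.
exact: continuous_cos.
Qed.

Lemma continuous_sin_freq k : continuous (fun x : R => sin (freq k * x)).
Proof.
move=> x; apply: (@continuous_comp _ _ _ (fun y : R => freq k * y) sin).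
  exact: continuous_mull.
exact: continuous_sin.
Qed.

Lemma Rintegral_cos_freq k : Rintegral mu setT (fun x : R => cos (freq k * x)) = (k == 0)%:R.
Proof.
have [->|k0] := eqVneq k 0.
  under eq_Rintegral => x _ do rewrite /freq mulr0 !mul0r cos0.
  rewrite (@Rintegral_mu01_FTC id)/= ?subr0//; exact: cst_continuous.
have w0 : freq k != 0 by rewrite !mulf_neq0 ?intr_eq0// gt_eqF// pi_gt0.
have dF (x : R) : is_derive x (1 : R) (fun x => (freq k)^-1 * sin (freq k * x))
    (cos (freq k * x)).
  have := @is_deriveZ R R R _ (freq k)^-1 x 1 _
    (is_derive1_comp (is_derive_sin _) (is_derive_mull (freq k) x)).
  by rewrite /GRing.scale/= mulrCA mulVf ?mulr1.
rewrite (Rintegral_mu01_FTC dF).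
  by rewrite mulr0 sin0 mulr1 cos_sin_freq mulr0 subr0.
exact: continuous_cos_freq.
Qed.

Lemma Rintegral_sin_freq k : Rintegral mu setT (fun x : R => sin (freq k * x)) = 0.
Proof.
have [->|k0] := eqVneq k 0.
  under eq_Rintegral => x _ do rewrite /freq mulr0 !mul0r sin0.
  rewrite (@Rintegral_mu01_FTC (cst 0))/= ?subr0//; exact: cst_continuous.
have w0 : freq k != 0 by rewrite !mulf_neq0 ?intr_eq0// gt_eqF// pi_gt0.
have dF (x : R) : is_derive x (1 : R) (fun x => - (freq k)^-1 * cos (freq k * x))
    (sin (freq k * x)).
  have := @is_deriveZ R R R _ (- (freq k)^-1) x 1 _
    (is_derive1_comp (is_derive_cos _) (is_derive_mull (freq k) x)).
  rewrite /GRing.scale/= => H; apply: is_derive_eq H _.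
  by move: w0; set a := freq k => a0; field.
rewrite (Rintegral_mu01_FTC dF).
  by rewrite mulr0 cos0 mulr1 cos_sin_freq mulr1 subrr.
exact: continuous_sin_freq.
Qed.

(** [Negz m] is the integer -(m + 1), hence the frequency [m.+1] in the sine. The functions live on
    all of R, so they are continuous there and restriction to (0,1) is left to [mu01]. *)
Definition trig (n : int) : R -> R :=
  match n with
  | Posz 0 => fun=> 1
  | Posz m => fun x => Num.sqrt 2 * cos (freq m * x)
  | Negz m => fun x => Num.sqrt 2 * sin (freq m.+1 * x)
  end.

Lemma trig_continuous n : continuous (trig n).
Proof.
case: n => [[|m]|m] x /=; first exact: cvg_cst.
- apply: cvgM; first exact: cvg_cst.
  exact: continuous_cos_freq.
- apply: cvgM; first exact: cvg_cst.
  exact: continuous_sin_freq.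
Qed.

Lemma trig_measurable n : measurable_fun [set: measurableTypeR R] (trig n).
Proof. exact: (continuous_measurable_fun (@trig_continuous n)). Qed.

Lemma trig_bounded n x : `|trig n x| <= Num.sqrt 2.
Proof.
have s1 : 1 <= Num.sqrt 2 :> R by rewrite -[leLHS]sqrtr1 ler_sqrt// ler1n.
case: n => [[|m]|m] /=; rewrite ?normr1// normrM ger0_norm ?sqrtr_ge0//.
- by rewrite ler_piMr ?sqrtr_ge0// cos_max.
- by rewrite ler_piMr ?sqrtr_ge0// sin_max.
Qed.

Lemma trig_Lfun n : trig n \in Lfun mu 2%:E.
Proof. exact: Lfun2_bounded (trig_measurable n) (trig_bounded n). Qed.

Lemma Rintegral_trig_product (c1 c2 : R) (f1 f2 : R -> R) :
  continuous f1 -> continuous f2 ->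
  (forall x, `|f1 x| <= 1) -> (forall x, `|f2 x| <= 1) ->
  Rintegral mu setT (fun x => c1 * f1 x + c2 * f2 x) =
  c1 * Rintegral mu setT f1 + c2 * Rintegral mu setT f2.
Proof.
move=> cf1 cf2 b1 b2.
have I f : continuous f -> (forall x, `|f x| <= 1) -> mu.-integrable setT (EFin \o f).
  move=> cf bf; have Lf := Lfun2_bounded (continuous_measurable_fun cf) bf.
  have := Lfun2M_integrable Lfun2_cst1 Lf.
  by apply: eq_integrable => // x _; rewrite /= mul1r.
rewrite RintegralD//; last 2 first.
- by have := integrableZl measurableT c1 (I _ cf1 b1); apply: eq_integrable.
- by have := integrableZl measurableT c2 (I _ cf2 b2); apply: eq_integrable.
by rewrite !RintegralZl//; exact: I.
Qed.

(** Product-to-sum formulas turn each product into two waves of frequencies k - l and k + l, and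
    only a cosine of frequency 0 has a nonzero integral. For positive k and l the frequency k + l
    never vanishes, so only k = l contributes. *)
Lemma trig_orthonormal m n :
  Rintegral mu setT (fun x => trig m x * trig n x) = (m == n)%:R.
Proof.
have C := continuous_cos_freq.
have S := continuous_sin_freq.
have C1 k (x : R) : `|cos (freq k * x)| <= 1 by exact: cos_max.
have S1 k (x : R) : `|sin (freq k * x)| <= 1 by exact: sin_max.
have s2 : Num.sqrt 2 * Num.sqrt 2 = 2 :> R by rewrite -expr2 sqr_sqrtr.
have cc k l x : (Num.sqrt 2 * cos (freq k * x)) * (Num.sqrt 2 * cos (freq l * x)) =
    1 * cos (freq (k - l) * x) + 1 * cos (freq (k + l) * x).
  rewrite !freqD freqN mulrBl mulrDl cosB cosD mulrACA s2; ring.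
have ss k l x : (Num.sqrt 2 * sin (freq k * x)) * (Num.sqrt 2 * sin (freq l * x)) =
    1 * cos (freq (k - l) * x) + (-1) * cos (freq (k + l) * x).
  rewrite !freqD freqN mulrBl mulrDl cosB cosD mulrACA s2; ring.
have sc k l x : (Num.sqrt 2 * sin (freq k * x)) * (Num.sqrt 2 * cos (freq l * x)) =
    1 * sin (freq (k - l) * x) + 1 * sin (freq (k + l) * x).
  rewrite !freqD freqN mulrBl mulrDl sinB sinD mulrACA s2; ring.
(* The products with the constant function get a second term with coefficient 0, to match the
   two-term shape of [Rintegral_trig_product]. *)
have one x : 1 * 1 = 1 * cos (freq 0 * x) + 0 * cos (freq 0 * x) :> R.
  by rewrite /freq mulr0 !mul0r cos0 addr0.
have onec k x : 1 * (Num.sqrt 2 * cos (freq k * x)) = Num.sqrt 2 * cos (freq k * x) + 0 * cos (freq k * x).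
  by rewrite mul1r mul0r addr0.
have ones k x : 1 * (Num.sqrt 2 * sin (freq k * x)) = Num.sqrt 2 * sin (freq k * x) + 0 * sin (freq k * x).
  by rewrite mul1r mul0r addr0.
have PN (k l : nat) : (Posz k.+1 + Posz l.+1 == 0) = false by [].
wlog : m n / (exists k, m = Negz k) \/ (exists k l, m = Posz k /\ n = Posz l).
  move=> H; case: m => m; last by apply: H; left; exists m.
  case: n => n; first by apply: H; right; exists m, n.
  under eq_Rintegral => x _ do rewrite mulrC.
  by rewrite H//; left; exists n.
case=> [[k ->]|[k [l [-> ->]]]].
- case: n => [[|n]|n] /=.
  + under eq_Rintegral => x _ do rewrite mulrC ones.
    by rewrite Rintegral_trig_product// !Rintegral_sin_freq !mulr0 addr0.
  + under eq_Rintegral => x _ do rewrite sc.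
    by rewrite Rintegral_trig_product// !Rintegral_sin_freq !mulr0 addr0.
  + under eq_Rintegral => x _ do rewrite ss.
    rewrite Rintegral_trig_product// !Rintegral_cos_freq PN mulr0 addr0 mul1r.
    by rewrite subr_eq0 !NegzE eqr_opp.
- case: k l => [|k] [|l] /=.
  + under eq_Rintegral => x _ do rewrite (one x).
    by rewrite Rintegral_trig_product// !Rintegral_cos_freq mul0r addr0 mul1r.
  + under eq_Rintegral => x _ do rewrite onec.
    by rewrite Rintegral_trig_product// !Rintegral_cos_freq !mulr0 addr0.
  + under eq_Rintegral => x _ do rewrite mulrC onec.
    by rewrite Rintegral_trig_product// !Rintegral_cos_freq !mulr0 addr0.
  + under eq_Rintegral => x _ do rewrite cc.
    rewrite Rintegral_trig_product// !Rintegral_cos_freq PN mulr0 addr0 mul1r.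
    by rewrite subr_eq0.
Qed.

Lemma dot_trig m n : dot (cls (trig m)) (cls (trig n)) = (m == n)%:R.
Proof. by rewrite dot_cls ?trig_orthonormal//; exact: trig_Lfun. Qed.

End trigonometric_system.

(** * Unconditional sums and orthonormal expansions *)

Section esum_fset_sums.
Variables (R : realType) (I : choiceType).
Implicit Types A : {fset I}.

Lemma fsum_le_esum (a : I -> \bar R) A :
  (\sum_(i <- A) a i <= \esum_(i in [set: I]) a i)%E.
Proof.
apply: esum_ge; exists [set` A] => //.
by rewrite fsbig_finite//= set_fsetK.
Qed.

Lemma esum_leP (a : I -> \bar R) (M : \bar R) :
  (forall A, (\sum_(i <- A) a i <= M)%E) -> (\esum_(i in [set: I]) a i <= M)%E.
Proof.
move=> aM; apply: ge_ereal_sup => _ [X [finX _] <-].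
by rewrite fsbig_finite//.
Qed.

End esum_fset_sums.

#[local] Existing Instance totally_filter.

Lemma fsum_split (I : choiceType) (V : nmodType) (f : I -> V) (J K : {fset I}) :
  (J `<=` K)%fset ->
  \sum_(i <- K) f i = \sum_(i <- J) f i + \sum_(i <- (K `\` J)%fset) f i.
Proof.
move=> JK; rewrite (big_fsetID _ (mem J))/=; congr (_ + _).
  congr bigop; congr enum_fset; apply/fsetP => i; rewrite !inE/=.
  by case: (boolP (i \in J)) => [/(fsubsetP JK) ->|]; rewrite ?andbF.
by congr bigop; congr enum_fset; apply/fsetP => i; rewrite !inE/= andbC.
Qed.

Section orthonormal_expansions.
Variables (R : realType) (b : int -> L2 R).
Hypothesis hb : forall m n, dot (b m) (b n) = (m == n)%:R.
Implicit Types (a : int -> R) (A B : {fset int}) (v : L2 R).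

Lemma dot_fsum a A n :
  dot (b n) (\sum_(i <- A) a i *: b i) = if n \in A then a n else 0.
Proof.
rewrite dot_sumr; under eq_bigr => i _ do rewrite dotZr hb.
case: ifPn => nA.
  rewrite (big_fsetD1 n)//= eqxx mulr1 big_seq big1 ?addr0// => i.
  by rewrite !inE => /andP[ne _]; rewrite eq_sym (negbTE ne) mulr0.
rewrite big_seq big1// => i iA; case: eqP => [ni|]; last by rewrite mulr0.
by rewrite ni iA in nA.
Qed.

Lemma norm_fsum a A : `|\sum_(i <- A) a i *: b i| ^+ 2 = \sum_(i <- A) a i ^+ 2.
Proof.
rewrite -dot_normE dot_suml big_seq [RHS]big_seq; apply: eq_bigr => i iA.
by rewrite dotZl dot_fsum iA expr2.
Qed.

Lemma bessel v A : \sum_(i <- A) dot (b i) v ^+ 2 <= `|v| ^+ 2.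
Proof.
pose y := \sum_(i <- A) dot (b i) v *: b i.
have : 0 <= dot (v - y) (v - y) by rewrite dot_normE sqr_ge0.
have vy : dot v y = \sum_(i <- A) dot (b i) v ^+ 2.
  by rewrite dot_sumr; apply: eq_bigr => i _; rewrite dotZr dotC expr2.
rewrite dotBl !dotBr (dotC y v) vy !dot_normE norm_fsum subrr subr0.
by rewrite subr_ge0.
Qed.

Lemma dot_cvg (T : Type) (F : set_system T) (FF : Filter F) (f : T -> L2 R) y v :
  f x @[x --> F] --> y -> dot v (f x) @[x --> F] --> dot v y.
Proof.
move=> fy; apply/cvgrPdist_le => e e0.
have v1 : 0 < `|v| + 1 by rewrite ltr_pwDr.
have : \forall x \near F, `|y - f x| <= e / (`|v| + 1).
  by move/cvgrPdist_le : fy; apply; rewrite divr_gt0.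
apply: filterS => x hx; rewrite -dotBr (le_trans (dot_CS _ _))//.
rewrite (le_trans (ler_wpM2l (normr_ge0 _) hx))// mulrA ler_pdivrMr// mulrC.
by rewrite ler_pM2l// lerDl.
Qed.

Lemma partial_sumE (V : zmodType) (f : int -> V) A :
  partial_sum f A = \sum_(i <- A) f i.
Proof. by rewrite big_seq_fsetE. Qed.

(** Once the finite index set contains [n], the coordinate along [b n] of the partial sum is
    constantly [a n]. *)
Lemma dot_lim_sum a y : partial_sum (fun n => a n *: b n) A @[A --> totally] --> y ->
  forall n, dot (b n) y = a n.
Proof.
move=> ay n.
have /(cvg_lim (@Rhausdorff R)) <- : dot (b n) (partial_sum (fun n => a n *: b n) A)
  @[A --> totally] --> dot (b n) y by exact: dot_cvg.
apply: cvg_lim; first exact: Rhausdorff.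
apply: cvg_near_cst; exists [fset n]%fset => // A /=.
by rewrite fsub1set => nA; rewrite partial_sumE dot_fsum nA.
Qed.

Lemma sum_fsupp (V : normedModType R) (f : int -> V) A :
  (forall i, i \notin A -> f i = 0) ->
  partial_sum f B @[B --> totally] --> \sum_(i <- A) f i.
Proof.
move=> f0; apply: cvg_near_cst; exists A => // B /= AB.
rewrite partial_sumE (fsum_split _ AB) [X in _ + X]big_seq [X in _ + X]big1 ?addr0// => i.
by rewrite inE => /andP[/f0].
Qed.

Lemma sum_lim (V : normedModType R) (f : int -> V) y :
  partial_sum f B @[B --> totally] --> y -> sum f = y.
Proof. by move=> fy; apply: cvg_lim fy; exact: norm_hausdorff. Qed.

Lemma norm2_lim_le (V : normedModType R) (T : Type) (F : set_system T)
  (FF : ProperFilter F) (f : T -> V) y M :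
  f x @[x --> F] --> y -> (\forall x \near F, `|f x| ^+ 2 <= M) -> `|y| ^+ 2 <= M.
Proof.
move=> fy fM; have M0 : 0 <= M.
  by have [x] := filter_ex fM; apply: le_trans; exact: sqr_ge0.
suff : `|y| <= Num.sqrt M.
  by rewrite -ler_sqr ?nnegrE ?sqrtr_ge0// sqr_sqrtr.
apply: (cvgr_to_le (cvg_norm fy)); apply: filterS fM => x h.
by rewrite -ler_sqr ?nnegrE ?sqrtr_ge0// sqr_sqrtr.
Qed.

End orthonormal_expansions.

(** * Interpolation spaces *)

Section interpolation_spaces.
Variables (R : realType) (b : int -> L2 R) (A : L2 R -> L2 R) (eta : R).
Hypothesis hb : forall m n, dot (b m) (b n) = (m == n)%:R.
Hypothesis heta : 0 < eta.
Hypothesis eigval_le0 : forall n, eigval b A n <= 0.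
Variable HH : interpolation_family b A eta.
Local Notation iota := (iota_ HH).
Local Notation lam := (eigval b A).
Implicit Types (J K : {fset int}) (v : L2 R) (q : R).

(** The eigenvalue of (eta - A)^q at [b n]: the H_q-norm is the l^2-norm of the coordinates with
    these weights. *)
Definition weight q (n : int) : R := (eta - lam n) `^ q.
Local Notation wt := weight.

Lemma gap_gt0 n : 0 < eta - lam n.
Proof. by rewrite subr_gt0 (le_lt_trans (eigval_le0 n)). Qed.

Lemma weight_gt0 q n : 0 < wt q n.
Proof. exact/powR_gt0/gap_gt0. Qed.

Lemma weight_le q n : q <= 0 -> wt q n <= eta `^ q.
Proof.
move=> q0; rewrite /weight -[q]opprK !(powRN _ (- q)).
rewrite lef_pV2 ?posrE ?powR_gt0 ?gap_gt0//.
rewrite ge0_ler_powR ?oppr_ge0 ?nnegrE ?(ltW heta) ?(ltW (gap_gt0 n))//.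
by rewrite lerDl oppr_ge0.
Qed.

Lemma fcalc_domP (f : R -> R) v :
  fcalc_dom b A f v <->
  exists M, forall J, \sum_(i <- J) (f (lam i) * dot (b i) v) ^+ 2 <= M.
Proof.
have sq i : `|f (lam i) * dot (b i) v| ^+ 2 = (f (lam i) * dot (b i) v) ^+ 2.
  by rewrite real_normK ?num_real.
rewrite /fcalc_dom /=; under eq_esum => i _ do rewrite sq.
have sq0 i : 0 <= (f (lam i) * dot (b i) v) ^+ 2 by exact: sqr_ge0.
split=> [fin|[M fM]].
  have E0 : (0 <= \esum_(n in [set: int]) ((f (lam n) * dot (b n) v) ^+ 2)%:E)%E.
    by apply: esum_ge0 => i _; rewrite lee_fin.
  exists (fine (\esum_(n in [set: int]) ((f (lam n) * dot (b n) v) ^+ 2)%:E)) => J.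
  by rewrite -lee_fin fineK ?ge0_fin_numE// -sumEFin; exact: fsum_le_esum.
apply: (@le_lt_trans _ _ M%:E); last exact: ltry.
by apply: esum_leP => J; rewrite sumEFin lee_fin.
Qed.

Lemma range_emb0 v : range (emb HH 0) (iota v).
Proof.
rewrite sp_ge0//; exists v => //; apply/fcalc_domP; exists (`|v| ^+ 2) => J.
under eq_bigr => i _ do rewrite powRr0 mul1r.
exact: bessel.
Qed.

Lemma fracpow_fsum q (a : int -> R) J :
  fracpow b A eta q (\sum_(i <- J) a i *: b i) = \sum_(i <- J) (wt q i * a i) *: b i.
Proof.
rewrite /fracpow /fcalc; apply: sum_lim.
have -> : \sum_(i <- J) (wt q i * a i) *: b i =
    \sum_(i <- J) (wt q i * dot (b i) (\sum_(j <- J) a j *: b j)) *: b i.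
  by rewrite big_seq [RHS]big_seq; apply: eq_bigr => i iJ; rewrite dot_fsum// iJ.
by apply: sum_fsupp => i iJ; rewrite dot_fsum// (negbTE iJ) mulr0 scale0r.
Qed.

Lemma sp_normE q (x : sp HH q) v : emb HH q x = iota v -> `|x| = `|fracpow b A eta q v|.
Proof. exact: sp_norm. Qed.

(* The junk value of a divergent sum is 0, so a vector with divergent Fourier
   series would have norm 0 in H_0. *)
Lemma fourier_expansion v :
  partial_sum (fun n => dot (b n) v *: b n) J @[J --> totally] --> v.
Proof.
have w0 n : wt 0 n = 1 by exact: powRr0.
have fE v' : fracpow b A eta 0 v' = lim (partial_sum (fun n => dot (b n) v' *: b n) J @[J --> totally]).
  rewrite -[LHS]/(lim (partial_sum (fun n => (wt 0 n * dot (b n) v') *: b n) J @[J --> totally])).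
  suff -> : (fun n : int => (wt 0 n * dot (b n) v') *: b n) = (fun n => dot (b n) v' *: b n) by [].
  by apply/funext => n; rewrite w0 mul1r.
have zero v' : fracpow b A eta 0 v' = 0 -> v' = 0.
  move=> f0; have [x _ xv] := range_emb0 v'.
  have := sp_normE xv; rewrite f0 normr0 => /eqP; rewrite normr_eq0 => /eqP x0.
  by apply: (@iota_inj _ _ _ _ HH); rewrite -xv x0 !raddf0.
(* If the series diverged, its default sum 0 would be [fracpow] of [v] at exponent 0, so [v] would
   vanish by [zero]; but the series of 0 converges. *)
have cv : cvg (partial_sum (fun n => dot (b n) v *: b n) J @[J --> totally]).
  apply: contrapT => dv; have v0 : v = 0 by apply: zero; rewrite fE dvgP.
  apply: dv; apply/cvg_ex; exists 0.
  rewrite [X in _ --> X](_ : 0 = \sum_(i <- fset0) dot (b i) v *: b i).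
    by apply: sum_fsupp => i _; rewrite v0 dot0r scale0r.
  by rewrite (big_seq_fset0 +%R).
(* The remainder has no coordinates, so its series sums to 0 and [zero] kills it: this is totality
   of [b]. *)
set y := lim _ in cv; have yv n : dot (b n) (v - y) = 0.
  by rewrite dotBr (dot_lim_sum hb cv) subrr.
suff /eqP : v - y = 0 by rewrite subr_eq0 => /eqP {2}->.
apply: zero; rewrite fE; apply: cvg_lim; first exact: norm_hausdorff.
rewrite [X in _ --> X](_ : 0 = \sum_(i <- fset0) dot (b i) (v - y) *: b i).
  by apply: sum_fsupp => i _; rewrite yv scale0r.
by rewrite (big_seq_fset0 +%R).
Qed.

Lemma fracpow0 v : fracpow b A eta 0 v = v.
Proof.
apply: sum_lim; rewrite (_ : (fun n => _) = (fun n => dot (b n) v *: b n)).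
  exact: fourier_expansion.
by apply/funext => n; rewrite powRr0 mul1r.
Qed.

Lemma range_emb_le0 q v : q <= 0 -> range (emb HH q) (iota v).
Proof.
rewrite le_eqVlt => /predU1P[->|q0]; first exact: range_emb0.
by have [h _] := sp_lt0_dense HH q0; apply: h; exists v.
Qed.

(** Cauchy criterion along finite index sets. Past a set J whose sum of squares nearly attains the
    supremum, every further block has a small sum of squares. *)
Lemma cvg_totally_summable (V : completeNormedModType R) (y : {fset int} -> V)
    (a : int -> R) (M : R) :
  (forall J, \sum_(i <- J) a i ^+ 2 <= M) ->
  (forall J K, (J `<=` K)%fset ->
     `|y K - y J| ^+ 2 <= \sum_(i <- (K `\` J)%fset) a i ^+ 2) ->
  cvg (y J @[J --> totally]).
Proof.
move=> aM yJK; apply: cauchy_cvg; apply/cauchy_ballP => e e0.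
pose s := sup [set \sum_(i <- J) a i ^+ 2 | J in [set: {fset int}]].
have hs : has_sup [set \sum_(i <- J) a i ^+ 2 | J in [set: {fset int}]].
  split; first by exists (\sum_(i <- fset0) a i ^+ 2); exists fset0.
  by exists M => _ [J _ <-].
(* Two points of the tail are compared through [y J], which allows e / 2 for each, and the
   hypothesis bounds squares. *)
have e4 : 0 < (e / 2) ^+ 2 by rewrite exprn_gt0// divr_gt0.
have [_ [J _ <-] sJ] := sup_adherent e4 hs.
have close K : (J `<=` K)%fset -> `|y K - y J| < e / 2.
  move=> JK; rewrite -ltr_sqr ?nnegrE ?divr_ge0 ?(ltW e0)//.
  apply: le_lt_trans (yJK _ _ JK) _.
  have : \sum_(i <- K) a i ^+ 2 <= s by apply: ub_le_sup; [exact: hs.2|exists K].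
  rewrite (fsum_split _ JK).
  by move: sJ; rewrite -/s; lra.
exists ([set y K | K in [set K | (J `<=` K)%fset]], [set y K | K in [set K | (J `<=` K)%fset]]).
  by split; exists J => // K JK; exists K.
case=> _ _ [/= [K JK <-] [L JL <-]]; rewrite -ball_normE /ball_/=.
have -> : y K - y L = (y K - y J) - (y L - y J) by rewrite opprB addrA subrK.
by rewrite (le_lt_trans (ler_normB _ _))// (splitr e) ltrD// close.
Qed.

(** The condition q <= 0 places every finite sum in H_q; there the norm of a block is its weighted
    l^2-norm, so completeness of H_q yields a limit. *)
Lemma sp_sum_exists q (a : int -> R) M : q <= 0 ->
  (forall J, \sum_(i <- J) (wt q i * a i) ^+ 2 <= M) ->
  exists (y : sp HH q) (yJ : {fset int} -> sp HH q),
  [/\ forall J, emb HH q (yJ J) = iota (\sum_(i <- J) a i *: b i),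
      yJ J @[J --> totally] --> y & `|y| ^+ 2 <= M].
Proof.
move=> q0 aM.
have /choice[yJ yJE] : forall J, exists x, emb HH q x = iota (\sum_(i <- J) a i *: b i).
  by move=> J; have [x _ xE] := range_emb_le0 (\sum_(i <- J) a i *: b i) q0; exists x.
have cvy : cvg (yJ J @[J --> totally]).
  apply: (@cvg_totally_summable _ _ (fun i => wt q i * a i) M) => // J K JK.
  rewrite (@sp_normE _ _ (\sum_(i <- (K `\` J)%fset) a i *: b i)).
    by rewrite fracpow_fsum norm_fsum.
  rewrite raddfB/= !yJE -raddfB/=; congr (iota _).
  rewrite (fsum_split _ JK).
  by rewrite addrAC subrr add0r.
exists (lim (yJ J @[J --> totally])), yJ; split => //.
apply: (@norm2_lim_le _ _ _ (@totally int) _ yJ _ _ cvy); apply: nearW => J.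
by rewrite (sp_normE (yJE J)) fracpow_fsum norm_fsum.
Qed.

(* H is complete because it is isometric to H_0. *)
Lemma riesz_fischer (a : int -> R) M : (forall J, \sum_(i <- J) a i ^+ 2 <= M) ->
  exists v, forall n, dot (b n) v = a n.
Proof.
move=> aM; have [|y [yJ [yJE yJy _]]] := @sp_sum_exists 0 a M (lexx 0).
  by move=> J; under eq_bigr => i _ do rewrite /weight powRr0 mul1r.
have : range (emb HH 0) (emb HH 0 y) by exists y.
rewrite sp_ge0// => -[v _ vy]; exists v; apply: (@dot_lim_sum _ _ hb).
apply/cvgrPdist_le => e e0; move/cvgrPdist_le : yJy => /(_ e e0).
apply: filterS => J; rewrite partial_sumE.
by rewrite (@sp_normE _ _ (v - \sum_(i <- J) a i *: b i)) ?fracpow0// raddfB/= yJE -vy raddfB.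
Qed.

(** On the domain the defining sum is a genuine limit and not a default value: Riesz-Fischer
    provides a vector with these coordinates, and its Fourier series is the sum in question. *)
Lemma fcalc_coord (f : R -> R) v : fcalc_dom b A f v ->
  partial_sum (fun n => (f (lam n) * dot (b n) v) *: b n) J @[J --> totally] --> fcalc b A f v.
Proof.
move=> /fcalc_domP[M /riesz_fischer[y yE]].
have := @fourier_expansion y.
rewrite (_ : (fun n => _) = (fun n => (f (lam n) * dot (b n) v) *: b n)); last first.
  by apply/funext => n; rewrite yE.
by move=> h; rewrite /fcalc (sum_lim h).
Qed.

Lemma dot_fcalc (f : R -> R) v n : fcalc_dom b A f v ->
  dot (b n) (fcalc b A f v) = f (lam n) * dot (b n) v.
Proof. by move=> /fcalc_coord /(dot_lim_sum hb) ->. Qed.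

Lemma norm_fcalc_le (f : R -> R) v M : fcalc_dom b A f v ->
  (forall J, \sum_(i <- J) (f (lam i) * dot (b i) v) ^+ 2 <= M) ->
  `|fcalc b A f v| ^+ 2 <= M.
Proof.
move=> /fcalc_coord h fM; apply: (@norm2_lim_le _ _ _ (@totally int) _ _ _ _ h); apply: nearW => J.
by rewrite partial_sumE norm_fsum.
Qed.

(** For q >= 0 this is how H_q sits in H; for q < 0 the weights are at most eta^q, so Bessel's
    inequality bounds the sums for every vector of H. *)
Lemma fracpow_domP q (x : sp HH q) v : emb HH q x = iota v -> fracpow_dom b A eta q v.
Proof.
move=> xv; have [q0|q0] := leP 0 q.
  have : range (emb HH q) (iota v) by exists x.
  by rewrite sp_ge0// => -[v' dv' /(@iota_inj _ _ _ _ HH) <-].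
apply/fcalc_domP; exists ((eta `^ q) ^+ 2 * `|v| ^+ 2) => J.
apply: le_trans (ler_wpM2l (sqr_ge0 _) (bessel hb v J)).
rewrite mulr_sumr; apply: ler_sum => i _; rewrite exprMn ler_wpM2r ?sqr_ge0//.
by rewrite ler_sqr ?nnegrE ?powR_ge0// (weight_le _ (ltW q0)).
Qed.

Lemma sp_norm_ge q (x : sp HH q) v J : emb HH q x = iota v ->
  \sum_(i <- J) (wt q i * dot (b i) v) ^+ 2 <= `|x| ^+ 2.
Proof.
move=> xv; rewrite (sp_normE xv); apply: le_trans (bessel hb _ J).
by apply: ler_sum => i _; rewrite dot_fcalc//; exact: fracpow_domP xv.
Qed.

Lemma sp_norm_le q (x : sp HH q) v M : emb HH q x = iota v ->
  (forall J, \sum_(i <- J) (wt q i * dot (b i) v) ^+ 2 <= M) -> `|x| ^+ 2 <= M.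
Proof.
by move=> xv; rewrite (sp_normE xv); apply: norm_fcalc_le; exact: fracpow_domP xv.
Qed.

End interpolation_spaces.

(** * Coordinates on interpolation spaces *)

Lemma dense_approx (R : realType) (V : normedModType R) (D : set V) (x : V) (e : R) :
  dense D -> 0 < e -> exists2 y, D y & `|x - y| < e.
Proof.
move=> dD e0; have [|y [/= xy Dy]] := dD (ball x e) _ (ball_open x e).
  by exists x; exact: ballxx.
by exists y => //; move: xy; rewrite -ball_normE.
Qed.

(** Extends coordinate functionals from H to H_q0. An infimum formula gives all values at once and
    satisfies |g x - f v| <= C |x - v| for v in D; linearity and the bound then follow by
    approximating points from D. *)
Lemma dense_linear_extension (R : realType) (V : normedModType R) (D : set V)
    (f : V -> R) (C : R) :
  dense D -> (forall a x y, D x -> D y -> D (a *: x + y)) ->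
  (forall a x y, D x -> D y -> f (a *: x + y) = a * f x + f y) ->
  0 <= C -> (forall x, D x -> `|f x| <= C * `|x|) ->
  exists g : V -> R,
    [/\ forall a x y, g (a *: x + y) = a * g x + g y,
        forall x, `|g x| <= C * `|x| & forall x, D x -> g x = f x].
Proof.
move=> dD Dl fl C0 fC.
have fLip x y : D x -> D y -> `|f x - f y| <= C * `|x - y|.
  move=> Dx Dy; have -> : x - y = -1 *: y + x by rewrite scaleN1r addrC.
  have -> : f x - f y = f (-1 *: y + x) by rewrite fl// mulN1r addrC.
  by apply: fC; exact: Dl.
pose E x := [set f v + C * `|x - v| | v in D].
(* McShane's extension *)
pose g x := inf (E x).
have [v0 Dv0 _] := dense_approx 0 dD ltr01.
(* The infimum is finite because of this lower bound, which is also one half of [gP]. *)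
have lbE x v : D v -> lbound (E x) (f v - C * `|x - v|).
  move=> Dv _ [u Du <-]; rewrite lerBlDr -addrA -mulrDr -lerBlDl.
  apply: le_trans (ler_norm _) (le_trans (fLip _ _ Dv Du) _).
  rewrite ler_wpM2l// (_ : v - u = (x - u) - (x - v)) ?ler_normB//.
  by rewrite opprB [RHS]addrC addrA subrK.
have gP x v : D v -> `|g x - f v| <= C * `|x - v|.
  move=> Dv; rewrite ler_norml lerBlDl lerBrDl; apply/andP; split.
    apply: lb_le_inf; last exact: lbE.
    by exists (f v0 + C * `|x - v0|); exists v0.
  by apply: ge_inf; [exists (f v - C * `|x - v|); exact: lbE|exists v].
have gD x : D x -> g x = f x.
  move=> Dx; have := gP x x Dx; rewrite subrr normr0 mulr0 normr_le0 subr_eq0.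
  by move/eqP.
exists g; split => // [a x y|x].
- apply/eqP; rewrite -subr_eq0 -normr_le0; apply/ler_addgt0Pr => e e0; rewrite add0r.
  (* With approximations within d, the errors at [a *: x + y], at [x] (times |a|) and at [y] add up
     to C (|a| + 1) d + |a| C d + C d = 2 C (|a| + 1) d. The final + 1 keeps [M] positive when C =
     0. *)
  pose M := 2 * C * (`|a| + 1) + 1.
  have M0 : 0 < M by rewrite ltr_pwDr// !mulr_ge0// addr_ge0.
  have d0 : 0 < e / M by rewrite divr_gt0.
  have [x' Dx' xx'] := dense_approx x dD d0.
  have [y' Dy' yy'] := dense_approx y dD d0.
  have h1 := gP x x' Dx'; have h2 := gP y y' Dy'.
  have h3 := gP (a *: x + y) (a *: x' + y') (Dl a _ _ Dx' Dy').
  have h4 : `|a *: x + y - (a *: x' + y')| <= (`|a| + 1) * (e / M).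
    rewrite (_ : _ - _ = a *: (x - x') + (y - y')); last first.
      by rewrite scalerBr opprD addrACA.
    rewrite (le_trans (ler_normD _ _))// mulrDl mul1r lerD ?(ltW yy')//.
    by rewrite normrZ ler_wpM2l// ltW.
  rewrite fl// in h3.
  rewrite (_ : _ - _ = (g (a *: x + y) - (a * f x' + f y')) - a * (g x - f x') - (g y - f y')); last by ring.
  rewrite (le_trans (ler_normB _ _))//.
  have h5 : `|g y - f y'| <= C * (e / M) by apply: le_trans h2 _; rewrite ler_wpM2l// ltW.
  have h6 : `|a * (g x - f x')| <= `|a| * (C * (e / M)).
    by rewrite normrM ler_wpM2l//; apply: le_trans h1 _; rewrite ler_wpM2l// ltW.
  have h7 : `|g (a *: x + y) - (a * f x' + f y')| <= C * ((`|a| + 1) * (e / M)).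
    by apply: le_trans h3 _; rewrite ler_wpM2l.
  have h8 := ler_normB (g (a *: x + y) - (a * f x' + f y')) (a * (g x - f x')).
  have h9 : 2 * C * (`|a| + 1) * (e / M) <= e.
    rewrite mulrA ler_pdivrMr// mulrC ler_pM2l// /M; lra.
  by move: h9; rewrite -!mulrA; lra.
- apply/ler_addgt0Pr => e e0.
  (* The distance to x' enters twice with factor C: once in |x'| <= |x| + |x - x'|, once in |g x - f
     x'|. *)
  have d0 : 0 < e / (2 * C + 1) by rewrite divr_gt0// ltr_pwDr// mulr_ge0.
  have [x' Dx' xx'] := dense_approx x dD d0.
  have h1 := gP x x' Dx'; have h2 := fC _ Dx'.
  have h3 : `|x'| <= `|x| + `|x - x'|.
    by rewrite -[X in `|X| <= _](subrK x) addrC (le_trans (ler_normD _ _))// lerD2l distrC.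
  have h4 : (2 * C) * (e / (2 * C + 1)) <= e.
    rewrite mulrA ler_pdivrMr ?ltr_pwDr ?mulr_ge0//; nra.
  have h5 : C * `|x'| <= C * (`|x| + e / (2 * C + 1)).
    by rewrite ler_wpM2l// (le_trans h3)// lerD2l ltW.
  have h6 : C * `|x - x'| <= C * (e / (2 * C + 1)) by rewrite ler_wpM2l// ltW.
  have h7 : `|g x| <= `|f x'| + `|g x - f x'|.
    by rewrite -[X in `|X| <= _](subrK (f x')) addrC (le_trans (ler_normD _ _)).
  rewrite mulrDr in h5; lra.
Qed.

Section coordinates.
Variables (R : realType) (b : int -> L2 R) (A : L2 R -> L2 R) (eta : R).
Hypothesis hb : forall m n, dot (b m) (b n) = (m == n)%:R.
Hypothesis heta : 0 < eta.
Hypothesis eigval_le0 : forall n, eigval b A n <= 0.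
Variable HH : interpolation_family b A eta.
Local Notation iota := (iota_ HH).
Local Notation lam := (eigval b A).
Local Notation wt := (weight b A eta).
Implicit Types (J K : {fset int}) (v : L2 R) (q : R).

Let wt_gt0 q n : 0 < wt q n. Proof. exact: weight_gt0. Qed.

(** Functionals on [amb] and not on each H_q, so that vectors of different spaces can be compared;
    linearity and boundedness are asked only on the image of H_q0, [amb] having no topology. *)
Definition is_coordinates (q0 : R) (c : int -> amb HH -> R) :=
  [/\ forall n v, c n (iota v) = dot (b n) v,
      forall n a (x y : sp HH q0), c n (a *: emb HH q0 x + emb HH q0 y) =
        a * c n (emb HH q0 x) + c n (emb HH q0 y) &
      forall n, exists2 C, 0 <= C & forall x : sp HH q0, `|c n (emb HH q0 x)| <= C * `|x|].

(** On H one term of the weighted sum gives |<b n, v>| <= (weight q0 n)^(-1) |v| in the H_q0-norm,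
    so each coordinate extends from the dense subspace H to H_q0. *)
Lemma coordinates_exist (q0 : R) : q0 < 0 -> exists c, is_coordinates q0 c.
Proof.
move=> q0n; pose D := emb HH q0 @^-1` range iota.
(* A left inverse for the injections into [amb], with default value 0 off the range. *)
pose inv (X Y : lmodType R) (f : X -> Y) y := xget 0 (f @^-1` [set y]).
have invK (X Y : lmodType R) (f : {linear X -> Y}) x : injective f -> inv X Y f (f x) = x.
  move=> fi; rewrite /inv; case: xgetP => [x' _ /fi //|/(_ x) /(_ erefl) []].
have [sub dD] := sp_lt0_dense HH q0n.
have : forall n, exists g : sp HH q0 -> R,
  [/\ forall a x y, g (a *: x + y) = a * g x + g y,
      (exists2 C, 0 <= C & forall x, `|g x| <= C * `|x|) &
      forall x v, emb HH q0 x = iota v -> g x = dot (b n) v].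
  move=> n; pose h x := dot (b n) (inv _ _ iota (emb HH q0 x)).
  have fE x v : emb HH q0 x = iota v -> h x = dot (b n) v.
    by move=> xv; rewrite /h xv invK//; exact: iota_inj.
  have Dl a x y : D x -> D y -> D (a *: x + y).
    by move=> [v _ vx] [u _ uy]; exists (a *: v + u) => //; rewrite !linearP /= vx uy.
  have [|||g [gl gC gD]] := @dense_linear_extension _ _ D h (wt q0 n)^-1 dD Dl.
  - move=> a x y [v _ vx] [u _ uy].
    by rewrite (fE x v)// (fE y u)// (fE _ (a *: v + u)) ?dotDr ?dotZr// !linearP/= vx uy.
  - by rewrite invr_ge0 ltW.
  - move=> x [v _ vC]; rewrite (fE x v)// mulrC ler_pdivlMr ?wt_gt0//.
    rewrite -ler_sqr ?nnegrE ?mulr_ge0// ?(ltW (wt_gt0 _ _))//.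
    have := @sp_norm_ge _ _ _ _ hb heta eigval_le0 _ _ _ v [fset n]%fset (esym vC).
    by rewrite big_seq_fset1 !exprMn real_normK ?num_real// mulrC.
  exists g; split => //; first by exists (wt q0 n)^-1; rewrite ?invr_ge0 ?(ltW (wt_gt0 _ _)).
  by move=> x v xv; rewrite gD ?(fE _ v)//; exists v.
move=> /choice[g gP]; exists (fun n a => g n (inv _ _ (emb HH q0) a)); split.
- move=> n v; have [x _ xv] : range (emb HH q0) (iota v) by apply: sub; exists v.
  by have [_ _ gE] := gP n; rewrite -xv invK ?(gE _ v)//; exact: emb_inj.
- move=> n a x y; have [gl _ _] := gP n.
  by rewrite -linearP !invK ?gl//; exact: emb_inj.
- move=> n; have [_ [C C0 gC] _] := gP n; exists C => // x.
  by rewrite invK//; exact: emb_inj.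
Qed.

Section coordinates_theory.
Variables (q0 : R) (c : int -> amb HH -> R).
Hypothesis q0_lt0 : q0 < 0.
Hypothesis hc : is_coordinates q0 c.
Local Notation U := (range (emb HH q0)).

Lemma range_emb_nested q q' : q' <= q -> range (emb HH q) `<=` range (emb HH q').
Proof.
by move=> /(sp_nested HH)[j [_ jE]] _ [x _ <-]; exists (j x).
Qed.

Lemma range_emb_sub q (x : sp HH q) : q0 <= q -> U (emb HH q x).
Proof. by move=> /range_emb_nested; apply; exists x. Qed.

Lemma coordinate_iota n v : c n (iota v) = dot (b n) v.
Proof. by have [+ _ _] := hc. Qed.

Lemma coordinate_lin n a x y : U x -> U y -> c n (a *: x + y) = a * c n x + c n y.
Proof. by have [_ + _] := hc => cl [x' _ <-] [y' _ <-]. Qed.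

Lemma coordinateD n x y : U x -> U y -> c n (x + y) = c n x + c n y.
Proof. by move=> Ux Uy; have := coordinate_lin n 1 Ux Uy; rewrite scale1r mul1r. Qed.

Lemma coordinateB n x y : U x -> U y -> c n (x - y) = c n x - c n y.
Proof.
move=> Ux Uy; have := coordinate_lin n (-1) Uy Ux.
by rewrite scaleN1r mulN1r addrC [X in _ = X]addrC.
Qed.

Lemma coordinate_zero n : c n 0 = 0.
Proof. by rewrite -(raddf0 iota) coordinate_iota dot0r. Qed.

Lemma coordinate_bounded q n : q0 <= q ->
  exists2 C, 0 < C & forall x : sp HH q, `|c n (emb HH q x)| <= C * `|x|.
Proof.
move=> q0q; have [j [jc jE]] := sp_nested HH q0q.
have [_ _ /(_ n)[C C0 cC]] := hc.
have /linear_boundedP : bounded_near j (nbhs 0) by apply/linear_bounded_continuous.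
move=> [M [_ /(_ (Num.max M 0 + 1)) jM]].
(* Boundedness near 0 allows any bound strictly above [M]; this choice is also positive. *)
have M1 : 0 < Num.max M 0 + 1 by rewrite ltr_pwDr// le_max lexx orbT.
exists (C * (Num.max M 0 + 1) + 1) => [|x]; first by rewrite ltr_pwDr// mulr_ge0// ltW.
rewrite -jE (le_trans (cC _))// (le_trans (ler_wpM2l C0 (jM _ x)))//.
  by rewrite ltr_pwDr// le_max lexx.
by rewrite mulrA ler_wpM2r// lerDl.
Qed.

Lemma coordinate_continuous q n : q0 <= q -> continuous (fun x : sp HH q => c n (emb HH q x)).
Proof.
move=> q0q x; have [C C0 cC] := coordinate_bounded n q0q.
apply/cvgrPdist_le => e e0; near=> y.
rewrite -coordinateB; [|exact: range_emb_sub..].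
rewrite -raddfB (le_trans (cC _))// mulrC -ler_pdivlMr//.
near: y; apply: cvgr_dist_le; first exact: cvg_id.
by rewrite divr_gt0.
Unshelve. all: by end_near. Qed.

Lemma sp_lt0_approx q (x : sp HH q) (e : R) : q < 0 -> 0 < e ->
  exists (y : sp HH q) v, emb HH q y = iota v /\ `|x - y| < e.
Proof.
move=> /(sp_lt0_dense HH)[_ dD] e0.
by have [y [v _ vy] xy] := dense_approx x dD e0; exists y, v.
Qed.

Lemma dense_eq (V : normedModType R) (D : set V) (f g : V -> R) :
  dense D -> continuous f -> continuous g -> (forall x, D x -> f x = g x) ->
  forall x, f x = g x.
Proof.
move=> dD cf cg fg x; apply/eqP; rewrite -subr_eq0; apply/negP => /negP fx.
have : open [set y | f y - g y != 0].
  rewrite (_ : [set _ | _] = (f \- g) @^-1` [set~ 0]); last first.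
    by apply/seteqP; split => y /eqP.
  apply: open_comp; last exact/closed_openC/accessible_closed_set1/hausdorff_accessible/Rhausdorff.
  by move=> y _; apply: cvgB; [exact: cf|exact: cg].
move=> /(dD _); case; first by exists x.
by move=> y [/= fy /fg yE]; rewrite yE subrr eqxx in fy.
Qed.

(** Nonnegativity is the equation min(f, 0) = 0 between continuous functions, which passes from a
    dense set to the whole space. *)
Lemma dense_ge0 (V : normedModType R) (D : set V) (f : V -> R) :
  dense D -> continuous f -> (forall x, D x -> 0 <= f x) -> forall x, 0 <= f x.
Proof.
move=> dD cf fg x.
have cm : continuous (fun x => Num.min (f x) 0) by move=> y; apply: continuous_min; [exact: cf|exact: cst_continuous].
have c0 : continuous (fun _ : V => 0 : R) by move=> y; exact: cvg_cst.
have := @dense_eq V D (fun x => Num.min (f x) 0) (fun=> 0) dD cm c0.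
move=> /(_ _ x) <-; first by rewrite ge_min lexx.
by move=> y /fg fy; apply/min_idPr.
Qed.

(** Bessel's inequality in H_q. It holds on H; for q < 0 both sides are continuous and H is dense,
    for q >= 0 all of H_q lies in H. *)
Lemma coordinate_fsum_le q (x : sp HH q) J : q0 <= q ->
  \sum_(i <- J) (wt q i * c i (emb HH q x)) ^+ 2 <= `|x| ^+ 2.
Proof.
move=> q0q; have onH (y : sp HH q) v : emb HH q y = iota v ->
    \sum_(i <- J) (wt q i * c i (emb HH q y)) ^+ 2 <= `|y| ^+ 2.
  move=> yv; apply: le_trans (sp_norm_ge hb heta eigval_le0 J yv).
  by apply: ler_sum => i _; rewrite yv coordinate_iota.
have [qge|qlt] := leP 0 q.
  have : range (emb HH q) (emb HH q x) by exists x.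
  by rewrite sp_ge0// => -[v _ /esym]; exact: onH.
have [_ dD] := sp_lt0_dense HH qlt; rewrite -subr_ge0; move: x.
apply: (dense_ge0 dD) => [x|x [v _ /esym /onH]]; last by rewrite subr_ge0.
apply: cvgB; first by apply: (cvg_comp _ (fun r => r ^+ 2)); [exact: norm_continuous|exact: exprn_continuous].
apply: cvg_big => [|i _]; first exact: add_continuous.
apply: (cvg_comp _ (fun r => r ^+ 2)); last exact: exprn_continuous.
by apply: cvgM; [exact: cvg_cst|exact: coordinate_continuous].
Qed.

(** For y in H close to x, the coordinates of y are those of y - x. The norm of y is determined by
    them, so |y| <= |y - x| and |x| <= 2 |x - y|. *)
Lemma coordinate_eq0 x : U x -> (forall n, c n x = 0) -> x = 0.
Proof.
move=> [{}x _ <-] x0; suff -> : x = 0 by rewrite raddf0.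
apply/eqP; rewrite -normr_le0; apply/ler_addgt0Pr => e e0; rewrite add0r.
have e2 : 0 < e / 2 by rewrite divr_gt0.
have [y [v [yv xy]]] := sp_lt0_approx x q0_lt0 e2.
have yx : `|y| <= `|y - x|.
  rewrite -ler_sqr ?nnegrE//; apply: (sp_norm_le hb heta eigval_le0 yv) => J.
  apply: le_trans (coordinate_fsum_le (y - x) J (lexx _)).
  apply: ler_sum => i _; rewrite raddfB/= coordinateB ?x0 ?subr0 ?yv ?coordinate_iota//.
  by rewrite -yv; exists y.
rewrite distrC in yx.
rewrite -(subrK y x) (le_trans (ler_normD _ _))// (splitr e) lerD ?(ltW xy)//.
exact: le_trans yx (ltW xy).
Qed.

(** Converse of Bessel: membership in the smaller space H_q can be read from the coordinates. The
    series built from them converges in H_q, and its limit equals [x] because the coordinates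
    separate points. *)
Lemma sp_of_coords q x M : q0 <= q -> q <= 0 -> U x ->
  (forall J, \sum_(i <- J) (wt q i * c i x) ^+ 2 <= M) ->
  exists2 y : sp HH q, emb HH q y = x & `|y| ^+ 2 <= M.
Proof.
move=> q0q q0' Ux xM; have [y [yJ [yJE yJy yM]]] := sp_sum_exists hb HH q0' xM.
exists y => //; apply/eqP; rewrite -subr_eq0; apply/eqP/coordinate_eq0.
  have [x' _ <-] := Ux; have [y' _ <-] := range_emb_sub y q0q.
  by exists (y' - x') => //; rewrite raddfB.
move=> n; rewrite coordinateB//; last exact: range_emb_sub.
apply/eqP; rewrite subr_eq0; apply/eqP.
have cy : c n (emb HH q (yJ J)) @[J --> totally] --> c n (emb HH q y).
  by apply: (cvg_comp _ (fun z : sp HH q => c n (emb HH q z)) yJy); exact: coordinate_continuous.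
have := cvg_lim (@Rhausdorff R) cy => <-.
apply: cvg_lim; first exact: Rhausdorff.
apply: cvg_near_cst; exists [fset n]%fset => // J /=; rewrite fsub1set => nJ.
by rewrite yJE coordinate_iota dot_fsum// nJ.
Qed.

Lemma enorm_emb q (x : sp HH q) : enorm q (emb HH q x) = `|x|%:E.
Proof.
rewrite /enorm (_ : _ @` _ = [set `|x|%:E]) ?ereal_inf1//.
apply/seteqP; split=> [_ [y /= /emb_inj -> <-]//|_ ->]; exists x => //.
Qed.

(** On H this is the functional calculus, whose domain is everything since e^(t lam) <= 1; density
    and continuity carry it to negative q. *)
Lemma coordinate_semigroup (S : forall q, R -> sp HH q -> sp HH q) q t (x : sp HH q) n :
  semigroup_extension S -> q0 <= q -> 0 <= t ->
  c n (emb HH q (S q t x)) = expR (t * lam n) * c n (emb HH q x).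
Proof.
move=> hS q0q t0; have [_ Sc SE] := hS q t t0.
have onH (y : sp HH q) v : emb HH q y = iota v ->
    c n (emb HH q (S q t y)) = expR (t * lam n) * c n (emb HH q y).
  move=> yv; rewrite (SE _ _ yv) yv !coordinate_iota (dot_fcalc hb HH)//.
  apply/fcalc_domP; exists (`|v| ^+ 2) => J; apply: le_trans (bessel hb v J).
  apply: ler_sum => i _; rewrite exprMn ler_piMl ?sqr_ge0// exprn_ile1 ?expR_ge0//.
  by rewrite -expR0 ler_expR mulr_ge0_le0.
have [qge|qlt] := leP 0 q.
  have : range (emb HH q) (emb HH q x) by exists x.
  by rewrite sp_ge0// => -[v _ /esym]; exact: onH.
have [_ dD] := sp_lt0_dense HH qlt; move: x.
apply: (dense_eq dD) => [x|x|x [v _ /esym /onH]//].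
- by apply: (@continuous_comp _ _ _ (S q t) (fun z => c n (emb HH q z)));
    [exact: Sc|exact: coordinate_continuous].
- by apply: cvgM; [exact: cvg_cst|exact: coordinate_continuous].
Qed.

End coordinates_theory.
End coordinates.

(** * The second moment of a normal law *)

Import HBNNSimple.

Section density.
Local Open Scope ereal_scope.
Context d (T : measurableType d) (R : realType).
Variables (mu nu : {measure set T -> \bar R}) (p : T -> R).
Hypothesis mp : measurable_fun setT p.
Hypothesis p0 : forall x, (0 <= p x)%R.
Hypothesis nuE : forall A, measurable A -> nu A = \int[mu]_(x in A) (p x)%:E.

Let integral_density_nnsfun (f : {nnsfun T >-> R}) :
  \int[nu]_x (f x)%:E = \int[mu]_x ((f x)%:E * (p x)%:E).
Proof.
under [LHS]eq_integral do rewrite fimfunE -fsumEFin//.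
rewrite [LHS]ge0_integral_fsum//; last 2 first.
  - by move=> r; exact/measurable_EFinP/measurableT_comp.
  - by move=> n x _; rewrite EFinM nnfun_muleindic_ge0.
under [RHS]eq_integral.
  move=> x xD; rewrite fimfunE -fsumEFin// ge0_mule_fsuml; last first.
    by move=> r; rewrite EFinM nnfun_muleindic_ge0.
  over.
rewrite [RHS]ge0_integral_fsum//; last 2 first.
  - move=> r; apply: emeasurable_funM; last exact/measurable_EFinP.
    by apply/measurable_EFinP; do 2 apply/measurableT_comp => //.
  - move=> n x _; apply: mule_ge0; last by rewrite lee_fin.
    by rewrite EFinM nnfun_muleindic_ge0.
apply: eq_fsbigr => r _; rewrite integralZl_indic_nnsfun// integral_indic//= setIT nuE//.
have [r0|r0] := ltP r 0%R.
  rewrite preimage_nnfun0// integral_set0 mule0; apply/esym/integral0_eq => x _.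
  by rewrite indic0 mulr0 mul0e.
rewrite integral_mkcond -ge0_integralZl//; last 2 first.
  - by apply/(measurable_restrictT _ _).1 => //; exact/measurable_funTS/measurable_EFinP.
  - by move=> x _; apply: erestrict_ge0 => y _; rewrite lee_fin.
apply: eq_integral => x _; rewrite patchE indicE; case: ifPn => _.
  by rewrite mulr1.
by rewrite mulr0 mul0e mule0.
Qed.

Lemma ge0_integral_density (f : T -> \bar R) : measurable_fun setT f ->
  (forall x, 0 <= f x) -> \int[nu]_x f x = \int[mu]_x (f x * (p x)%:E).
Proof.
move=> mf f0; pose f_ := nnsfun_approx measurableT mf.
transitivity (limn (fun n => \int[nu]_x (f_ n x)%:E)).
  rewrite -monotone_convergence//=.
  - by apply: eq_integral => x _; apply/esym/cvg_lim => //; exact: cvg_nnsfun_approx.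
  - by move=> n; exact/measurable_EFinP/measurable_funTS.
  - by move=> n ? _; rewrite lee_fin.
  - by move=> ? _ ? ? mn; rewrite lee_fin; exact/lefP/nd_nnsfun_approx.
under eq_fun do rewrite integral_density_nnsfun.
rewrite -monotone_convergence//=.
- apply: eq_integral => x _; apply/cvg_lim => //.
  apply: cvgeZr => //; exact: cvg_nnsfun_approx.
- by move=> n; apply: emeasurable_funM; exact/measurable_EFinP/measurable_funTS.
- by move=> n ? _; rewrite mule_ge0// lee_fin.
- move=> ? _ ? ? mn; rewrite lee_wpmul2r ?lee_fin//; exact/lefP/nd_nnsfun_approx.
Qed.

End density.

Section normal_moment.
Variables (R : realType) (s : R).
Hypothesis s0 : 0 < s.
Local Notation leb := (@lebesgue_measure R).
Local Notation p := (normal_pdf 0 s).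

Let pE : p = (fun x => normal_peak s * normal_fun 0 s x).
Proof. by rewrite normal_pdfE ?gt_eqF. Qed.

Let cp : continuous p.
Proof. by apply: continuous_normal_pdf; rewrite gt_eqF. Qed.

Let dp x : is_derive x (1 : R) p (- x / s ^+ 2 * p x).
Proof.
rewrite pE /normal_fun.
have d1 : is_derive x (1 : R) (fun y => - (y - 0) ^+ 2 / (s ^+ 2 *+ 2)) (- x / s ^+ 2).
  rewrite (_ : (fun y => _) = (fun y => (- (s ^+ 2 *+ 2)^-1) * (y ^+ 2))); last first.
    by apply/funext => y; rewrite subr0 mulNr mulrC mulNr.
  apply: is_derive_eq; rewrite /GRing.scale/= -[s ^+ 2 *+ 2]mulr_natr.
  by field; rewrite gt_eqF.
have := @is_deriveZ R R R _ (normal_peak s) x 1 _ (is_derive1_comp (is_derive_expR _) d1).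
by move=> H; apply: is_derive_eq H _; rewrite /GRing.scale/=; ring.
Qed.

(** The boundary term of the integration by parts below. With u = n^2 / (2 s^2), the bound e^(-u) <=
    1/u leaves a constant over n. *)
Let sqr_pdf_cvg0 : (n%:R * p n%:R) @[n --> \oo] --> (0 : R).
Proof.
apply/cvgrPdist_le => e e0; near=> n.
have n0 : 0 < n%:R :> R by rewrite ltr0n; near: n; exact: nbhs_infty_gt.
have pk := normal_peak_ge0 s.
rewrite sub0r normrN ger0_norm ?mulr_ge0 ?normal_pdf_ge0// pE /normal_fun subr0 mulNr expRN.
set u := n%:R ^+ 2 / (s ^+ 2 *+ 2).
have s2 : 0 < s ^+ 2 *+ 2 by rewrite mulrn_wgt0// exprn_gt0.
have u0 : 0 < u by rewrite divr_gt0// exprn_gt0.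
have ue : (expR u)^-1 <= u^-1.
  rewrite lef_pV2 ?posrE ?expR_gt0//; apply: le_trans (expR_ge1Dx _); rewrite lerDr; exact: ler01.
apply: (@le_trans _ _ (n%:R * (normal_peak s * u^-1))); first by rewrite !ler_wpM2l// ltW.
have -> : n%:R * (normal_peak s * u^-1) = (normal_peak s * (s ^+ 2 *+ 2)) / n%:R.
  by rewrite /u invf_div; field; rewrite gt_eqF.
rewrite ler_pdivrMr// -ler_pdivrMl// mulrC.
near: n; exact: nbhs_infty_ger.
Unshelve. all: by end_near. Qed.

(** Evenness reduces both the moment and the total mass to the half-line; integration by parts on
    [0, n] relates the two, and n tends to infinity. *)
Lemma normal_second_moment :
  (\int[normal_prob 0 s]_x (x ^+ 2)%:E = (s ^+ 2)%:E)%E.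
Proof.
have mp : measurable_fun [set: R] p by exact: measurable_normal_pdf.
have ps : p =1 p \o -%R.
  by move=> x; rewrite pE /normal_fun /= !subr0 sqrrN.
have q0 x : 0 <= x ^+ 2 * p x by rewrite mulr_ge0 ?sqr_ge0 ?normal_pdf_ge0.
have cq : continuous (fun x : R => x ^+ 2 * p x).
  by move=> x; apply: cvgM; [exact: exprn_continuous|exact: cp].
rewrite (@ge0_integral_density _ _ _ leb _ p mp)//; last first.
- by move=> x; rewrite lee_fin sqr_ge0.
- exact/measurable_EFinP/measurable_funX.
- by move=> x; exact: normal_pdf_ge0.
under eq_integral do rewrite -EFinM.
rewrite ge0_symfun_integralT//; last by move=> x /=; rewrite sqrrN ps.
have : (\int[leb]_x (p x)%:E)%E = 1%E by exact: integral_normal_pdf.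
rewrite ge0_symfun_integralT//; last by move=> x; exact: normal_pdf_ge0.
rewrite -!set_itvcy => half.
have := @ge0_cvgn_integral R leb _ q0 (continuous_measurable_fun cq).
have := @ge0_cvgn_integral R leb _ (normal_pdf_ge0 0 s) (continuous_measurable_fun cp).
set Ip := (\int[leb]_(x in _) (p x)%:E)%E in half *; set Iq := (\int[leb]_(x in _) _)%E.
move=> cvp cvq.
(* integration by parts: (x p)' = p - x^2 p / s^2 *)
have parts (n : nat) : (0 < n)%N ->
   (\int[leb]_(x in `[0%R, n%:R]) (x ^+ 2 * p x)%:E =
   (s ^+ 2)%:E * (\int[leb]_(x in `[0%R, n%:R]) (p x)%:E - (n%:R * p n%:R)%:E))%E.
  move=> n0; have n0' : (0 : R) < n%:R by rewrite ltr0n.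
  have ii (f : R -> R) : continuous f -> leb.-integrable `[0, n%:R] (EFin \o f).
    move=> cf; apply: continuous_compact_integrable; first exact: segment_compact.
    exact: continuous_subspaceT.
  have dF (x : R) : is_derive x (1 : R) (fun y => y * p y) (p x - (s ^+ 2)^-1 * (x ^+ 2 * p x)).
    have dxp := dp x.
    have := @is_deriveM R R id p x 1 1 _ (is_derive_id _ _) dxp.
    by move=> H; apply: is_derive_eq H _; rewrite /GRing.scale/=; field; rewrite gt_eqF.
  have cF : continuous (fun x : R => p x - (s ^+ 2)^-1 * (x ^+ 2 * p x)).
    move=> x; apply: cvgB; first exact: cp.
    by apply: cvgM; [exact: cvg_cst|exact: cq].
  have := integral_FTC n0' dF cF; rewrite mul0r subr0 => <-.
  have -> : (\int[leb]_(x in `[0%R, n%:R]) (p x - (s ^+ 2)^-1 * (x ^+ 2 * p x))%:E =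
      \int[leb]_(x in `[0%R, n%:R]) (p x)%:E -
      ((s ^+ 2)^-1)%:E * \int[leb]_(x in `[0%R, n%:R]) (x ^+ 2 * p x)%:E)%E.
    rewrite -integralZl//; last exact: ii.
    rewrite -integralB//; first exact: ii.
    by apply: (integrableZl _ _ (ii _ cq)).
  have /integrable_fin_num -/(_ (measurable_itv _)) := ii _ cp.
  have /integrable_fin_num -/(_ (measurable_itv _)) := ii _ cq.
  rewrite /comp; case: (integral _ _ _) => //= Q _; case: (integral _ _ _) => //= I' _.
  by rewrite -EFinD -EFinM; congr EFin; field; rewrite gt_eqF.
have Ipfin : Ip \is a fin_num.
  move: half; case: (Ip) => [//| |].
    by rewrite mulry gtr0_sg// mul1e.
  by rewrite mulrNy gtr0_sg// mul1e.
have cvq' : (fun n : nat => (s ^+ 2)%:E * (\int[leb]_(x in `[0%R, n%:R]) (p x)%:E - (n%:R * p n%:R)%:E))%E @ \oo --> ((s ^+ 2)%:E * (Ip - 0%:E))%E.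
  apply: cvgeZl => //; apply: cvgeB => //; last by apply: cvg_EFin; [exact: nearW|exact: sqr_pdf_cvg0].
  by rewrite fin_num_adde_defl.
have -> : Iq = ((s ^+ 2)%:E * (Ip - 0%:E))%E.
  apply: (cvg_unique (@ereal_hausdorff R) cvq); apply: cvg_trans cvq'.
  apply: near_eq_cvg; near=> n; rewrite parts//; near: n; exact: nbhs_infty_gt.
by rewrite sube0 muleCA half mule1.
Unshelve. all: by end_near. Qed.
End normal_moment.

(** * Square-integrable random variables *)

Lemma Rintegral_sum d (T : measurableType d) (R : realType)
    (mu : {measure set T -> \bar R}) (D : set T) (I : Type) (s : seq I) (f : I -> T -> R) :
  measurable D -> (forall i, mu.-integrable D (EFin \o f i)) ->
  \int[mu]_(x in D) (\sum_(i <- s) f i x) = \sum_(i <- s) \int[mu]_(x in D) f i x.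
Proof.
move=> mD fi; elim: s => [|i s ih].
  under eq_Rintegral do rewrite big_nil.
  by rewrite big_nil Rintegral_cst// mul0r.
under eq_Rintegral do rewrite big_cons; rewrite big_cons RintegralD// ?ih//.
rewrite (_ : _ \o _ = (fun w => \sum_(i <- s) (f i w)%:E)%E).
  by apply: (@integrable_sum _ _ _ mu D mD I s xpredT (fun k => EFin \o f k)) => k _; exact: fi.
by apply/funext => w /=; rewrite sumEFin.
Qed.

Section square_integrable.
Context d (Omega : measurableType d) (R : realType) (P : probability Omega R).
Implicit Types f g : Omega -> R.

Definition sqi f := measurable_fun setT f /\ (\int[P]_w ((f w) ^+ 2)%:E < +oo)%E.

Lemma sqi_integrable f : sqi f -> P.-integrable setT (EFin \o (fun w => f w ^+ 2)).
Proof.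
move=> [mf fi]; apply/integrableP; split.
  by apply/measurable_EFinP; exact: measurable_funX.
by under eq_integral do rewrite /= ger0_norm ?sqr_ge0//.
Qed.

Lemma sqiM f g : sqi f -> sqi g -> P.-integrable setT (EFin \o (fun w => f w * g w)).
Proof.
move=> sf sg; have [[mf _] [mg _]] := (sf, sg).
apply: (le_integrable measurableT _ _ (integrableD measurableT (sqi_integrable sf) (sqi_integrable sg))).
  exact/measurable_EFinP/measurable_funM.
move=> w _; rewrite /= lee_fin normrM (ger0_norm (addr_ge0 (sqr_ge0 _) (sqr_ge0 _))).
rewrite -(real_normK (num_real (f w))) -(real_normK (num_real (g w))).
have := normr_ge0 (f w); have := normr_ge0 (g w); nra.
Qed.

Lemma sqi_cst c : sqi (fun=> c).
Proof.
split; first exact: measurable_cst.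
by rewrite integral_cst// [X in (_ * X)%E]probability_setT mule1 ltry.
Qed.

Lemma sqi_integrable1 f : sqi f -> P.-integrable setT (EFin \o f).
Proof.
move=> sf; have := sqiM sf (sqi_cst 1).
by apply: eq_integrable => // w _; rewrite /= mulr1.
Qed.

Lemma sqi_le f g (C : R) : measurable_fun setT f -> (forall w, f w ^+ 2 <= C * g w ^+ 2) ->
  sqi g -> sqi f.
Proof.
move=> mf fg sg; split => //; have [mg _] := sg.
have /integrableP[_] := integrableZl measurableT C (sqi_integrable sg).
apply: le_lt_trans; apply: ge0_le_integral => //.
- by move=> w _; rewrite lee_fin sqr_ge0.
- by apply/measurable_EFinP; exact: measurable_funX.
- apply: measurableT_comp => //; apply: measurable_funeM.
  by apply/measurable_EFinP; exact: measurable_funX.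
- by move=> w _; rewrite -EFinM lee_fin (le_trans (fg w))// ler_norm.
Qed.

Lemma sqiD f g : sqi f -> sqi g -> sqi (fun w => f w + g w).
Proof.
move=> sf sg; have [[mf _] [mg _]] := (sf, sg).
split; first exact: measurable_funD.
have /integrableP[_] := integrableZl measurableT 2 (integrableD measurableT (sqi_integrable sf) (sqi_integrable sg)).
apply: le_lt_trans; apply: ge0_le_integral => //.
- by move=> w _; rewrite lee_fin sqr_ge0.
- by apply/measurable_EFinP; apply: measurable_funX; exact: measurable_funD.
- apply: measurableT_comp => //; apply: measurable_funeM; apply: emeasurable_funD.
    by apply/measurable_EFinP; exact: measurable_funX.
  by apply/measurable_EFinP; exact: measurable_funX.
- move=> w _; rewrite /= lee_fin (le_trans _ (ler_norm _))//.
  by have := sqr_ge0 (f w - g w); lra.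
Qed.

Lemma sqiZ a f : sqi f -> sqi (fun w => a * f w).
Proof.
move=> sf; have [mf _] := sf; apply: (@sqi_le _ f (a ^+ 2) _ _ sf).
  exact: measurable_funM.
by move=> w; rewrite exprMn.
Qed.

Lemma sqi_sum (I : Type) (s : seq I) (f : I -> Omega -> R) :
  (forall i, sqi (f i)) -> sqi (fun w => \sum_(i <- s) f i w).
Proof.
move=> sf; elim: s => [|i s ih].
  by under eq_fun do rewrite big_nil; exact: sqi_cst.
by under eq_fun do rewrite big_cons; exact: sqiD.
Qed.

Lemma sqi_indic (C : set Omega) f : measurable C -> sqi f -> sqi (fun w => \1_C w * f w).
Proof.
move=> mC sf; have [mf _] := sf; apply: (@sqi_le _ f 1 _ _ sf).
  by apply: measurable_funM => //; exact: measurable_indic.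
move=> w; rewrite exprMn mul1r indicE; case: (w \in C); rewrite ?expr1n ?mul1r//.
by rewrite expr0n/= mul0r sqr_ge0.
Qed.

Lemma RintegralE f : P.-integrable setT (EFin \o f) ->
  (\int[P]_w (f w)%:E)%E = (\int[P]_w f w)%:E.
Proof. by move=> fi; rewrite /Rintegral fineK//; exact: integrable_fin_num fi. Qed.

Lemma ae_eq_E f g : measurable_fun setT f -> measurable_fun setT g ->
  {ae P, forall w, f w = g w} -> \int[P]_w f w = \int[P]_w g w.
Proof.
move=> mf mg fg; congr fine; apply: ae_eq_integral => //.
- exact/measurable_EFinP.
- exact/measurable_EFinP.
- by apply: filterS fg => w -> .
Qed.

(** The joint law agrees with the product of the two laws on rectangles, hence everywhere by
    uniqueness of the product measure; Fubini's theorem then separates the factors. *)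
Lemma E_independent f g :
  P.-integrable setT (EFin \o f) -> P.-integrable setT (EFin \o g) ->
  P.-integrable setT (EFin \o (fun w => f w * g w)) ->
  (forall D1 D2 : set (measurableTypeR R), measurable D1 -> measurable D2 ->
     (P (f @^-1` D1 `&` g @^-1` D2) = P (f @^-1` D1) * P (g @^-1` D2))%E) ->
  \int[P]_w (f w * g w) = \int[P]_w f w * \int[P]_w g w.
Proof.
move=> fi gi fgi fg.
have mf : measurable_fun setT f by move/integrableP : fi => [/measurable_EFinP].
have mg : measurable_fun setT g by move/integrableP : gi => [/measurable_EFinP].
pose f' : {RV P >-> R} := mfun_Sub (mem_set mf).
pose g' : {RV P >-> R} := mfun_Sub (mem_set mg).
have mfg : measurable_fun setT (fun w => (f w, g w)) by exact: measurable_fun_pair.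
pose h : {RV P >-> (R * R)%type} := mfun_Sub (mem_set mfg).
have mE X : measurable X -> ((distribution P f') \x (distribution P g'))%E X = distribution P h X.
  by apply: product_measure_unique => D1 D2 mD1 mD2; exact: fg.
pose k (z : R * R) : \bar R := (z.1 * z.2)%:E.
have mk : measurable_fun setT k.
  by apply/measurable_EFinP/measurable_funM; [exact: measurable_fst|exact: measurable_snd].
have intE (u : R * R -> \bar R) : (\int[(distribution P f' \x distribution P g')%E]_z u z =
    \int[distribution P h]_z u z)%E.
  by apply: eq_measure_integral => X mX _; exact: mE.
have ki : (distribution P f' \x distribution P g')%E.-integrable setT k.
  apply/integrableP; split => //; rewrite intE ge0_integral_distribution//; last exact: measurableT_comp.
  by move/integrableP : fgi => [].
apply: EFin_inj; rewrite -RintegralE// EFinM -!RintegralE//.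
transitivity (\int[distribution P h]_z k z)%E.
  by rewrite integral_distribution.
rewrite -intE -integral12_prod_meas1//= /fubini_F/=.
have mid : measurable_fun [set: R] (@EFin R) by exact/measurable_EFinP.
have G x : (\int[distribution P g']_y k (x, y) = x%:E * \int[P]_w (g w)%:E)%E.
  rewrite /k/=; under eq_integral do rewrite EFinM.
  have gd : (distribution P g').-integrable setT (@EFin R).
    apply/integrableP; split => //; rewrite ge0_integral_distribution//; last exact: measurableT_comp.
    by move/integrableP : gi => [].
  by rewrite integralZl// integral_distribution.
under eq_integral do rewrite G.
have gfin : (\int[P]_w (g w)%:E)%E \is a fin_num by exact: integrable_fin_num gi.
rewrite -(fineK gfin) integralZr//; first by rewrite integral_distribution.
apply/integrableP; split => //; rewrite ge0_integral_distribution//; last exact: measurableT_comp.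
by move/integrableP : fi => [].
Qed.

End square_integrable.

(** * Increments of the Wiener process *)

Section wiener.
Variables (R : realType) (d : measure_display) (Omega : measurableType d).
Variables (P : probability Omega R) (T : R) (F : R -> set (set Omega)).
Hypothesis hF : normal_filtration P T F.
Variable W : R -> L2 R -> Omega -> R.
Hypothesis hW : cylindrical_wiener P T F W.
Implicit Types (u v : R) (h k : L2 R) (Y : Omega -> R) (C : set Omega).
Local Notation D := (increment W).
Local Notation sqi := (sqi P).

Definition adapted_at u Y :=
  forall B : set (measurableTypeR R), measurable B -> F u (Y @^-1` B).

Lemma filtration_sigma u : 0 <= u <= T -> sigma_algebra setT (F u).
Proof. by move=> uT; have [/(_ u uT)[]] := hF. Qed.

Lemma filtration_measurable u C : 0 <= u <= T -> F u C -> measurable C.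
Proof. by move=> uT; have [/(_ u uT)[_ FM] _ _ _] := hF; exact: FM. Qed.

Lemma filtration_mono u v C : 0 <= u -> u <= v -> v <= T -> F u C -> F v C.
Proof. by move=> u0 uv vT; have [_ /(_ u v u0 uv vT) FM _ _] := hF; exact: FM. Qed.

Lemma adapted_atP u Y : 0 <= u <= T ->
  adapted_at u Y <-> measurable_fun [set: g_sigma_algebraType (F u)] Y.
Proof.
move=> uT; have FE : <<s F u>> = F u by apply: sigma_algebra_id; exact: filtration_sigma.
split=> [uY _ B mB|mY B mB].
  by rewrite setTI -[measurable _]/(<<s F u>> _) FE; exact: uY.
by have := mY measurableT B mB; rewrite setTI -[measurable _]/(<<s F u>> _) FE.
Qed.

Lemma adapted_measurable u Y : 0 <= u <= T -> adapted_at u Y -> measurable_fun setT Y.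
Proof.
by move=> uT uY _ B mB; rewrite setTI; exact: (filtration_measurable uT (uY B mB)).
Qed.

Lemma adapted_mono u v Y : 0 <= u -> u <= v -> v <= T -> adapted_at u Y -> adapted_at v Y.
Proof. by move=> u0 uv vT uY B mB; exact: filtration_mono (uY B mB). Qed.

Lemma adaptedM u Y Z : 0 <= u <= T -> adapted_at u Y -> adapted_at u Z ->
  adapted_at u (fun w => Y w * Z w).
Proof. by move=> uT /adapted_atP-/(_ uT) mY /adapted_atP-/(_ uT) mZ; apply/adapted_atP => //; exact: measurable_funM. Qed.

Lemma adaptedB u Y Z : 0 <= u <= T -> adapted_at u Y -> adapted_at u Z ->
  adapted_at u (fun w => Y w - Z w).
Proof. by move=> uT /adapted_atP-/(_ uT) mY /adapted_atP-/(_ uT) mZ; apply/adapted_atP => //; exact: measurable_funB. Qed.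

Lemma ge0_integral_law Y (nu : {measure set (measurableTypeR R) -> \bar R})
    (g : measurableTypeR R -> \bar R) :
  measurable_fun setT Y ->
  (forall B : set (measurableTypeR R), measurable B -> P (Y @^-1` B) = nu B) ->
  measurable_fun setT g -> (forall x, 0 <= g x)%E ->
  (\int[P]_w g (Y w) = \int[nu]_x g x)%E.
Proof.
move=> mY Ynu mg g0; pose Y' : Omega -> measurableTypeR R := Y.
have mY' : measurable_fun setT Y' by exact: mY.
rewrite -[LHS](@ge0_integral_pushforward _ _ _ _ _ _ mY' P setT g)//.
by apply: eq_measure_integral => B mB _; exact: Ynu.
Qed.

Lemma integral_law Y (nu : {measure set (measurableTypeR R) -> \bar R})
    (g : measurableTypeR R -> \bar R) :
  measurable_fun setT Y ->
  (forall B : set (measurableTypeR R), measurable B -> P (Y @^-1` B) = nu B) ->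
  measurable_fun setT g ->
  (\int[P]_w g (Y w) = \int[nu]_x g x)%E.
Proof.
move=> mY Ynu mg; rewrite [LHS]integralE [RHS]integralE.
congr (_ - _)%E.
- have := ge0_integral_law (g := g^\+%E) mY Ynu (measurable_funepos mg).
  by move=> <- //; apply: eq_integral => w _; rewrite ?funeposE ?funenegE.
- have := ge0_integral_law (g := g^\-%E) mY Ynu (measurable_funeneg mg).
  by move=> <- //; apply: eq_integral => w _; rewrite ?funeposE ?funenegE.
Qed.

Lemma adapted_indic u C : 0 <= u <= T -> F u C -> adapted_at u (\1_C).
Proof.
move=> uT uC; apply/adapted_atP => //; apply: measurable_indic.
exact: sub_sigma_algebra.
Qed.

Lemma filtrationI u C C' : 0 <= u <= T -> F u C -> F u C' -> F u (C `&` C').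
Proof.
move=> uT uC uC'; have FE : <<s F u>> = F u by apply: sigma_algebra_id; exact: filtration_sigma.
rewrite -FE -[<<s F u>> _]/(@measurable _ (g_sigma_algebraType (F u)) _).
by apply: measurableI; exact: sub_sigma_algebra.
Qed.

Lemma adapted_incr u v h : 0 <= u -> u <= v -> v <= T -> adapted_at v (D u v h).
Proof.
move=> u0 uv vT; have vv : 0 <= v <= T by rewrite vT (le_trans u0).
apply: adaptedB => // [B mB|]; first exact: (wiener_adapted hW).
by apply: (adapted_mono u0 uv vT) => B mB; apply: (wiener_adapted hW) => //; rewrite u0 (le_trans uv).
Qed.

Lemma incr_measurable u v h : 0 <= u -> u <= v -> v <= T -> measurable_fun setT (D u v h).
Proof.
move=> u0 uv vT; apply: (@adapted_measurable v); last exact: adapted_incr.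
by rewrite vT (le_trans u0).
Qed.

Lemma incr_linear u v a h k : 0 <= u -> u <= v -> v <= T ->
  {ae P, forall w, D u v (a *: h + k) w = a * D u v h w + D u v k w}.
Proof.
move=> u0 uv vT; have uT : 0 <= u <= T by rewrite u0 (le_trans uv).
have vT' : 0 <= v <= T by rewrite vT (le_trans u0).
apply: filterS2 (wiener_linear hW a h k uT) (wiener_linear hW a h k vT') => w.
by rewrite /increment => -> ->; ring.
Qed.

(** No law is prescribed for h = 0. Linearity applied to 0 + 0 makes the increment equal to its
    double. *)
Lemma incr_zero u v : 0 <= u -> u <= v -> v <= T -> {ae P, forall w, D u v 0 w = 0}.
Proof.
move=> u0 uv vT; apply: filterS (incr_linear 1 0 0 u0 uv vT) => w.
by rewrite scaler0 add0r mul1r => /eqP; rewrite -subr_eq0 opprD addNKr oppr_eq0 => /eqP.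
Qed.

Lemma incr_second_moment_ereal u v h : 0 <= u -> u <= v -> v <= T ->
  (\int[P]_w (D u v h w ^+ 2)%:E = ((v - u) * `|h| ^+ 2)%:E)%E.
Proof.
move=> u0 uv vT; have mD := incr_measurable h u0 uv vT.
have zero : {ae P, forall w, D u v h w = 0} -> (\int[P]_w (D u v h w ^+ 2)%:E = 0)%E.
  move=> D0; rewrite (@ae_eq_integral _ _ _ P setT (cst 0))//.
  - by rewrite integral_cst// mul0e.
  - by apply/measurable_EFinP; exact: measurable_funX.
  - by apply: filterS D0 => w ->; rewrite expr0n.
have [h0|h0] := eqVneq h 0.
  by rewrite zero h0 ?normr0 ?expr0n ?mulr0//; exact: incr_zero.
move: uv; rewrite le_eqVlt => /predU1P[uv|uv].
  by rewrite zero -uv ?subrr ?mul0r//; apply: aeW => w; exact: subrr.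
pose s := Num.sqrt (v - u) * `|h|.
have s0 : 0 < s by rewrite mulr_gt0 ?normr_gt0// sqrtr_gt0 subr_gt0.
have -> : (v - u) * `|h| ^+ 2 = s ^+ 2 by rewrite exprMn sqr_sqrtr// subr_ge0 ltW.
rewrite -(normal_second_moment s0).
apply: (ge0_integral_law (g := fun x => (x ^+ 2)%:E) mD) => [B mB||x].
- by apply: (wiener_normal hW).
- by apply/measurable_EFinP; exact: measurable_funX.
- by rewrite lee_fin sqr_ge0.
Qed.

Lemma incr_sqi u v h : 0 <= u -> u <= v -> v <= T -> sqi (D u v h).
Proof.
move=> u0 uv vT; split; first exact: incr_measurable.
by rewrite incr_second_moment_ereal// ltry.
Qed.

Lemma incr_second_moment u v h : 0 <= u -> u <= v -> v <= T ->
  \int[P]_w (D u v h w ^+ 2) = (v - u) * `|h| ^+ 2.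
Proof. by move=> u0 uv vT; rewrite /Rintegral incr_second_moment_ereal. Qed.

(* [W (- h)] is both a copy and the opposite of [W h]. *)
Lemma incr_mean u v h : 0 <= u -> u <= v -> v <= T -> \int[P]_w D u v h w = 0.
Proof.
move=> u0 uv vT.
have law k : k != 0 -> u < v ->
  \int[P]_w D u v k w = \int[normal_prob 0 (Num.sqrt (v - u) * `|k|)]_x x.
  move=> k0 uv'; congr fine.
  apply: (integral_law (g := EFin) (incr_measurable k u0 uv vT)) => [B mB|].
    by apply: (wiener_normal hW).
  exact/measurable_EFinP.
have E0 k : {ae P, forall w, D u v k w = 0} -> \int[P]_w D u v k w = 0.
  move=> D0; rewrite (@ae_eq_E _ _ _ P _ (cst 0))//; last exact: incr_measurable.
  by rewrite Rintegral_cst// mul0r.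
have [->|h0] := eqVneq h 0; first by apply: E0; exact: incr_zero.
move: (uv); rewrite le_eqVlt => /predU1P[uv'|uv'].
  by apply: E0; apply: aeW => w; rewrite -uv'; exact: subrr.
have neg : \int[P]_w D u v (- h) w = - \int[P]_w D u v h w.
  rewrite -mulN1r -RintegralZl//; last exact: (sqi_integrable1 (incr_sqi h u0 uv vT)).
  apply: ae_eq_E; [exact: incr_measurable|by apply: measurable_funM => //; exact: incr_measurable|].
  have := incr_linear (-1) h 0 u0 uv vT; rewrite scaleN1r addr0 => H.
  by apply: filterS2 H (incr_zero u0 uv vT) => w -> ->; rewrite addr0.
move: neg; rewrite !law ?oppr_eq0// normrN.
set I := Rintegral _ _ _ => h1; lra.
Qed.

Lemma E_adapted_incr u v h Y : 0 <= u -> u <= v -> v <= T -> adapted_at u Y -> sqi Y ->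
  \int[P]_w (Y w * D u v h w) = 0.
Proof.
move=> u0 uv vT uY sY; move: (uv); rewrite le_eqVlt => /predU1P[<-|uv'].
  under eq_Rintegral do rewrite /increment subrr mulr0.
  by rewrite Rintegral_cst// mul0r.
have sD := incr_sqi h u0 uv vT.
rewrite E_independent ?incr_mean ?mulr0//.
- exact: sqi_integrable1.
- exact: sqi_integrable1.
- exact: sqiM.
- by move=> D1 D2 mD1 mD2; apply: (wiener_indep hW) => //; exact: uY.
Qed.

Lemma E_indic C : measurable C -> \int[P]_w \1_C w = fine (P C).
Proof. by move=> mC; rewrite /Rintegral integral_indic// setIT. Qed.

Lemma E_indic_incr2 u v h C : 0 <= u -> u <= v -> v <= T -> F u C ->
  \int[P]_w (\1_C w * D u v h w ^+ 2) = fine (P C) * ((v - u) * `|h| ^+ 2).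
Proof.
move=> u0 uv vT uC; move: (uv); rewrite le_eqVlt => /predU1P[<-|uv'].
  under eq_Rintegral do rewrite /increment subrr expr0n mulr0.
  by rewrite Rintegral_cst// mul0r subrr mul0r mulr0.
have uT : 0 <= u <= T by rewrite u0 (le_trans uv).
have mC := filtration_measurable uT uC.
have sD := incr_sqi h u0 uv vT.
have s1 : sqi (\1_C).
  by have := sqi_indic mC (sqi_cst P 1); under eq_fun do rewrite mulr1.
rewrite E_independent ?incr_second_moment ?E_indic//.
- exact: sqi_integrable1.
- exact: sqi_integrable.
- have := sqiM (sqi_indic mC sD) sD.
  by apply: eq_integrable => // w _; rewrite /= -mulrA -expr2.
- move=> D1 D2 mD1 mD2.
  rewrite (_ : _ @^-1` D2 = D u v h @^-1` ((fun x : measurableTypeR R => x ^+ 2) @^-1` D2))//.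
  apply: (wiener_indep hW) => //; first by apply: adapted_indic.
  have : measurable_fun [set: R] (fun x : R => x ^+ 2) by exact: measurable_funX.
  by move=> /(_ measurableT D2 mD2); rewrite setTI.
Qed.

(** Polarization: only the law in a single direction is prescribed, so the mixed moment is read from
    the direction h + k and the almost sure linearity of the increments. *)
Lemma E_indic_incr u v h k C : 0 <= u -> u <= v -> v <= T -> F u C ->
  \int[P]_w (\1_C w * (D u v h w * D u v k w)) = fine (P C) * ((v - u) * dot h k).
Proof.
move=> u0 uv vT uC.
have uT : 0 <= u <= T by rewrite u0 (le_trans uv).
have mC := filtration_measurable uT uC.
have sh := incr_sqi h u0 uv vT; have sk := incr_sqi k u0 uv vT.
have I1 h1 k1 : P.-integrable setT (EFin \o (fun w => \1_C w * (D u v h1 w * D u v k1 w))).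
  have := sqiM (sqi_indic mC (incr_sqi h1 u0 uv vT)) (incr_sqi k1 u0 uv vT).
  by apply: eq_integrable => // w _; rewrite /= mulrA.
have hk : \int[P]_w (\1_C w * D u v (h + k) w ^+ 2) =
  \int[P]_w (\1_C w * D u v h w ^+ 2) + 2 * \int[P]_w (\1_C w * (D u v h w * D u v k w)) +
  \int[P]_w (\1_C w * D u v k w ^+ 2).
  under [X in _ = X + _ + _]eq_Rintegral do rewrite expr2.
  under [X in _ = _ + X]eq_Rintegral do rewrite expr2.
  rewrite -RintegralZl// -RintegralD//; last by apply: (integrableZl measurableT 2 (I1 h k)).
  rewrite -RintegralD//; last first.
    by apply: (integrableD measurableT (I1 h h) (integrableZl measurableT 2 (I1 h k))).
  apply: ae_eq_E.
  - apply: measurable_funM; first exact: measurable_indic.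
    by apply: measurable_funX; exact: incr_measurable.
  - have mm h1 k1 : measurable_fun setT (fun w => \1_C w * (D u v h1 w * D u v k1 w)).
      apply: measurable_funM; first exact: measurable_indic.
      by apply: measurable_funM; exact: incr_measurable.
    by apply: measurable_funD => //; apply: measurable_funD => //; exact: measurable_funM.
  - have := incr_linear 1 h k u0 uv vT; rewrite scale1r; apply: filterS => w ->; ring.
move: hk; rewrite !E_indic_incr2// -!dot_normE dotDl !dotDr (dotC k h).
set I := Rintegral _ _ _; lra.
Qed.

End wiener.

(** * Ito isometry for elementary processes *)

Section elementary_isometry.
Variables (R : realType) (d : measure_display) (Omega : measurableType d).
Variables (P : probability Omega R) (T : R) (F : R -> set (set Omega)).
Hypothesis hF : normal_filtration P T F.
Variable W : R -> L2 R -> Omega -> R.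
Hypothesis hW : cylindrical_wiener P T F W.
Local Notation D := (increment W).
Local Notation sqi := (sqi P).
Local Notation leb := (@lebesgue_measure R).

Lemma incr_split u v w h x : D u w h x = D u v h x + D v w h x.
Proof. by rewrite /increment; ring. Qed.

(** The length of the intersection of two intervals, 0 when they are disjoint. *)
Definition overlap (l r l' r' : R) := Num.max 0 (Num.min r r' - Num.max l l').

(** Both increments are cut at l' and at m = min(r, r'). Only the products over the common piece
    (l', m] survive: in every other product one factor is known before the other increment
    starts. *)
Lemma E_elementary_ordered l r C h l' r' C' h' :
  0 <= l -> l <= r -> r <= T -> F l C -> 0 <= l' -> l' <= r' -> r' <= T -> F l' C' ->
  l <= l' ->
  \int[P]_w ((\1_C w * D l r h w) * (\1_C' w * D l' r' h' w)) =
  overlap l r l' r' * fine (P (C `&` C')) * dot h h'.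
Proof.
move=> l0 lr rT lC l0' lr' rT' lC' ll'.
have lT : l <= T by apply: le_trans rT.
have lT' : l' <= T by apply: le_trans rT'.
have l'T : 0 <= l' <= T by rewrite l0'.
have FC : F l' (C `&` C') by apply: (filtrationI hF) => //; exact: (filtration_mono hF l0 ll' lT' lC).
have mC : measurable (C `&` C') := filtration_measurable hF l'T FC.
set G := C `&` C' in FC mC *.
have CC w : (\1_C w * D l r h w) * (\1_C' w * D l' r' h' w) = \1_G w * (D l r h w * D l' r' h' w).
  by rewrite mulrACA; congr (_ * _); rewrite /G indicI.
under eq_Rintegral do rewrite CC.
have orth u v k Y : 0 <= u -> u <= v -> v <= T -> adapted_at F u Y -> sqi Y -> l' <= u ->
   \int[P]_w (\1_G w * (Y w * D u v k w)) = 0.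
  move=> u0 uv vT uY sY l'u; have uT : 0 <= u <= T by rewrite u0 (le_trans uv).
  under eq_Rintegral do rewrite mulrA.
  apply: (E_adapted_incr hF hW) => //; last exact: sqi_indic.
  apply: (adaptedM hF) => //; apply: (adapted_indic hF) => //.
  by apply: (filtration_mono hF l0' l'u) => //; case/andP: uT.
rewrite /overlap (max_idPr ll').
have [rl|lr'2] := leP r l'.
  rewrite (max_idPl _) ?mul0r//; last first.
    by rewrite subr_le0 ge_min rl.
  apply: orth => //; last exact: (incr_sqi hF hW).
  by apply: (adapted_mono hF _ rl) => //; [exact: le_trans lr|exact: (adapted_incr hF hW)].
pose m := Num.min r r'.
have l'm : l' <= m by rewrite le_min lr' ltW.
have mr : m <= r by rewrite ge_min lexx.
have mr' : m <= r' by rewrite ge_min lexx orbT.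
have mT : m <= T := le_trans mr rT.
have m0 : 0 <= m := le_trans l0' l'm.
have i1 : sqi (D l l' h) by exact: (incr_sqi hF hW).
have i2 : sqi (D l' m h) by exact: (incr_sqi hF hW).
have i3 : sqi (D m r h) by exact: (incr_sqi hF hW).
have j0 : sqi (D l' r' h') by exact: (incr_sqi hF hW).
have j1 : sqi (D l' m h') by exact: (incr_sqi hF hW).
have j2 : sqi (D m r' h') by exact: (incr_sqi hF hW).
(* One of the two intervals ends at [m], so one of these increments is empty. *)
have last0 w : D m r h w * D m r' h' w = 0.
  rewrite /m; case: (leP r r') => _; rewrite /increment subrr ?mul0r ?mulr0//.
pose f1 w := \1_G w * (D l l' h w * D l' r' h' w).
pose f2 w := \1_G w * (D l' m h w * D l' m h' w).
pose f3 w := \1_G w * (D l' m h w * D m r' h' w).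
pose f4 w := \1_G w * (D l' m h' w * D m r h w).
have E w : \1_G w * (D l r h w * D l' r' h' w) = f1 w + (f2 w + (f3 w + f4 w)).
  rewrite /f1 /f2 /f3 /f4 (incr_split l l' r) (incr_split l' m r) !(incr_split l' m r' h').
  rewrite -!mulrDr; congr (_ * _).
  move: (last0 w); set x := D m r h w; set y := D m r' h' w => xy.
  rewrite -[RHS]addr0 -xy; ring.
under eq_Rintegral do rewrite E.
have ii Y Z : sqi Y -> sqi Z -> P.-integrable setT (EFin \o (fun w => \1_G w * (Y w * Z w))).
  move=> sY sZ; have := sqiM (sqi_indic mC sY) sZ.
  by apply: eq_integrable => // w _; rewrite /= mulrA.
have iD f g : P.-integrable setT (EFin \o f) -> P.-integrable setT (EFin \o g) ->
    P.-integrable setT (EFin \o (fun w => f w + g w)) by move=> fi gi; exact: (integrableD measurableT fi gi).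
have I1 : P.-integrable setT (EFin \o f1) by exact: (ii _ _ i1 j0).
have I2 : P.-integrable setT (EFin \o f2) by exact: (ii _ _ i2 j1).
have I3 : P.-integrable setT (EFin \o f3) by exact: (ii _ _ i2 j2).
have I4 : P.-integrable setT (EFin \o f4) by exact: (ii _ _ j1 i3).
rewrite (RintegralD measurableT I1 (iD _ _ I2 (iD _ _ I3 I4))).
rewrite (RintegralD measurableT I2 (iD _ _ I3 I4)) (RintegralD measurableT I3 I4).
have E1 : \int[P]_w f1 w = 0.
  by apply: orth => //; exact: (adapted_incr hF hW).
have E2 : \int[P]_w f2 w = fine (P G) * ((m - l') * dot h h').
  exact: (E_indic_incr hF hW).
have E3 : \int[P]_w f3 w = 0.
  by apply: orth => //; exact: (adapted_incr hF hW).
have E4 : \int[P]_w f4 w = 0.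
  by apply: orth => //; exact: (adapted_incr hF hW).
rewrite E1 E2 E3 E4 (max_idPr _) ?subr_ge0// -/m; ring.
Qed.

Lemma E_elementary l r C h l' r' C' h' :
  0 <= l -> l <= r -> r <= T -> F l C -> 0 <= l' -> l' <= r' -> r' <= T -> F l' C' ->
  \int[P]_w ((\1_C w * D l r h w) * (\1_C' w * D l' r' h' w)) =
  overlap l r l' r' * fine (P (C `&` C')) * dot h h'.
Proof.
move=> l0 lr rT lC l0' lr' rT' lC'.
have [ll'|/ltW ll'] := leP l l'; first exact: E_elementary_ordered.
under eq_Rintegral do rewrite mulrC.
by rewrite E_elementary_ordered// setIC dotC /overlap minC (maxC l').
Qed.

Lemma sumr_sqr (n : nat) (f : 'I_n -> R) :
  (\sum_(i < n) f i) ^+ 2 = \sum_(p : 'I_n * 'I_n) f p.1 * f p.2.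
Proof.
rewrite expr2 mulr_suml -(pair_bigA _ (fun i j => f i * f j))/=.
by apply: eq_bigr => i _; rewrite mulr_sumr.
Qed.

Lemma norm2_sum (n : nat) (h : 'I_n -> L2 R) :
  `|\sum_(i < n) h i| ^+ 2 = \sum_(p : 'I_n * 'I_n) dot (h p.1) (h p.2).
Proof.
rewrite -dot_normE dot_suml -(pair_bigA _ (fun i j => dot (h i) (h j)))/=.
by apply: eq_bigr => i _; rewrite dot_sumr.
Qed.

Lemma indic_itv_overlap l r l' r' (x : R) :
  \1_(`]l, r]) x * \1_(`]l', r']) x = \1_(`]Num.max l l', Num.min r r']) x :> R.
Proof.
rewrite !indicE !mem_setE !in_itv/= gt_max le_min.
by case: (l < x); case: (x <= r); case: (l' < x); case: (x <= r'); rewrite ?mul1r ?mul0r.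
Qed.

Variables (t : R) (n : nat) (l r : 'I_n -> R) (C : 'I_n -> set Omega).
Variables (h : 'I_n -> L2 R) (a : 'I_n -> R).
Hypothesis tT : t <= T.
Hypothesis hel : forall i, [/\ 0 <= l i, l i <= r i, r i <= t & F (l i) (C i)].

Let mC i : measurable (C i).
Proof.
have [l0 lr rt FC] := hel i; apply: (filtration_measurable hF _ FC).
by rewrite l0 (le_trans lr)// (le_trans rt).
Qed.

Let term i w := \1_(C i) w * D (l i) (r i) (h i) w.

Lemma sqi_elementary_term i : sqi (term i).
Proof.
have [l0 lr rt FC] := hel i; apply: sqi_indic; first exact: mC.
by apply: (incr_sqi hF hW) => //; exact: le_trans tT.
Qed.

Definition el_sum w := \sum_(i < n) a i * term i w.

Lemma sqi_el_sum : sqi el_sum.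
Proof. by apply: sqi_sum => i; apply: sqiZ; exact: sqi_elementary_term. Qed.

(** The Riesz representative of the scalar elementary integrand whose stochastic integral is
    [el_sum]. *)
Definition el_density s w := \sum_(i < n) (a i * (\1_(`]l i, r i]) s * \1_(C i) w)) *: h i.

Let I (p : 'I_n * 'I_n) : set R := `]Num.max (l p.1) (l p.2), Num.min (r p.1) (r p.2)].
Let CC (p : 'I_n * 'I_n) := C p.1 `&` C p.2.
Let K (p : 'I_n * 'I_n) := a p.1 * a p.2 * dot (h p.1) (h p.2).

Lemma norm2_el_density s w :
  `|el_density s w| ^+ 2 = \sum_(p : 'I_n * 'I_n) K p * \1_(I p) s * \1_(CC p) w.
Proof.
rewrite norm2_sum; apply: eq_bigr => p _; rewrite dotZl dotZr /K /I /CC indicI -indic_itv_overlap.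
by rewrite /= ; ring.
Qed.

Lemma E_el_sum2 : \int[P]_w (el_sum w ^+ 2) =
  \sum_(p : 'I_n * 'I_n) K p * (overlap (l p.1) (r p.1) (l p.2) (r p.2) * fine (P (CC p))).
Proof.
rewrite (_ : (fun w => _) = (fun w => \sum_(p : 'I_n * 'I_n) (a p.1 * a p.2) * (term p.1 w * term p.2 w))); last first.
  apply/funext => w; rewrite sumr_sqr; apply: eq_bigr => p _; rewrite mulrACA//.
have tt p : P.-integrable setT (EFin \o (fun w => term p.1 w * term p.2 w)).
  exact: (sqiM (sqi_elementary_term p.1) (sqi_elementary_term p.2)).
rewrite Rintegral_sum//; last first.
  by move=> p; apply: (integrableZl measurableT _ (tt p)).
apply: eq_bigr => p _; rewrite RintegralZl// /term /K.
have [l0 lr rt FC] := hel p.1; have [l0' lr' rt' FC'] := hel p.2.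
by rewrite E_elementary// ?(le_trans _ tT)//; rewrite /CC; ring.
Qed.

Lemma E_el_density2 s : (\int[P]_w (`|el_density s w| ^+ 2)%:E)%E =
  (\sum_(p : 'I_n * 'I_n) K p * fine (P (CC p)) * \1_(I p) s)%:E.
Proof.
have mCC p : measurable (CC p) by exact: measurableI.
have ic p : P.-integrable setT (EFin \o \1_(CC p)).
  by have := sqi_integrable1 (sqi_indic (mCC p) (sqi_cst P 1)); apply: eq_integrable => // w _; rewrite /= mulr1.
under eq_integral do rewrite norm2_el_density.
rewrite RintegralE; last first.
  rewrite (_ : _ \o _ = (fun w => \sum_(p : 'I_n * 'I_n) (K p * \1_(I p) s * \1_(CC p) w)%:E)%E).
    by apply: integrable_sum => // p _; apply: (integrableZl measurableT _ (ic p)).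
  by apply/funext => w /=; rewrite sumEFin.
congr EFin; rewrite Rintegral_sum//; last by move=> p; apply: (integrableZl measurableT _ (ic p)).
by apply: eq_bigr => p _; rewrite RintegralZl// E_indic//; ring.
Qed.

(** Both sides expand into the same sum over pairs of terms, because the indicator of the
    intersection of two time intervals integrates to their overlap. *)
Lemma elementary_isometry :
  (\int[leb]_(s in `]0%R, t[) \int[P]_w (`|el_density s w| ^+ 2)%:E =
   \int[P]_w (el_sum w ^+ 2)%:E)%E.
Proof.
under eq_integral do rewrite E_el_density2.
have -> : (\int[P]_w (el_sum w ^+ 2)%:E = (\int[P]_w (el_sum w ^+ 2))%:E)%E.
  by rewrite RintegralE//; exact: (sqi_integrable sqi_el_sum).
pose Dt : set (measurableTypeR R) := `]0%R, t]%classic.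
have mDt : measurable Dt by exact: measurable_itv.
have mI p : measurable (I p : set (measurableTypeR R)) by exact: measurable_itv.
have mi p : measurable_fun [set: measurableTypeR R] (\1_(I p) : R -> R) by exact: measurable_indic.
(* The null endpoint t is added, since the intervals of the elementary process are closed on the
   right and may end at t. *)
have := @integral_itv_bndo_bndc R (BRight 0%R) t (fun s => (\sum_p K p * fine (P (CC p)) * \1_(I p) s)%:E).
move=> ->; last first.
  apply/measurable_EFinP/measurable_funTS; apply: measurable_sum => p.
  by apply: measurable_funM => //; exact: mi.
rewrite -/Dt.
have leI p : leb (I p) = (overlap (l p.1) (r p.1) (l p.2) (r p.2))%:E.
  rewrite /I lebesgue_measure_itv/= lte_fin /overlap; case: ltP => [lr|rl].
    by rewrite -EFinB [Num.max 0 _]max_r// subr_ge0 ltW.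
  by rewrite [Num.max 0 _]max_l// subr_le0.
have ID p : I p `&` Dt = I p.
  apply: setIidl => x; rewrite /I /Dt /= !in_itv/= gt_max le_min.
  have [l0 _ rt _] := hel p.1.
  move=> /andP[/andP[lx _] /andP[xr _]].
  by rewrite (le_lt_trans l0 lx) (le_trans xr rt).
have iE p : (\int[leb]_(x in Dt) (\1_(I p) x)%:E)%E = (overlap (l p.1) (r p.1) (l p.2) (r p.2))%:E.
  by rewrite integral_indic// -leI; congr (leb _); exact: ID.
have iI p : leb.-integrable Dt (EFin \o \1_(I p)).
  apply/integrableP; split; first by apply/measurable_EFinP/measurable_funTS; exact: mi.
  under eq_integral do rewrite /= ger0_norm//.
  by rewrite iE ltry.
have iKI p : leb.-integrable Dt (EFin \o (fun s => K p * fine (P (CC p)) * \1_(I p) s)).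
  exact: (integrableZl mDt (K p * fine (P (CC p))) (iI p)).
have iS : leb.-integrable Dt (EFin \o (fun s => \sum_p K p * fine (P (CC p)) * \1_(I p) s)).
  rewrite (_ : _ \o _ = (fun s => \sum_p (K p * fine (P (CC p)) * \1_(I p) s)%:E)%E).
    by apply: integrable_sum => // p _; exact: iKI.
  by apply/funext => w /=; rewrite sumEFin.
rewrite -(fineK (integrable_fin_num mDt iS)); congr EFin.
rewrite -[LHS]/(\int[leb]_(x in Dt) (\sum_p K p * fine (P (CC p)) * \1_(I p) x)).
rewrite Rintegral_sum// E_el_sum2; apply: eq_bigr => p _.
rewrite RintegralZl// /Rintegral iE /=; ring.
Qed.

End elementary_isometry.

(** * Non-negative integrals and series *)

Section integral_tools.
Local Open Scope ereal_scope.

(* Without measurability the integral is still a supremum over simple functions. *)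
Lemma le_integral_ge0 d (T : measurableType d) (R : realType)
    (mu : {measure set T -> \bar R}) (D : set T) (f g : T -> \bar R) :
  (forall x, D x -> 0 <= f x) -> (forall x, D x -> f x <= g x) ->
  \int[mu]_(x in D) f x <= \int[mu]_(x in D) g x.
Proof.
move=> f0 fg; rewrite integral_mkcond [leRHS]integral_mkcond.
have fD x : 0 <= (f \_ D) x by apply: erestrict_ge0.
have gD x : 0 <= (g \_ D) x by apply: erestrict_ge0 => y Dy; exact: le_trans (f0 _ Dy) (fg _ Dy).
rewrite !ge0_integralTE//; apply: ereal_sup_le => _ [h hf <-].
exists h => // x; apply: le_trans (hf x) _.
by rewrite !patchE; case: ifPn => // /set_mem; exact: fg.
Qed.

(** The exceptional null set is cut out of [f] alone, so that [g] may be nonmeasurable. *)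
Lemma ae_le_integral_ge0 d (T : measurableType d) (R : realType)
    (mu : {measure set T -> \bar R}) (f g : T -> \bar R) :
  measurable_fun setT f -> (forall x, 0 <= f x) -> (forall x, 0 <= g x) ->
  {ae mu, forall x, f x <= g x} ->
  \int[mu]_x f x <= \int[mu]_x g x.
Proof.
move=> mf f0 g0 [N [mN N0 sN]].
have -> : \int[mu]_x f x = \int[mu]_x (f \_ (~` N)) x.
  apply: ae_eq_integral => //.
    apply/(measurable_restrictT _ (measurableC mN)).1; exact: measurable_funTS.
  exists N; split => // x /= h; apply: contrapT => Nx; apply: h => _.
  by rewrite patchE mem_set.
apply: le_integral_ge0 => x _; first by apply: erestrict_ge0.
rewrite patchE; case: ifPn => // /set_mem Nx.
by apply: contrapT => h; apply: Nx; exact: sN.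
Qed.

(** The sum over all integers written as a series over nat, pairing k with -(k + 1), so that results
    on countable series of measurable functions apply. *)
Definition zsum (R : realType) (a : int -> R) : \bar R :=
  \sum_(0 <= k <oo) (a (Posz k) + a (Negz k))%:E.

End integral_tools.

Section zsum.
Variable R : realType.
Implicit Types a : int -> R.

(** The integers from -N to N - 1, which index the N-th partial sum of [zsum]. *)
Definition zpart N : {fset int} :=
  seq_fset tt ([seq Posz k | k <- iota 0 N] ++ [seq Negz k | k <- iota 0 N]).

Lemma sum_zpart a N : \sum_(n <- zpart N) a n = \sum_(0 <= k < N) (a (Posz k) + a (Negz k)).
Proof.
rewrite /zpart (perm_big ([seq Posz k | k <- iota 0 N] ++ [seq Negz k | k <- iota 0 N])); last first.
  apply: uniq_perm; first exact: fset_uniq.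
    rewrite cat_uniq !map_inj_uniq ?iota_uniq ?andbT//=; [|by move=> ? ? []|by move=> ? ? []].
    by apply/hasPn => _ /mapP[k _ ->]; apply/mapP => -[].
  by move=> n; rewrite seq_fsetE.
by rewrite big_cat !big_map/= big_split/= /index_iota subn0.
Qed.

Lemma zpart_sub (K : {fset int}) : exists N, (K `<=` zpart N)%fset.
Proof.
exists (\max_(n <- K) `|n|%N).+1; apply/fsubsetP => n nK.
have : (`|n| <= \max_(n <- K) `|n|%N)%N by rewrite (big_fsetD1 n)//= leq_maxl.
rewrite seq_fsetE mem_cat; case: n nK => k _ h; apply/orP; [left|right]; apply/mapP; exists k => //.
  by rewrite mem_iota.
by rewrite mem_iota/= add0n ltnS ltnW.
Qed.

Lemma zsum_leP a (M : \bar R) : (forall n, 0 <= a n) ->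
  (forall K : {fset int}, ((\sum_(n <- K) a n)%:E <= M)%E) <-> (zsum a <= M)%E.
Proof.
move=> a0; have a0' k : true -> xpredT k -> (0 <= (a (Posz k) + a (Negz k))%:E)%E.
  by move=> _ _; rewrite lee_fin addr_ge0.
split=> [aM|aM K].
  apply: lime_le; first by apply: is_cvg_nneseries => k _ _; exact: a0'.
  by apply: nearW => N; rewrite sumEFin -sum_zpart.
have [N KN] := zpart_sub K; apply: le_trans aM.
apply: (@le_trans _ _ (\sum_(0 <= k < N) (a (Posz k) + a (Negz k))%:E)%E).
  by rewrite sumEFin -sum_zpart lee_fin (fsum_split _ KN) lerDl sumr_ge0.
by apply: nneseries_lim_ge => k _ _; exact: a0'.
Qed.

Lemma zsum_ge0 a : (forall n, 0 <= a n) -> (0 <= zsum a)%E.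
Proof. by move=> a0; apply: nneseries_ge0 => k _ _; rewrite lee_fin addr_ge0. Qed.

Context d (T : measurableType d) (mu : {measure set T -> \bar R}).

Lemma zsum_measurable (f : int -> T -> R) : (forall n, measurable_fun setT (f n)) ->
  (forall n x, 0 <= f n x) -> measurable_fun setT (fun x => zsum (f^~ x)).
Proof.
move=> mf f0; apply: ge0_emeasurable_sum => [k x _ _|k _]; first by rewrite lee_fin addr_ge0.
by apply/measurable_EFinP/measurable_funD.
Qed.

Lemma integral_zsum_le (f : int -> T -> R) (M : \bar R) :
  (forall n, measurable_fun setT (f n)) -> (forall n x, 0 <= f n x) ->
  (forall K : {fset int}, \int[mu]_x (\sum_(n <- K) f n x)%:E <= M)%E ->
  (\int[mu]_x zsum (f^~ x) <= M)%E.
Proof.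
move=> mf f0 fM.
have mk k : measurable_fun setT (fun x => (f (Posz k) x + f (Negz k) x)%:E).
  by apply/measurable_EFinP/measurable_funD.
rewrite /zsum integral_nneseries//; last by move=> k x _; rewrite lee_fin addr_ge0.
apply: lime_le.
  apply: is_cvg_nneseries => k _ _; apply: integral_ge0 => x _; by rewrite lee_fin addr_ge0.
apply: nearW => N; apply: le_trans (fM (zpart N)).
rewrite -ge0_integral_sum//; last by move=> k x _; rewrite lee_fin addr_ge0.
apply: le_integral_ge0 => x _; first by apply: sume_ge0 => k _; rewrite lee_fin addr_ge0.
by rewrite sumEFin sum_zpart.
Qed.

End zsum.

Section iterated_integrals.
Local Open Scope ereal_scope.
Variables (R : realType) (d : measure_display) (Omega : measurableType d).
Variable (P : probability Omega R).
Local Notation leb := (@lebesgue_measure R).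
Variable t : R.
Local Notation Dt := (`]0%R, t[%classic : set (measurableTypeR R)).
Implicit Types f g h : R -> Omega -> R.

Definition jmeas f := measurable_fun [set: measurableTypeR R * Omega] (fun z => f z.1 z.2).

Definition iterint f : \bar R := \int[leb]_(s in Dt) \int[P]_w (f s w)%:E.

Lemma jmeas_section f s : jmeas f -> measurable_fun setT (f s).
Proof.
move=> mf; rewrite (_ : f s = (fun z : measurableTypeR R * Omega => f z.1 z.2) \o (fun w => (s, w)))//.
by apply: measurableT_comp mf _; exact: measurable_pair1.
Qed.

Lemma jmeas_int f : jmeas f -> (forall s w, 0 <= f s w)%R ->
  measurable_fun [set: measurableTypeR R] (fun s => \int[P]_w (f s w)%:E).
Proof.
move=> mf f0.
apply: (@measurable_fun_fubini_tonelli_F _ _ _ _ _ P (fun z => (f z.1 z.2)%:E)).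
  exact/measurable_EFinP.
by move=> z; rewrite lee_fin.
Qed.

Lemma iterint_lin (a b : R) f g : (0 <= a)%R -> (0 <= b)%R -> jmeas f -> jmeas g ->
  (forall s w, 0 <= f s w)%R -> (forall s w, 0 <= g s w)%R ->
  iterint (fun s w => a * f s w + b * g s w)%R = a%:E * iterint f + b%:E * iterint g.
Proof.
move=> a0 b0 mf mg f0 g0; rewrite /iterint.
have mD : measurable Dt by exact: measurable_itv.
have i0 h s : (forall s w, 0 <= h s w)%R -> 0 <= \int[P]_w (h s w)%:E.
  by move=> h0; apply: integral_ge0 => w _; rewrite lee_fin.
rewrite -ge0_integralZl//; last 2 first.
- by apply: measurable_funTS; exact: jmeas_int.
- by move=> s _; exact: i0.
rewrite -ge0_integralZl//; last 2 first.
- by apply: measurable_funTS; exact: jmeas_int.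
- by move=> s _; exact: i0.
rewrite -ge0_integralD//; last 4 first.
- by move=> s _; rewrite mule_ge0//; exact: i0.
- by apply: measurable_funeM; apply: measurable_funTS; exact: jmeas_int.
- by move=> s _; rewrite mule_ge0//; exact: i0.
- by apply: measurable_funeM; apply: measurable_funTS; exact: jmeas_int.
apply: eq_integral => s _; under eq_integral do rewrite EFinD !EFinM.
have mfs := jmeas_section s mf; have mgs := jmeas_section s mg.
rewrite ge0_integralD//.
- by rewrite !ge0_integralZl//; [exact/measurable_EFinP|move=> w _; rewrite lee_fin|exact/measurable_EFinP|move=> w _; rewrite lee_fin].
- by move=> w _; rewrite -EFinM lee_fin mulr_ge0.
- by apply: measurable_funeM; exact/measurable_EFinP.
- by move=> w _; rewrite -EFinM lee_fin mulr_ge0.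
- by apply: measurable_funeM; exact/measurable_EFinP.
Qed.

Lemma iterint_le (f g : R -> Omega -> \bar R) :
  (forall s w, Dt s -> 0 <= f s w) -> (forall s w, Dt s -> f s w <= g s w) ->
  \int[leb]_(s in Dt) \int[P]_w f s w <= \int[leb]_(s in Dt) \int[P]_w g s w.
Proof.
move=> f0 fg; apply: le_integral_ge0 => s Ds.
  by apply: integral_ge0 => w _; exact: f0.
by apply: le_integral_ge0 => w _; [exact: f0|exact: fg].
Qed.

End iterated_integrals.

Lemma borel_preimage (R : realType) (V : normedModType R) (phi : V -> R) :
  continuous phi -> forall B : set (measurableTypeR R), measurable B ->
  <<s @open V >> (phi @^-1` B).
Proof.
move=> cphi B mB.
have : measurable_fun [set: g_sigma_algebraType (@open V)] (phi : _ -> measurableTypeR R).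
  apply: (measurability _ (RGenOInfty.measurableE R)) => _ [_ [x ->] <-].
  rewrite setTI; apply: sub_sigma_algebra.
  by apply: open_comp => // y _; exact: cphi.
by move=> /(_ measurableT B mB); rewrite setTI.
Qed.

Lemma lee_mul1Deps (R : realType) (x M : \bar R) : (0 <= M)%E ->
  (forall e : R, 0 < e -> (x <= (1 + e)%:E * M + e%:E)%E) -> (x <= M)%E.
Proof.
case: M => [m|_ _|//]; last by rewrite leey.
rewrite lee_fin => m0 xM; apply/lee_addgt0Pr => e e0.
(* With e' = e / (m + 1) the total error e' m + e' is exactly e. *)
have e1 : 0 < e / (m + 1) by rewrite divr_gt0// ltr_wpDl.
apply: le_trans (xM _ e1) _; rewrite -EFinM -!EFinD lee_fin mulrDl mul1r -addrA lerD2l.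
by rewrite -{2}[e / (m + 1)]mulr1 -mulrDr divfK// gt_eqF// ltr_wpDl.
Qed.

Lemma ereal_cvg0_near_le (R : realType) (u : nat -> \bar R) (e : R) : 0 < e -> u @ \oo --> 0%E ->
  \forall k \near \oo, (u k <= e%:E)%E.
Proof.
move=> e0 u0; have e0n : nbhs (0%E : \bar R) [set y | (y < e%:E)%E].
  apply: open_nbhs_nbhs; split; first exact: (@open_ereal_lt_ereal R e%:E).
  by rewrite /= lte_fin.
have un : \forall k \near \oo, (u k < e%:E)%E by exact: (u0 _ e0n).
by apply: filterS un => k /ltW.
Qed.

Lemma integral_expR_decay (R : realType) (a t : R) : 0 < a -> 0 < t ->
  (\int[@lebesgue_measure R]_(s in `]0%R, t[) (expR (- (2 * a) * s))%:E =
   ((1 - expR (- (2 * a) * t)) / (2 * a))%:E)%E.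
Proof.
move=> a0 t0; have a2 : 2 * a != 0 by rewrite mulf_neq0// gt_eqF.
have cf : continuous (fun s : R => expR (- (2 * a) * s)).
  move=> s; apply: (@continuous_comp _ _ _ (fun s : R => - (2 * a) * s) expR).
    by apply: cvgM; [exact: cvg_cst|exact: cvg_id].
  exact: continuous_expR.
rewrite -(@integral_itv_bndoo _ _ _ _ true false); last first.
  by apply/measurable_EFinP/measurable_funTS; exact: continuous_measurable_fun.
have dF (s : R) : is_derive s (1 : R) (fun s => - (2 * a)^-1 * expR (- (2 * a) * s))
    (expR (- (2 * a) * s)).
  have := @is_deriveZ R R R _ (- (2 * a)^-1) s 1 _
    (is_derive1_comp (is_derive_expR _) (is_derive_mull (- (2 * a)) s)).
  rewrite /GRing.scale/= => H; apply: is_derive_eq H _.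
  by move: a2; set k := 2 * a => k0; field.
apply: etrans (integral_FTC t0 dF cf) _.
by congr EFin; rewrite mulr0 expR0; field; rewrite gt_eqF.
Qed.

(** * Mild solutions *)

Lemma basis_trig (R : realType) (b : int -> L2 R) :
  b 0 = cls (fun=> 1) ->
  (forall n : nat, (0 < n)%N ->
     b n%:Z = cls (fun x : R => Num.sqrt 2 * cos (2 * n%:R * pi * x))) ->
  (forall n : nat, (0 < n)%N ->
     b (- n%:Z) = cls (fun x : R => Num.sqrt 2 * sin (2 * n%:R * pi * x))) ->
  forall n, b n = cls (@trig R n).
Proof.
move=> b0 bp bn [[|n]|n]; first exact: b0.
- exact: bp.
- by rewrite NegzE bn.
Qed.

(** By orthonormality [b n] has a single nonzero coordinate, so it lies in the domain and the sum
    defining [A (b n)] has one term. *)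
Lemma eigval_laplacian (R : realType) (b : int -> L2 R) (nu : R) (DA : set (L2 R))
    (A : L2 R -> L2 R) :
  (forall m n, dot (b m) (b n) = (m == n)%:R) ->
  DA = [set v | (\esum_(n in [set: int])
                 (`|n%:~R ^+ 2 * dot (b n) v| ^+ 2)%:E < +oo)%E] ->
  (forall v, DA v ->
     A v = - nu *: sum (fun n : int => (n%:~R ^+ 2 * dot (b n) v) *: b n)) ->
  forall n, eigval b A n = - nu * n%:~R ^+ 2.
Proof.
move=> hb -> hA n; rewrite /eigval hA.
  rewrite (@sum_lim _ _ _ (\sum_(i <- [fset n]%fset) (i%:~R ^+ 2 * dot (b i) (b n)) *: b i)).
    by rewrite big_seq_fset1 dotZr dotZr !hb eqxx !mulr1.
  apply: sum_fsupp => i; rewrite !inE => ni.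
  by rewrite hb (negbTE ni) mulr0 scale0r.
apply: (@le_lt_trans _ _ ((n%:~R ^+ 2) ^+ 2)%:E); last exact: ltry.
apply: esum_leP => K; rewrite sumEFin lee_fin.
apply: (@le_trans _ _ (\sum_(i <- K) (if i == n then (n%:~R ^+ 2) ^+ 2 else 0))).
  apply: ler_sum => i _; rewrite hb; case: eqP => [->|_].
    by rewrite mulr1 real_normK// num_real.
  by rewrite mulr0 normr0 expr0n.
have [nK|nK] := boolP (n \in K).
  rewrite (big_fsetD1 n)//= eqxx big_seq big1 ?addr0// => i.
  by rewrite !inE => /andP[/negbTE -> _].
rewrite big_seq big1 ?sqr_ge0// => i iK; case: eqP => // ni.
by move: nK; rewrite -ni iK.
Qed.

Section random_variable_norm.
Variables (R : realType) (b : int -> L2 R) (A : L2 R -> L2 R) (eta : R).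
Variable HH : interpolation_family b A eta.
Local Open Scope ereal_scope.

Lemma enorm_ge0 q (x : amb HH) : 0 <= enorm q x.
Proof. by apply: le_ereal_inf_tmp => _ [y _ <-]; rewrite lee_fin. Qed.

Lemma rv_normE (d : measure_display) (Omega : measurableType d)
    (P : probability Omega R) q (Z : Omega -> amb HH) :
  rv_norm P q Z = (\int[P]_w enorm q (Z w) ^+ 2) `^ 2^-1.
Proof.
rewrite /rv_norm unlock; congr poweR; apply: eq_integral => w _ /=.
have := enorm_ge0 q (Z w); case: (enorm q (Z w)) => [x||//] x0.
  by rewrite gee0_abs// poweR_EFin powR_mulrn// EFin_expe.
by rewrite gee0_abs// poweRyr.
Qed.

End random_variable_norm.

Section mild_solution.
Variables (R : realType) (T eta nu r delta beta : R).
Hypotheses (hT : 0 < T) (heta : 0 < eta) (hnu : 0 < nu) (hr : 0 <= r).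
Variables (d : measure_display) (Omega : measurableType d) (P : probability Omega R).
Variables (F : R -> set (set Omega)) (hF : normal_filtration P T F).
Variables (W : R -> L2 R -> Omega -> R) (hW : cylindrical_wiener P T F W).
Variables (b : int -> L2 R) (A : L2 R -> L2 R).
Hypothesis bE : forall n, b n = cls (@trig R n).
Hypothesis lamE : forall n, eigval b A n = - nu * n%:~R ^+ 2.
Variable HH : interpolation_family b A eta.
Variable S : forall q, R -> sp HH q -> sp HH q.
Arguments S : clear implicits.
Hypothesis hS : semigroup_extension S.
Variable xi : Omega -> sp HH delta.
Hypothesis hxi : forall O, <<s (@open (sp HH delta)) >> O -> F 0 (xi @^-1` O).
Variables (B : L2 R -> L2 R -> sp HH (- beta)).
Hypothesis hBmul : forall v u : R -> R, v \in Lfun (@mu01 R) 2%:E ->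
     {within `[0, 1], continuous u} ->
     emb HH (- beta) (B (cls v) (cls (u \_ `]0, 1[))) =
     iota_ HH (cls (fun x => v x * (u \_ `]0, 1[) x)).
Variables (X : R -> Omega -> sp HH delta) (hX : predictable T F X).
Hypothesis hXH : forall t w, 0 < t <= T ->
     range (iota_ HH) (emb HH delta (X t w)).
Hypothesis hint : forall t, 0 < t <= T ->
     (\int[P]_w enorm (- r)%R (emb HH delta (S delta t (xi w))) ^+ 2 +
      \int[lebesgue_measure]_(s in `]0%R, t[) \int[P]_w
        HSnorm2 (- r)%R (mild_integrand S B X t s w) < +oo)%E.
Hypothesis hmild : forall t, 0 < t <= T ->
     exists2 I : Omega -> sp HH (- r),
       is_ito_integral P F W t (mild_integrand S B X t) I &
       {ae P, forall w, emb HH delta (X t w) =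
          emb HH delta (S delta t (xi w)) + emb HH (- r) (I w)}.
Variables (q0 : R) (c : int -> amb HH -> R).
Hypotheses (q0_lt0 : q0 < 0) (q0_delta : q0 <= delta) (q0_r : q0 <= - r).
Hypotheses (q0_beta : q0 <= - beta) (q0_half : q0 <= - 2^-1).
Hypothesis hc : is_coordinates q0 c.
Local Notation lam := (eigval b A).
Local Notation wt := (weight b A eta).
Local Notation iota := (iota_ HH).
Local Notation sqi := (sqi P).
Local Notation leb := (@lebesgue_measure R).
Local Notation U := (range (emb HH q0)).

Let hb m n : dot (b m) (b n) = (m == n)%:R.
Proof. by rewrite !bE; exact: dot_trig. Qed.

Let lam_le0 n : lam n <= 0.
Proof. by rewrite lamE mulNr oppr_le0 mulr_ge0 ?sqr_ge0// ltW. Qed.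

Let wt_gt0 q n : 0 < wt q n. Proof. exact: weight_gt0. Qed.

(** * Norms of H_q read from coordinates *)

Lemma coordinate_emb_sum q n (s : nat) (k : 'I_s -> R) (x : 'I_s -> sp HH q) : q0 <= q ->
  c n (emb HH q (\sum_(i < s) k i *: x i)) = \sum_(i < s) k i * c n (emb HH q (x i)).
Proof.
move=> q0q; elim/big_rec2: _ => [|i y z _ <-]; first by rewrite raddf0 (coordinate_zero hc).
by rewrite linearP/= (coordinate_lin hc)//; exact: range_emb_sub.
Qed.

Lemma enorm_ge_fsum q a (K : {fset int}) : q0 <= q ->
  ((\sum_(n <- K) (wt q n * c n a) ^+ 2)%:E <= enorm q a ^+ 2)%E.
Proof.
move=> q0q; have [[x _ <-]|na] := EM (range (emb HH q) a).
  rewrite enorm_emb -EFin_expe lee_fin.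
  exact: (coordinate_fsum_le hb heta lam_le0 hc x K q0q).
rewrite /enorm (_ : _ @` _ = set0) ?ereal_inf0 ?leey//.
by apply/seteqP; split => // _ [y /= ya _]; apply: na; exists y.
Qed.

Lemma enorm_ge q n a : q0 <= q -> (((wt q n * c n a) ^+ 2)%:E <= enorm q a ^+ 2)%E.
Proof.
by move=> q0q; have := enorm_ge_fsum a [fset n]%fset q0q; rewrite big_seq_fset1.
Qed.

(** Supplies a majorant of the squared norm that is measurable along random elements with measurable
    coordinates. A finite sum forces [x] into H_q; an infinite one leaves nothing to prove. *)
Lemma enorm_le_zsum q x : q0 <= q -> q <= 0 -> U x ->
  (enorm q x ^+ 2 <= zsum (fun n => ((wt q n * c n x) ^+ 2)%R))%E.
Proof.
move=> q0q q_le0 Ux; have s0 n : 0 <= (wt q n * c n x) ^+ 2 by exact: sqr_ge0.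
have := zsum_ge0 s0; case E: (zsum _) => [M||//] M0; last by rewrite leey.
have xM (K : {fset int}) : \sum_(n <- K) (wt q n * c n x) ^+ 2 <= M.
  rewrite -lee_fin; apply: ((zsum_leP (a := fun n => (wt q n * c n x) ^+ 2) M%:E s0).2 _ K).
  by rewrite E.
have [y <- yM] := sp_of_coords hb heta lam_le0 q0_lt0 hc q0q q_le0 Ux xM.
by rewrite enorm_emb -EFin_expe lee_fin.
Qed.

Lemma range_zsumP q x : q0 <= q -> q <= 0 -> U x ->
  range (emb HH q) x <-> (zsum (fun n => ((wt q n * c n x) ^+ 2)%R) < +oo)%E.
Proof.
move=> q0q q_le0 Ux; have s0 n : 0 <= (wt q n * c n x) ^+ 2 by exact: sqr_ge0.
split=> [[y _ <-]|].
  apply: (@le_lt_trans _ _ (`|y| ^+ 2)%:E); last exact: ltry.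
  apply/zsum_leP => [n|K]; first exact: sqr_ge0.
  rewrite lee_fin; exact: (coordinate_fsum_le hb heta lam_le0 hc y K q0q).
have := zsum_ge0 s0; case E: (zsum _) => [M||] // M0 _.
have xM (K : {fset int}) : \sum_(n <- K) (wt q n * c n x) ^+ 2 <= M.
  rewrite -lee_fin; apply: ((zsum_leP (a := fun n => (wt q n * c n x) ^+ 2) M%:E s0).2 _ K).
  by rewrite E.
have [y yx _] := sp_of_coords hb heta lam_le0 q0_lt0 hc q0q q_le0 Ux xM.
by exists y.
Qed.

(** * Coordinates of the initial value and of the solution *)

Definition xin n w := c n (emb HH delta (xi w)).
Definition Xn n s w := c n (emb HH delta (X s w)).

Lemma xin_adapted n : adapted_at F 0 (xin n).
Proof.
move=> D mD; apply: (hxi (O := (fun x => c n (emb HH delta x)) @^-1` D)).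
by apply: borel_preimage => //; exact: (coordinate_continuous hc q0_delta).
Qed.

Let zT : 0 <= (0 : R) <= T. Proof. by rewrite lexx ltW. Qed.

Lemma xin_measurable n : measurable_fun setT (xin n).
Proof. exact: (adapted_measurable hF zT (@xin_adapted n)). Qed.

Lemma predictable_sigma_measurable (G : set (R * Omega)) : predictable_sigma T F G ->
  measurable (G : set (measurableTypeR R * Omega)%type).
Proof.
have mD : measurable (`[0, T] `*` setT : set (measurableTypeR R * Omega)%type).
  by apply: measurableX => //; exact: measurable_itv.
move: G; apply: smallest_sub.
  split; first exact: measurable0.
  - by move=> G mG; exact: measurableD.
  - by move=> G mG; exact: bigcupT_measurable.
move=> G [[s [t [C [s0 st tT FC ->]]]]|[C FC ->]].
- apply: measurableX; first exact: measurable_itv.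
  by apply: (filtration_measurable hF _ FC); rewrite s0 (le_trans _ tT)// ltW.
- apply: measurableX; first exact: measurable_set1.
  exact: (filtration_measurable hF zT FC).
Qed.

(** Predictability speaks only of times in [0, T]; the value 0 elsewhere gives a jointly measurable
    function on the whole product. *)
Definition Xt n s w := if 0 <= s <= T then Xn n s w else 0.

Lemma Xt_jmeas n : jmeas (Xt n).
Proof.
pose D : set (measurableTypeR R * Omega)%type := [set p | 0 <= p.1 <= T].
have mD : measurable D.
  rewrite (_ : D = `[0, T] `*` setT); first by apply: measurableX => //; exact: measurable_itv.
  by apply/seteqP; split => [[s w]|[s w] []] /=; rewrite in_itv.
pose f (z : measurableTypeR R * Omega) := Xn n z.1 z.2.
have mf : measurable_fun D f.
  move=> _ E mE.
  have OE : <<s @open (sp HH delta) >> ((fun x => c n (emb HH delta x)) @^-1` E).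
    by apply: borel_preimage => //; exact: (coordinate_continuous hc q0_delta).
  exact: (predictable_sigma_measurable (hX OE)).
have := (measurable_restrictT f mD).1 mf; congr measurable_fun.
apply/funext => -[s w]; rewrite patchE /Xt /=; case: ifPn => h.
  by move/set_mem: h => h; rewrite [X in if X then _ else _]h.
by case: ifPn => // h'; move: h; rewrite mem_set.
Qed.

Lemma Xn_measurable n t : 0 < t <= T -> measurable_fun setT (Xn n t).
Proof.
move=> /andP[t0 tT]; have := jmeas_section t (Xt_jmeas n).
by rewrite /Xt (ltW t0) tT.
Qed.

Lemma coordinate_S q t n (x : sp HH q) : q0 <= q -> 0 <= t ->
  c n (emb HH q (S q t x)) = expR (t * lam n) * c n (emb HH q x).
Proof. by move=> q0q t0; apply: (coordinate_semigroup hb lam_le0 hc). Qed.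

Lemma hint_xi t : 0 < t <= T ->
  (\int[P]_w enorm (- r)%R (emb HH delta (S delta t (xi w))) ^+ 2 < +oo)%E.
Proof.
move=> tT; apply: le_lt_trans (hint tT); rewrite leeDl//.
apply: integral_ge0 => s _; apply: integral_ge0 => w _; apply: esum_ge0 => n _.
exact: sqre_ge0.
Qed.

(** No moment of [xi] is assumed. The second moment of e^(TA) xi in H_(-r) is finite, and its n-th
    weighted coordinate is a positive multiple of that of [xi]. *)
Lemma xin_sqi n : sqi (xin n).
Proof.
have TT : 0 < T <= T by rewrite hT lexx.
pose k := wt (- r) n * expR (T * lam n).
have k0 : 0 < k by rewrite mulr_gt0 ?expR_gt0.
have sk : sqi (fun w => k * xin n w).
  split; first by apply: measurable_funM => //; exact: xin_measurable.
  apply: le_lt_trans (hint_xi TT); apply: le_integral_ge0 => w _; first by rewrite lee_fin sqr_ge0.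
  apply: le_trans (enorm_ge n _ q0_r).
  by rewrite coordinate_S// ?(ltW hT)// mulrA.
have := sqiZ k^-1 sk; rewrite (_ : (fun w => _) = xin n)//.
by apply/funext => w; rewrite mulrA mulVf ?mul1r// gt_eqF.
Qed.

(** * The mild equation at a fixed time, compared with one elementary integral *)

Section ito_at_time.
Variables (t : R) (I : Omega -> sp HH (- r)).
Hypothesis ht : 0 < t <= T.
Hypothesis mI : forall O, <<s (@open (sp HH (- r))) >> O -> measurable (I @^-1` O).
Hypothesis XI : {ae P, forall w, emb HH delta (X t w) =
          emb HH delta (S delta t (xi w)) + emb HH (- r) (I w)}.

Let t0 : 0 <= t. Proof. by case/andP: ht => /ltW. Qed.
Let tT : t <= T. Proof. by case/andP: ht. Qed.

Definition In n w := c n (emb HH (- r) (I w)).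

Lemma In_measurable n : measurable_fun setT (In n).
Proof.
move=> _ D mD; rewrite setTI.
apply: (mI (O := (fun x => c n (emb HH (- r) x)) @^-1` D)).
by apply: borel_preimage => //; exact: (coordinate_continuous hc q0_r).
Qed.

Lemma Xn_mild n : {ae P, forall w, Xn n t w = expR (t * lam n) * xin n w + In n w}.
Proof.
apply: filterS XI => w; rewrite /Xn => ->.
rewrite (coordinateD hc); [by rewrite coordinate_S|exact: (range_emb_sub _ q0_delta)|exact: (range_emb_sub _ q0_r)].
Qed.

Variable G : elementary HH Omega (- r).
Hypothesis hG : el_adapted F t G.

Definition Jn n w := c n (emb HH (- r) (el_integral W G w)).

Lemma Jn_el_sum n : Jn n =
  el_sum W (fun i : 'I_(el_size G) => el_l i) (fun i => el_r i) (fun i => el_C i)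
    (fun i => el_h i) (fun i => c n (emb HH (- r) (el_x i))).
Proof.
apply/funext => w; rewrite /Jn /el_integral coordinate_emb_sum//.
by apply: eq_bigr => i _; rewrite mulrC.
Qed.

Lemma Jn_sqi n : sqi (Jn n).
Proof. by rewrite Jn_el_sum; by apply: (sqi_el_sum hF hW _ _ tT); exact: hG. Qed.

(** The initial coordinate is known at time 0, hence at the left end of every interval, so it can be
    absorbed into the adapted factor of each term. *)
Lemma E_xin_Jn n : \int[P]_w (xin n w * Jn n w) = 0.
Proof.
have TT : 0 <= T by exact: ltW.
rewrite Jn_el_sum /el_sum.
have sY (i : 'I_(el_size G)) : sqi (fun w => \1_(el_C i) w * xin n w).
  have [l0 lr rt FC] := hG i; apply: sqi_indic; last exact: xin_sqi.
  by apply: (filtration_measurable hF _ FC); rewrite l0 (le_trans lr)// (le_trans rt).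
have sD (i : 'I_(el_size G)) : sqi (increment W (el_l i) (el_r i) (el_h i)).
  have [l0 lr rt FC] := hG i; apply: (incr_sqi hF hW) => //; exact: le_trans tT.
pose f (i : 'I_(el_size G)) w := c n (emb HH (- r) (el_x i)) *
  ((\1_(el_C i) w * xin n w) * increment W (el_l i) (el_r i) (el_h i) w).
under eq_Rintegral => w _.
  rewrite mulr_sumr (eq_bigr (f^~ w)); last by move=> i _; rewrite /f; ring.
  over.
have fi i : P.-integrable setT (EFin \o f i).
  exact: (integrableZl measurableT _ (sqiM (sY i) (sD i))).
rewrite Rintegral_sum// big1// => i _.
rewrite RintegralZl//; last exact: (sqiM (sY i) (sD i)).
have [l0 lr rt FC] := hG i.
have lT : 0 <= el_l i <= T by rewrite l0 (le_trans lr)// (le_trans rt).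
rewrite (E_adapted_incr hF hW) ?mulr0//; first exact: le_trans tT.
apply: (adaptedM hF) => //; first exact: (adapted_indic hF).
by apply: (adapted_mono hF _ l0); [|case/andP: lT|exact: xin_adapted].
Qed.

Lemma E_sum_sqr n (a : R) :
  (\int[P]_w ((a * xin n w + Jn n w) ^+ 2)%:E =
   (a ^+ 2)%:E * \int[P]_w (xin n w ^+ 2)%:E + \int[P]_w (Jn n w ^+ 2)%:E)%E.
Proof.
have sx := xin_sqi n; have sJ := Jn_sqi n.
have ix := sqi_integrable sx; have iJ := sqi_integrable sJ; have ixJ := sqiM sx sJ.
have ixa := integrableZl measurableT (a ^+ 2) ix.
have ixJa := integrableZl measurableT (2 * a) ixJ.
rewrite !RintegralE//; last exact: (sqi_integrable (sqiD (sqiZ a sx) sJ)).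
rewrite -EFinM -EFinD; congr EFin.
rewrite (_ : (fun w => _) = (fun w => (a ^+ 2 * xin n w ^+ 2 + (2 * a) * (xin n w * Jn n w)) + Jn n w ^+ 2)); last first.
  by apply/funext => w; ring.
rewrite RintegralD//; last exact: (integrableD measurableT ixa ixJa).
by rewrite RintegralD// !RintegralZl// E_xin_Jn mulr0 addr0.
Qed.

(** Replaces the stochastic integral by an elementary one at the price of a factor 1 + e and a
    summand e. The squared coordinate of the difference is at most C^2 times the squared norm, so
    the tolerance e / ((1 + 1/e) C^2) makes the second term of the split at most e. *)
Lemma mild_second_moment n (e C : R) : 0 < e ->
  0 < C -> (forall x : sp HH (- r), `|c n (emb HH (- r) x)| <= C * `|x|) ->
  (\int[P]_w (`|I w - el_integral W G w|%R ^+ 2)%:E <= (e / ((1 + e^-1) * C ^+ 2))%:E)%E ->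
  ((expR (t * lam n) ^+ 2)%:E * \int[P]_w (xin n w ^+ 2)%:E + \int[P]_w (Jn n w ^+ 2)%:E <=
   (1 + e)%:E * \int[P]_w (Xn n t w ^+ 2)%:E + e%:E)%E.
Proof.
move=> e0 C0 cC IG; rewrite -E_sum_sqr; set a := expR _.
have e1 : 0 < 1 + e^-1 by rewrite addr_gt0 ?invr_gt0.
have [mx _] := xin_sqi n; have [mJ _] := Jn_sqi n; have mIn := In_measurable n.
have mX := Xn_measurable n ht.
have mX2 : measurable_fun setT (fun w => (Xn n t w ^+ 2)%:E).
  exact/measurable_EFinP/measurable_funX.
have mIJ : measurable_fun setT (fun w => ((In n w - Jn n w) ^+ 2)%:E).
  by apply/measurable_EFinP/measurable_funX; exact: measurable_funB.
apply: (@le_trans _ _ (\int[P]_w ((1 + e)%:E * (Xn n t w ^+ 2)%:E + (1 + e^-1)%:E * ((In n w - Jn n w) ^+ 2)%:E))%E).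
  apply: ae_le_integral_ge0.
  - apply/measurable_EFinP/measurable_funX/measurable_funD => //; exact: measurable_funM.
  - by move=> w; rewrite lee_fin sqr_ge0.
  - move=> w; rewrite -!EFinM -EFinD lee_fin addr_ge0// mulr_ge0 ?sqr_ge0 ?(ltW e1)//.
    by rewrite addr_ge0 // ltW.
  - apply: filterS (Xn_mild n) => w ->; rewrite -!EFinM -EFinD lee_fin -/a.
    set y := a * xin n w; set i := In n w; set j := Jn n w.
    (* (x + z)^2 <= (1 + e) x^2 + (1 + 1/e) z^2 *)
    have : 0 <= e^-1 * (e * (y + i) + (i - j)) ^+ 2 by rewrite mulr_ge0 ?sqr_ge0// invr_ge0 ltW.
    have -> : e^-1 * (e * (y + i) + (i - j)) ^+ 2 =
        e * (y + i) ^+ 2 + 2 * (y + i) * (i - j) + e^-1 * (i - j) ^+ 2 by field; rewrite gt_eqF.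
    nra.
have i0 : (0 <= \int[P]_w ((In n w - Jn n w) ^+ 2)%:E)%E by apply: integral_ge0 => w _; rewrite lee_fin sqr_ge0.
rewrite ge0_integralD//; last 4 first.
- by move=> w _; rewrite -EFinM lee_fin mulr_ge0 ?sqr_ge0// addr_ge0// ltW.
- exact: measurable_funeM.
- by move=> w _; rewrite -EFinM lee_fin mulr_ge0 ?sqr_ge0// ltW.
- exact: measurable_funeM.
rewrite !ge0_integralZl//; last 4 first.
- by move=> w _; rewrite lee_fin sqr_ge0.
- by rewrite lee_fin ltW.
- by move=> w _; rewrite lee_fin sqr_ge0.
- by rewrite lee_fin addr_ge0// ltW.
rewrite leeD2l//.
have IJ : ((C ^- 2)%:E * \int[P]_w ((In n w - Jn n w) ^+ 2)%:E <= (e / ((1 + e^-1) * C ^+ 2))%:E)%E.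
  rewrite -ge0_integralZl//; last 2 first.
  - by move=> w _; rewrite lee_fin sqr_ge0.
  - by rewrite lee_fin invr_ge0 sqr_ge0.
  apply: le_trans IG; apply: le_integral_ge0 => w _.
    by rewrite -EFinM lee_fin mulr_ge0 ?invr_ge0 ?sqr_ge0.
  rewrite -EFinM lee_fin ler_pdivrMl ?exprn_gt0//.
  rewrite /In /Jn -(coordinateB hc); [|exact: range_emb_sub..].
  rewrite -raddfB -(real_normK (num_real (c n _))) -exprMn ler_sqr ?nnegrE ?mulr_ge0 ?(ltW C0)//.
  exact: cC.
move: IJ i0; case: (integral _ _ _) => [x||//].
  rewrite -!EFinM !lee_fin ler_pdivrMl ?exprn_gt0// => IJ _.
  rewrite -ler_pdivlMl// (le_trans IJ)// le_eqVlt; apply/orP; left; apply/eqP.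
  move: e1; set k := 1 + e^-1 => k0.
  by field; rewrite !gt_eqF.
have C2 : (0 < (C ^- 2)%:E)%E by rewrite lte_fin invr_gt0 exprn_gt0.
by rewrite (gt0_muley C2).
Qed.

(** A square-integrable real majorant stands in for the norm of the vector-valued integral, whose
    measurability is then not at issue. *)
Lemma el_integral_sqi : exists2 g : Omega -> R, sqi g & forall w, `|el_integral W G w| <= g w.
Proof.
exists (fun w => \sum_(i < el_size G) `|el_x i| *
    `|\1_(el_C i) w * increment W (el_l i) (el_r i) (el_h i) w|); last first.
  move=> w; apply: le_trans (ler_norm_sum _ _ _) _; apply: ler_sum => i _.
  by rewrite normrZ mulrC.
apply: sqi_sum => i; apply: sqiZ; have [l0 lr rt FC] := hG i.
have sD : sqi (fun w => \1_(el_C i) w * increment W (el_l i) (el_r i) (el_h i) w).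
  apply: sqi_indic.
    by apply: (filtration_measurable hF _ FC); rewrite l0 (le_trans lr)// (le_trans rt).
  by apply: (incr_sqi hF hW) => //; exact: le_trans tT.
have [mD _] := sD; apply: (@sqi_le _ _ _ _ _ _ 1 _ _ sD).
  exact: (measurableT_comp (@normr_measurable R setT)).
by move=> w; rewrite real_normK ?num_real// mul1r.
Qed.

(** X_t is split into e^(tA) xi, the approximation error and the elementary integral. The splitting
    is done on finite sums of squared coordinates, where additivity of the integral is available,
    and only afterwards bounded by norms. *)
Lemma E_enorm_X_fin : (\int[P]_w (`|I w - el_integral W G w|%R ^+ 2)%:E < +oo)%E ->
  (\int[P]_w enorm (- r)%R (emb HH delta (X t w)) ^+ 2 < +oo)%E.
Proof.
move=> IGfin; have [g sg gle] := el_integral_sqi.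
have mr_le0 : - r <= 0 by rewrite oppr_le0.
pose f1 (K : {fset int}) w := \sum_(n <- K) (wt (- r) n * (expR (t * lam n) * xin n w)) ^+ 2.
pose f2 (K : {fset int}) w := \sum_(n <- K) (wt (- r) n * (In n w - Jn n w)) ^+ 2.
pose f3 (K : {fset int}) w := \sum_(n <- K) (wt (- r) n * Jn n w) ^+ 2.
have mX n := Xn_measurable n ht.
have mJ n : measurable_fun setT (Jn n) by have [] := Jn_sqi n.
have mx := xin_measurable; have mIn := In_measurable.
have m1 K : measurable_fun setT (fun w => (f1 K w)%:E).
  apply/measurable_EFinP/measurable_sum => n.
  by apply: measurable_funX; apply: measurable_funM => //; apply: measurable_funM.
have m2 K : measurable_fun setT (fun w => (f2 K w)%:E).
  apply/measurable_EFinP/measurable_sum => n.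
  by apply: measurable_funX; apply: measurable_funM => //; apply: measurable_funB.
have m3 K : measurable_fun setT (fun w => (f3 K w)%:E).
  by apply/measurable_EFinP/measurable_sum => n; apply: measurable_funX; apply: measurable_funM.
have f10 K w : (0 <= (f1 K w)%:E)%E by rewrite lee_fin sumr_ge0// => n _; exact: sqr_ge0.
have f20 K w : (0 <= (f2 K w)%:E)%E by rewrite lee_fin sumr_ge0// => n _; exact: sqr_ge0.
have f30 K w : (0 <= (f3 K w)%:E)%E by rewrite lee_fin sumr_ge0// => n _; exact: sqr_ge0.
(* The constants come from (x + i)^2 <= 2 x^2 + 2 i^2 followed by i^2 <= 2 (i - j)^2 + 2 j^2. *)
pose M := (2%:E * \int[P]_w enorm (- r)%R (emb HH delta (S delta t (xi w))) ^+ 2 +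
  (4%:E * \int[P]_w (`|I w - el_integral W G w|%R ^+ 2)%:E + 4%:E * \int[P]_w (g w ^+ 2)%:E))%E.
have Mfin : (M < +oo)%E.
  rewrite /M !lte_add_pinfty ?lte_mul_pinfty ?lee_fin ?hint_xi//; exact: sg.2.
apply: le_lt_trans Mfin.
apply: (@le_trans _ _ (\int[P]_w zsum (fun n => ((wt (- r) n * Xn n t w) ^+ 2)%R))%E).
  apply: le_integral_ge0 => w _; first exact: sqre_ge0.
  by apply: enorm_le_zsum => //; exact: range_emb_sub.
apply: integral_zsum_le => [n|n w|K]; [|exact: sqr_ge0|].
  by apply: measurable_funX; apply: measurable_funM.
apply: (@le_trans _ _ (\int[P]_w (2%:E * (f1 K w)%:E + (4%:E * (f2 K w)%:E + 4%:E * (f3 K w)%:E)))%E).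
  apply: ae_le_integral_ge0.
  - apply/measurable_EFinP/measurable_sum => n.
    by apply: measurable_funX; apply: measurable_funM.
  - by move=> w; rewrite lee_fin sumr_ge0// => n _; exact: sqr_ge0.
  - by move=> w; rewrite !(adde_ge0, mule_ge0).
  - have : {ae P, forall w, forall n, Xn n t w = expR (t * lam n) * xin n w + In n w}.
      apply: filterS XI => w XIw n; rewrite /Xn XIw.
      rewrite (coordinateD hc); [by rewrite coordinate_S|exact: (range_emb_sub _ q0_delta)|exact: (range_emb_sub _ q0_r)].
    apply: filterS => w Xw; rewrite -!EFinM -!EFinD lee_fin /f1 /f2 /f3 !mulr_sumr -!big_split/=.
    apply: ler_sum => n _; rewrite Xw.
    set k := wt _ _; set x := expR _ * _; set i := In n w; set j := Jn n w.
    have := sqr_ge0 (k * x - k * i); have := sqr_ge0 (k * (i - j) - k * j); lra.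
rewrite ge0_integralD//; last 4 first.
- by move=> w _; rewrite mule_ge0.
- exact: measurable_funeM.
- by move=> w _; rewrite adde_ge0// mule_ge0.
- by apply: emeasurable_funD; exact: measurable_funeM.
rewrite ge0_integralD//; last 4 first.
- by move=> w _; rewrite mule_ge0.
- exact: measurable_funeM.
- by move=> w _; rewrite mule_ge0.
- exact: measurable_funeM.
rewrite !ge0_integralZl//.
apply: leeD; last apply: leeD; rewrite lee_wpmul2l//; apply: le_integral_ge0 => w _ //.
- apply: le_trans (enorm_ge_fsum _ K q0_r); rewrite lee_fin; apply: ler_sum => n _.
  by rewrite coordinate_S.
- rewrite lee_fin; apply: le_trans (coordinate_fsum_le hb heta lam_le0 hc _ K q0_r).
  by apply: ler_sum => n _; rewrite raddfB/= (coordinateB hc)//; exact: range_emb_sub.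
- rewrite lee_fin; apply: le_trans (coordinate_fsum_le hb heta lam_le0 hc (el_integral W G w) K q0_r) _.
  by rewrite lerXn2r ?nnegrE// (le_trans _ (gle w)).
Qed.

End ito_at_time.

Lemma E_Xn_ge t n : 0 < t <= T ->
  ((expR (t * lam n) ^+ 2)%:E * \int[P]_w (xin n w ^+ 2)%:E <=
   \int[P]_w (Xn n t w ^+ 2)%:E)%E.
Proof.
move=> ht; apply: lee_mul1Deps => [|e e0].
  by apply: integral_ge0 => w _; rewrite lee_fin sqr_ge0.
have [I [mI [G [Gad _ GI]]] XI] := hmild ht.
have [C C0 cC] := coordinate_bounded hc n q0_r.
have d0 : 0 < e / ((1 + e^-1) * C ^+ 2).
  by rewrite divr_gt0// mulr_gt0 ?exprn_gt0// addr_gt0// invr_gt0.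
have [k kI] := filter_ex (ereal_cvg0_near_le d0 GI).
apply: le_trans (mild_second_moment ht mI XI (Gad k) e0 C0 cC kI).
by rewrite leeDl// integral_ge0// => w _; rewrite lee_fin sqr_ge0.
Qed.

(** * The coordinate along the constant function *)

Lemma lam0 : lam 0 = 0.
Proof. by rewrite lamE expr0n mulr0. Qed.

Lemma wt0_gt0 : 0 < wt (- r) 0. Proof. exact: wt_gt0. Qed.

(** Since [b n] has a continuous representative, [B v (b n)] is the pointwise product, an element of
    H; its coordinate along the constant 1 is the integral of that product. *)
Lemma coordinate0_mult (v : L2 R) n : c 0 (emb HH (- beta) (B v (b n))) = dot (b n) v.
Proof.
have ut : {within `[0, 1], continuous (@trig R n)}.
  by apply: continuous_subspaceT; exact: trig_continuous.
have mu : measurable_fun [set: measurableTypeR R] ((@trig R n) \_ `]0, 1[).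
  have mD : measurable (`]0, 1[%classic : set (measurableTypeR R)) by exact: measurable_itv.
  have := (measurable_restrictT (@trig R n) mD).1; apply.
  by apply: measurable_funTS; exact: trig_measurable.
have ub x : `|((@trig R n) \_ `]0, 1[) x| <= Num.sqrt 2.
  by rewrite patchE; case: ifPn => _; rewrite ?normr0 ?sqrtr_ge0//; exact: trig_bounded.
(* [hBmul] expects a function vanishing off (0,1); [mu01] does not see the change. *)
have bc : b n = cls ((@trig R n) \_ `]0, 1[).
  rewrite bE; apply: cls_eq_ae; [exact: trig_Lfun|exact: (Lfun2_bounded mu ub)|].
  exists (~` `]0, 1[%classic); split.
  - by apply: measurableC; exact: measurable_itv.
  - by rewrite /mu01 /= /mrestr setICl measure0.
  - by move=> x /= h Dx; apply: h; rewrite patchE mem_set.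
have Lu : (@trig R n) \_ `]0, 1[ \in Lfun (@mu01 R) 2%:E.
  exact: (Lfun2_bounded mu ub).
rewrite -{1}(L2rep_cls v) [X in B _ X]bc hBmul ?L2rep_Lfun//.
rewrite (coordinate_iota hc) bE bc -{2}(L2rep_cls v) !dot_cls//.
- by apply: eq_Rintegral => x _; rewrite mul1r mulrC.
- exact: L2rep_Lfun.
- exact: trig_Lfun.
- exact: (Lfun2_bounded_mul mu ub (L2rep_Lfun v)).
Qed.

Section density_limit.
Variables (t : R) (G : elementary HH Omega (- r)).
Hypothesis ht : 0 < t <= T.
Hypothesis hG : el_adapted F t G.

(** The Riesz representative of the coordinate along [b_0] of the elementary integrand; it
    approximates X_s. *)
Definition dens s w : L2 R :=
  el_density (fun i : 'I_(el_size G) => el_l i) (fun i => el_r i) (fun i => el_C i)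
    (fun i => el_h i) (fun i => c 0 (emb HH (- r) (el_x i))) s w.

Lemma coordinate_el_eval s w h : c 0 (emb HH (- r) (el_eval G s w h)) = dot h (dens s w).
Proof.
rewrite /el_eval coordinate_emb_sum// /dens /el_density dot_sumr.
by apply: eq_bigr => i _; rewrite dotZr (dotC h); ring.
Qed.

Lemma dens_jmeas n : jmeas (fun s w => dot (b n) (dens s w)).
Proof.
rewrite /jmeas (_ : (fun z => _) = (fun z : measurableTypeR R * Omega =>
  \sum_(i < el_size G) (c 0 (emb HH (- r) (el_x i)) *
    (\1_(`]el_l i, el_r i]) z.1 * \1_(el_C i) z.2)) * dot (b n) (el_h i))); last first.
  by apply/funext => z; rewrite /dens /el_density dot_sumr; apply: eq_bigr => i _; rewrite dotZr.
apply: measurable_sum => i; apply: measurable_funM => //.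
apply: measurable_funM => //; apply: measurable_funM.
- have mI : measurable (`]el_l i, el_r i]%classic : set (measurableTypeR R)) by exact: measurable_itv.
  have m1 : measurable_fun [set: measurableTypeR R] (\1_(`]el_l i, el_r i]) : measurableTypeR R -> R) by exact: measurable_indic.
  exact: (measurableT_comp m1 measurable_fst).
- have mC : measurable (el_C i).
    have [l0 lr rt FC] := hG i; apply: (filtration_measurable hF _ FC).
    by case/andP: ht => _ tT; rewrite l0 (le_trans lr)// (le_trans rt).
  have m1 : measurable_fun setT (\1_(el_C i) : Omega -> R) by exact: measurable_indic.
  exact: (measurableT_comp m1 measurable_snd).
Qed.

Lemma toH_X s w : 0 < s <= T -> iota (toH (emb HH delta (X s w))) = emb HH delta (X s w).
Proof.
move=> hs; have [v _ vE] := hXH w hs; rewrite /toH; case: xgetP => [y _ //|/(_ v)].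
by rewrite /= vE.
Qed.

(** Of each value at [b n] only the coordinate along [b_0] is kept. The semigroup leaves it
    unchanged, and multiplication by X_s makes it <b_n, X_s>; positivity of s places X_s in H. *)
Lemma HSnorm2_ge s w (K : {fset int}) : 0 < s < t ->
  ((wt (- r) 0 ^+ 2 * \sum_(n <- K) (Xt n s w - dot (b n) (dens s w)) ^+ 2)%:E <=
   HSnorm2 (- r)%R (fun h => mild_integrand S B X t s w h - emb HH (- r) (el_eval G s w h))%R)%E.
Proof.
move=> /andP[s0 st]; case/andP: ht => t0 tT.
have hs : 0 < s <= T by rewrite s0 (le_trans (ltW st)).
apply: le_trans (fsum_le_esum _ K); rewrite mulr_sumr -sumEFin; apply: lee_sum => n _.
apply: le_trans (enorm_ge 0 _ q0_r); rewrite exprMn lee_fin.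
have -> // : c 0 (mild_integrand S B X t s w (b n) - emb HH (- r) (el_eval G s w (b n))) =
  Xt n s w - dot (b n) (dens s w).
rewrite (coordinateB hc); [|exact: range_emb_sub..].
rewrite coordinate_el_eval; congr (_ - _).
rewrite /mild_integrand coordinate_S// ?subr_ge0 ?(ltW st)//.
rewrite lam0 mulr0 expR0 mul1r coordinate0_mult /Xt /Xn (ltW s0) (le_trans (ltW st) tT)/=.
by rewrite -(coordinate_iota hc) toH_X.
Qed.

Lemma iterint_dens_le (K : {fset int}) :
  (iterint P t (fun s w => \sum_(n <- K) dot (b n) (dens s w) ^+ 2)%R <=
   \int[P]_w (Jn G 0 w ^+ 2)%:E)%E.
Proof.
case/andP: ht => t0 tT.
rewrite Jn_el_sum; have := elementary_isometry hF hW _ _ tT hG; move=> <-.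
apply: iterint_le => s w _; first by rewrite lee_fin sumr_ge0// => n _; exact: sqr_ge0.
by rewrite lee_fin; exact: bessel.
Qed.

(** The split with 1 + e and 1 + 1/e again, now between X_s and [dens]. The tolerance cancels both 1
    + 1/e and the weight lost in [HSnorm2_ge]. *)
Lemma iterint_Xt_le_step (K : {fset int}) (e : R) : 0 < e ->
  (\int[leb]_(s in `]0%R, t[) \int[P]_w
     HSnorm2 (- r)%R (fun h => mild_integrand S B X t s w h - emb HH (- r) (el_eval G s w h))%R <=
   (e * wt (- r) 0 ^+ 2 / (1 + e^-1))%:E)%E ->
  (iterint P t (fun s w => \sum_(n <- K) Xt n s w ^+ 2)%R <=
   (1 + e)%:E * \int[P]_w (Jn G 0 w ^+ 2)%:E + e%:E)%E.
Proof.
move=> e0 HSe; have e1 : 0 < 1 + e^-1 by rewrite addr_gt0 ?invr_gt0.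
pose g s w := \sum_(n <- K) dot (b n) (dens s w) ^+ 2.
pose h s w := \sum_(n <- K) (Xt n s w - dot (b n) (dens s w)) ^+ 2.
have g0 s w : 0 <= g s w by apply: sumr_ge0 => n _; exact: sqr_ge0.
have h0 s w : 0 <= h s w by apply: sumr_ge0 => n _; exact: sqr_ge0.
have mg : jmeas g.
  by apply: measurable_sum => n; apply: measurable_funX; exact: dens_jmeas.
have mh : jmeas h.
  apply: measurable_sum => n; apply: measurable_funX; apply: measurable_funB.
    exact: Xt_jmeas.
  exact: dens_jmeas.
apply: (@le_trans _ _ (iterint P t (fun s w => (1 + e) * g s w + (1 + e^-1) * h s w)%R)).
  apply: iterint_le => s w _; first by rewrite lee_fin sumr_ge0// => n _; exact: sqr_ge0.
  rewrite lee_fin /g /h !mulr_sumr -big_split/=; apply: ler_sum => n _.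
  set x := Xt n s w; set y := dot _ _.
  have : 0 <= e^-1 * (e * y - (x - y)) ^+ 2 by rewrite mulr_ge0 ?sqr_ge0// invr_ge0 ltW.
  have -> : e^-1 * (e * y - (x - y)) ^+ 2 = e * y ^+ 2 - 2 * y * (x - y) + e^-1 * (x - y) ^+ 2.
    by field; rewrite gt_eqF.
  nra.
rewrite iterint_lin// ?(ltW e1)//; last by rewrite addr_ge0// ltW.
apply: leeD.
  by apply: lee_wpmul2l; [rewrite lee_fin addr_ge0// ltW|exact: iterint_dens_le].
have w0 := wt0_gt0; have w2 : 0 < wt (- r) 0 ^+ 2 by rewrite exprn_gt0.
have : ((wt (- r) 0 ^+ 2)%:E * iterint P t h <= (e * wt (- r) 0 ^+ 2 / (1 + e^-1))%:E)%E.
  have zero : jmeas (fun _ _ => 0 : R) (Omega := Omega) by exact: measurable_cst.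
  (* Linearity with second coefficient 0 serves as homogeneity. *)
  have := @iterint_lin R _ _ P t (wt (- r) 0 ^+ 2) 0 h h (ltW w2) (lexx _) mh mh h0 h0.
  rewrite mul0e adde0 => <-; apply: le_trans HSe; apply: iterint_le => s w /=; rewrite in_itv/= => st.
    by rewrite lee_fin mul0r addr0 mulr_ge0 ?h0// ltW.
  by rewrite mul0r addr0; exact: HSnorm2_ge.
have : (0 <= iterint P t h)%E.
  by apply: integral_ge0 => s _; apply: integral_ge0 => w _; rewrite lee_fin h0.
case: (iterint P t h) => [x||//].
  rewrite -!EFinM !lee_fin => _; rewrite -ler_pdivlMl// => xh.
  rewrite -ler_pdivlMl// (le_trans xh)// le_eqVlt; apply/orP; left; apply/eqP.
  by move: e1; set k := 1 + e^-1 => k0; field; rewrite !gt_eqF.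
have C2 : (0 < (wt (- r) 0 ^+ 2)%:E)%E by rewrite lte_fin.
by rewrite (gt0_muley C2).
Qed.

End density_limit.

Lemma iterint_Xt_le t (K : {fset int}) : 0 < t <= T ->
  (iterint P t (fun s w => \sum_(n <- K) Xt n s w ^+ 2)%R <=
   \int[P]_w (Xn 0 t w ^+ 2)%:E)%E.
Proof.
move=> ht; set M := (\int[P]_w _)%E.
have M0 : (0 <= M)%E by apply: integral_ge0 => w _; rewrite lee_fin sqr_ge0.
apply: lee_mul1Deps => // e e0.
have [I [mI [G [Gad GPhi GI]]] XI] := hmild ht.
have [C C0 cC] := coordinate_bounded hc 0 q0_r.
(* Two approximations are chained, giving the factor (1 + e')^2 <= 1 + 3 e' and the summand (1 + e')
   e' + e' <= 3 e', both within the allowance e. *)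
pose e' := Num.min 1 (e / 4).
have e'0 : 0 < e' by rewrite lt_min ltr01 divr_gt0.
have e'1 : e' <= 1 by rewrite ge_min lexx.
have e'4 : e' <= e / 4 by rewrite ge_min lexx orbT.
have e1 : 0 < 1 + e'^-1 by rewrite addr_gt0 ?invr_gt0.
have d0 : 0 < e' / ((1 + e'^-1) * C ^+ 2) by rewrite divr_gt0// mulr_gt0// exprn_gt0.
have d1 : 0 < e' * wt (- r) 0 ^+ 2 / (1 + e'^-1).
  by rewrite divr_gt0// mulr_gt0// exprn_gt0// wt0_gt0.
(* The same elementary process must be close both as an integrand and after integration. *)
have [k [kI kPhi]] := filter_ex (filterI (ereal_cvg0_near_le d0 GI) (ereal_cvg0_near_le d1 GPhi)).
apply: le_trans (iterint_Xt_le_step ht (Gad k) K e'0 kPhi) _.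
have J : (\int[P]_w (Jn (G k) 0 w ^+ 2)%:E <= (1 + e')%:E * M + e'%:E)%E.
  apply: le_trans (mild_second_moment ht mI XI (Gad k) e'0 C0 cC kI).
  rewrite leeDr// mule_ge0 ?lee_fin ?sqr_ge0//.
  by apply: integral_ge0 => w _; rewrite lee_fin sqr_ge0.
have e10 : (0 <= (1 + e')%:E)%E by rewrite lee_fin addr_ge0// ltW.
apply: (@le_trans _ _ ((1 + e')%:E * ((1 + e')%:E * M + e'%:E) + e'%:E)%E).
  by rewrite leeD2r// lee_wpmul2l.
case: (M) M0 => [m||//].
  rewrite lee_fin => m0; rewrite -!EFinM -!EFinD lee_fin.
  have h1 : e' * e' <= e' by rewrite ler_piMl// ltW.
  have h2 : e' * m <= e / 4 * m by rewrite ler_wpM2r.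
  have h3 : e' * e' * m <= e' * m by rewrite ler_wpM2r.
  have h4 : 0 <= e * m by rewrite mulr_ge0// ltW.
  lra.
have e11 : (0 < (1 + e)%:E)%E by rewrite lte_fin addr_gt0.
by move=> _; rewrite [leRHS](_ : _ = +oo%E) ?leey// (gt0_muley e11) addye.
Qed.

(** * The norm of the initial value in H_(-1/2) and the two conclusions *)

Lemma weight_half n : wt (- 2^-1) n ^+ 2 = (eta - lam n)^-1.
Proof.
have a0 : 0 <= eta - lam n by rewrite subr_ge0 (le_trans (lam_le0 n))// ltW.
by rewrite /weight powRN powR12_sqrt// exprVn sqr_sqrtr.
Qed.

Lemma E_xin_fsum_le t (K : {fset int}) : 0 < t <= T ->
  (((1 - expR (- 2 * eta * t)) / 2)%:E *
     \int[P]_w (\sum_(n <- K) (wt (- 2^-1) n * xin n w) ^+ 2)%:E <=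
   \int[P]_w (Xn 0 t w ^+ 2)%:E)%E.
Proof.
move=> ht; apply: le_trans (iterint_Xt_le K ht); case/andP: ht => t0 tT.
pose a n := eta - lam n.
have aE n : eta <= a n by rewrite /a lerDl oppr_ge0.
have a0 n : 0 < a n by apply: lt_le_trans (aE n).
pose v n := \int[P]_w (xin n w ^+ 2).
have vE n : (\int[P]_w (xin n w ^+ 2)%:E)%E = (v n)%:E.
  by apply: RintegralE; exact: (sqi_integrable (xin_sqi n)).
have v0 n : 0 <= v n by apply: Rintegral_ge0 => w _; exact: sqr_ge0.
have mx n : measurable_fun setT (fun w => xin n w ^+ 2).
  by apply: measurable_funX; exact: xin_measurable.
apply: (@le_trans _ _ (\int[leb]_(s in `]0%R, t[) (\sum_(n <- K) (v n)%:E * (expR (- (2 * a n) * s))%:E))%E); last first.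
  apply: le_integral_ge0 => s; rewrite /= in_itv/= => /andP[s0 st].
    by apply: sume_ge0 => n _; rewrite -EFinM lee_fin mulr_ge0// expR_ge0.
  have hs : 0 < s <= T by rewrite s0 (le_trans (ltW st)).
  under [leRHS]eq_integral do rewrite -sumEFin.
  rewrite ge0_integral_sum//; last 2 first.
  - move=> n; apply/measurable_EFinP/measurable_funX.
    exact: (jmeas_section s (Xt_jmeas n)).
  - by move=> n w _; rewrite lee_fin sqr_ge0.
  apply: lee_sum => n _.
  rewrite (_ : (fun w => _) = (fun w => (Xn n s w ^+ 2)%:E)); last first.
    by apply/funext => w; rewrite /Xt (ltW s0) (le_trans (ltW st)).
  apply: le_trans (E_Xn_ge n hs); rewrite vE -!EFinM lee_fin mulrC ler_wpM2r//.
  (* Here the exponent 2 s lam_n is lowered to -2 (eta - lam_n) s, at the cost of a factor e^(-2 eta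
     s). *)
  rewrite expr2 -expRD ler_expR /a; have : 0 <= eta * s by rewrite mulr_ge0// ltW.
  lra.
have mD : measurable (`]0, t[%classic : set (measurableTypeR R)) by exact: measurable_itv.
have me n : measurable_fun (`]0, t[%classic : set (measurableTypeR R))
    (fun s : measurableTypeR R => (expR (- (2 * a n) * s))%:E).
  apply/measurable_EFinP/measurable_funTS.
  apply: (measurableT_comp (@measurable_expR R)).
  by apply: measurable_funM.
under [X in (_ * X <= _)%E]eq_integral do rewrite -sumEFin.
rewrite ge0_integral_sum//; last 2 first.
- by move=> n; apply/measurable_EFinP/measurable_funX/measurable_funM => //; exact: xin_measurable.
- by move=> n w _; rewrite lee_fin sqr_ge0.
rewrite ge0_integral_sum//; last 2 first.
- by move=> n; exact: measurable_funeM.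
- by move=> n s _; rewrite -EFinM lee_fin mulr_ge0// expR_ge0.
rewrite ge0_sume_distrr; last first.
  by move=> n _; apply: integral_ge0 => w _; rewrite lee_fin sqr_ge0.
apply: lee_sum => n _.
rewrite ge0_integralZl//; last by rewrite lee_fin.
rewrite integral_expR_decay// -EFinM.
have -> : (\int[P]_w ((wt (- 2^-1) n * xin n w) ^+ 2)%:E)%E = ((a n)^-1 * v n)%:E.
  under eq_integral do rewrite exprMn EFinM.
  rewrite ge0_integralZl//; last 3 first.
  - exact/measurable_EFinP.
  - by move=> w _; rewrite lee_fin sqr_ge0.
  - by rewrite lee_fin sqr_ge0.
  by rewrite vE weight_half -EFinM.
rewrite -EFinM lee_fin.
have -> : (1 - expR (- 2 * eta * t)) / 2 * ((a n)^-1 * v n) =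
  v n * ((1 - expR (- 2 * eta * t)) / (2 * a n)) by field; rewrite gt_eqF.
apply: ler_wpM2l => //; apply: ler_wpM2r; first by rewrite invr_ge0 mulr_ge0// ltW.
(* Since a_n >= eta, the numerator 1 - e^(-2 a_n t) is smallest at eta, which makes the constant
   independent of n. *)
rewrite lerB// ler_expR ler_wpM2r ?(ltW t0)//.
have := aE n; lra.
Qed.

(** A measurable substitute for the squared H_(-1/2)-norm of [xi]: it dominates that norm and is
    finite exactly where [xi] lies in H_(-1/2). *)
Definition xi2 w := zsum (fun n => (wt (- 2^-1) n * xin n w) ^+ 2).

Lemma xi2_ge0 w : (0 <= xi2 w)%E.
Proof. by apply: zsum_ge0 => n; exact: sqr_ge0. Qed.

Lemma xi2_measurable : measurable_fun setT xi2.
Proof.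
apply: (zsum_measurable (f := fun n w => (wt (- 2^-1) n * xin n w) ^+ 2)) => [n|n w].
  by apply: measurable_funX; apply: measurable_funM => //; exact: xin_measurable.
exact: sqr_ge0.
Qed.

Lemma E_X_fin t : 0 < t <= T ->
  (\int[P]_w enorm (- r)%R (emb HH delta (X t w)) ^+ 2 < +oo)%E.
Proof.
move=> ht; have [I [mI [G [Gad _ GI]]] XI] := hmild ht.
have [k kI] := filter_ex (ereal_cvg0_near_le ltr01 GI).
apply: (E_enorm_X_fin ht mI XI (Gad k)).
exact: le_lt_trans kI (ltry _).
Qed.

Lemma E_Xn0_le t : 0 < t <= T ->
  ((eta `^ (- r) ^+ 2)%:E * \int[P]_w (Xn 0 t w ^+ 2)%:E <=
   \int[P]_w enorm (- r)%R (emb HH delta (X t w)) ^+ 2)%E.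
Proof.
move=> ht; have mX := Xn_measurable 0 ht.
have wE : wt (- r) 0 = eta `^ (- r) by rewrite /weight lam0 subr0.
rewrite -ge0_integralZl//; last 3 first.
- exact/measurable_EFinP/measurable_funX.
- by move=> w _; rewrite lee_fin sqr_ge0.
- by rewrite lee_fin sqr_ge0.
apply: le_integral_ge0 => w _; first by rewrite -EFinM lee_fin mulr_ge0 ?sqr_ge0.
by apply: le_trans (enorm_ge 0 _ q0_r); rewrite wE exprMn EFinM.
Qed.

Let decay_gt0 t : 0 < t -> 0 < (1 - expR (- 2 * eta * t)) / 2.
Proof.
move=> t0; rewrite divr_gt0// subr_gt0 expR_lt1 !mulNr oppr_lt0.
by rewrite !mulr_gt0.
Qed.

Lemma E_xi2_le t : 0 < t <= T ->
  (((1 - expR (- 2 * eta * t)) / 2)%:E * \int[P]_w xi2 w <=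
   \int[P]_w (Xn 0 t w ^+ 2)%:E)%E.
Proof.
move=> ht; have /andP[t0 _] := ht; have k0 := decay_gt0 t0.
rewrite -lee_pdivlMl//.
apply: (integral_zsum_le (f := fun n w => (wt (- 2^-1) n * xin n w) ^+ 2)) => [n|n w|K].
- by apply: measurable_funX; apply: measurable_funM => //; exact: xin_measurable.
- exact: sqr_ge0.
- by rewrite lee_pdivlMl//; exact: E_xin_fsum_le.
Qed.

(** A single time t = T suffices: the second moment of X_T in H_(-r) is finite, and the constants in
    the chain of inequalities are positive. *)
Lemma E_xi2_fin : (\int[P]_w xi2 w < +oo)%E.
Proof.
have TT : 0 < T <= T by rewrite hT lexx.
have w2 : 0 < eta `^ (- r) ^+ 2 by rewrite exprn_gt0// powR_gt0.
have := E_xi2_le TT; rewrite -lee_pdivlMl ?decay_gt0// => /le_lt_trans; apply.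
rewrite lte_mul_pinfty// ?lee_fin ?invr_ge0 ?(ltW (decay_gt0 hT))//.
have := E_Xn0_le TT; rewrite -lee_pdivlMl// => /le_lt_trans; apply.
by rewrite lte_mul_pinfty// ?lee_fin ?invr_ge0 ?(ltW w2)// E_X_fin.
Qed.

(** [xi2] has finite expectation, so it is finite almost surely, and its finiteness is membership in
    H_(-1/2). *)
Lemma xi_range : P [set w | range (emb HH (- 2^-1)) (emb HH delta (xi w))] = 1%E.
Proof.
have h0 : - 2^-1 <= 0 :> R by rewrite oppr_le0.
have -> : [set w | range (emb HH (- 2^-1)) (emb HH delta (xi w))] =
    setT `&` [set w | (xi2 w < +oo)%E].
  rewrite setTI; apply/seteqP; split => w /=.
    by move/(range_zsumP q0_half h0 (range_emb_sub _ q0_delta)).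
  by move=> h; apply/(range_zsumP q0_half h0 (range_emb_sub _ q0_delta)).
have mS := emeasurable_fun_infty_o measurableT xi2_measurable (+oo%E).
have xi2i : P.-integrable setT xi2.
  apply/integrableP; split; first exact: xi2_measurable.
  by under eq_integral do rewrite gee0_abs ?xi2_ge0//; exact: E_xi2_fin.
have [N [mN N0 sN]] := integrable_ae measurableT xi2i.
rewrite -[X in P X]setCK probability_setC; last exact: measurableC.
suff -> : P (~` (setT `&` [set w | (xi2 w < +oo)%E])) = 0%E by rewrite sube0.
apply: (subset_measure0 (measurableC mS) mN _ N0) => w /= h; apply: sN => /= /(_ Logic.I).
by move=> /fin_numPlt/andP[_ wf]; apply: h.
Qed.

Lemma rv_norm_bounds t : 0 < t <= T ->
  ((2 `^ (- 2^-1) * eta `^ (- r) * (1 - expR (- 2 * eta * t)) `^ 2^-1)%:E *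
     rv_norm P (- 2^-1)%R (emb HH delta \o xi)
   <= rv_norm P (- r)%R (emb HH delta \o X t) < +oo)%E.
Proof.
move=> ht; have /andP[t0 tT] := ht.
rewrite !rv_normE poweR_lty ?E_X_fin// andbT.
have h0 : - 2^-1 <= 0 :> R by rewrite oppr_le0.
have k0 := decay_gt0 t0; set k := (1 - expR (- 2 * eta * t)) / 2 in k0 *.
have e0 : 0 <= eta `^ (- r) by exact: powR_ge0.
(* Collected under one square root, the constant is that of the second-moment inequality, and the
   claim becomes monotonicity of the square root. *)
have -> : 2 `^ (- 2^-1) * eta `^ (- r) * (1 - expR (- 2 * eta * t)) `^ 2^-1 =
    (k * eta `^ (- r) ^+ 2) `^ 2^-1.
  rewrite powRM ?sqr_ge0 ?(ltW k0)// /k powRM ?invr_ge0//; last by rewrite -(@pmulr_lge0 _ 2^-1)// ltW.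
  rewrite [2 `^ _]powRN !(powR12_sqrt (ler0n _ 2)) (powR12_sqrt (sqr_ge0 _)) sqrtr_sqr ger0_norm//.
  by rewrite [2^-1 `^ _]powR12_sqrt ?invr_ge0// sqrtrV//; ring.
have ke0 : 0 <= k * eta `^ (- r) ^+ 2 by rewrite mulr_ge0 ?sqr_ge0// ltW.
have Ixi0 : (0 <= \int[P]_w enorm (- 2^-1)%R ((emb HH delta \o xi) w) ^+ 2)%E.
  by apply: integral_ge0 => w _; exact: sqre_ge0.
have IX0 : (0 <= \int[P]_w enorm (- r)%R ((emb HH delta \o X t) w) ^+ 2)%E.
  by apply: integral_ge0 => w _; exact: sqre_ge0.
rewrite -poweR_EFin -poweRM ?lee_fin//; apply: gt0_ler_poweR => //.
- by rewrite in_itv/= mule_ge0 ?lee_fin// leey.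
- by rewrite in_itv/= IX0 leey.
apply: le_trans (E_Xn0_le ht).
rewrite mulrC EFinM -muleA lee_wpmul2l ?lee_fin ?sqr_ge0//.
apply: le_trans (E_xi2_le ht); rewrite lee_wpmul2l ?lee_fin ?(ltW k0)//.
apply: le_integral_ge0 => w _; first exact: sqre_ge0.
by apply: enorm_le_zsum => //; exact: range_emb_sub.
Qed.
End mild_solution.

Theorem proposition3p2 (R : realType) (T eta nu r delta beta : R)
  (hT : 0 < T) (heta : 0 < eta) (hnu : 0 < nu) (hr : 0 <= r)
  (hbeta : 4^-1 < beta < 2^-1)
  (d : measure_display) (Omega : measurableType d) (P : probability Omega R)
  (F : R -> set (set Omega)) (hF : normal_filtration P T F)
  (W : R -> L2 R -> Omega -> R) (hW : cylindrical_wiener P T F W)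
  (b : int -> L2 R)
  (hb0 : b 0 = cls (fun=> 1))
  (hbpos : forall n : nat, (0 < n)%N ->
     b n%:Z = cls (fun x : R => Num.sqrt 2 * cos (2 * n%:R * pi * x)))
  (hbneg : forall n : nat, (0 < n)%N ->
     b (- n%:Z) = cls (fun x : R => Num.sqrt 2 * sin (2 * n%:R * pi * x)))
  (DA : set (L2 R)) (A : L2 R -> L2 R)
  (hDA : DA = [set v | (\esum_(n in [set: int])
                 (`|n%:~R ^+ 2 * dot (b n) v| ^+ 2)%:E < +oo)%E])
  (hA : forall v, DA v ->
     A v = - nu *: sum (fun n : int => (n%:~R ^+ 2 * dot (b n) v) *: b n))
  (HH : interpolation_family b A eta)
  (S : forall q, R -> sp HH q -> sp HH q) (hS : semigroup_extension S)
  (xi : Omega -> sp HH delta)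
  (hxi : forall O, <<s (@open (sp HH delta)) >> O -> F 0 (xi @^-1` O))
  (B : L2 R -> L2 R -> sp HH (- beta)) (hB : bounded_to_HS B)
  (hBmul : forall v u : R -> R, v \in Lfun (@mu01 R) 2%:E ->
     {within `[0, 1], continuous u} ->
     emb HH (- beta) (B (cls v) (cls (u \_ `]0, 1[))) =
     iota_ HH (cls (fun x => v x * (u \_ `]0, 1[) x)))
  (X : R -> Omega -> sp HH delta) (hX : predictable T F X)
  (hXH : forall t w, 0 < t <= T ->
     range (iota_ HH) (emb HH delta (X t w)))
  (hint : forall t, 0 < t <= T ->
     (\int[P]_w enorm (- r)%R (emb HH delta (S delta t (xi w))) ^+ 2 +
      \int[lebesgue_measure]_(s in `]0%R, t[) \int[P]_w
        HSnorm2 (- r)%R (mild_integrand S B X t s w) < +oo)%E)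
  (hmild : forall t, 0 < t <= T ->
     exists2 I : Omega -> sp HH (- r),
       is_ito_integral P F W t (mild_integrand S B X t) I &
       {ae P, forall w, emb HH delta (X t w) =
          emb HH delta (S delta t (xi w)) + emb HH (- r) (I w)}) :
  P [set w | range (emb HH (- 2^-1)) (emb HH delta (xi w))] = 1%E /\
  forall t, 0 < t <= T ->
    ((2 `^ (- 2^-1) * eta `^ (- r) * (1 - expR (- 2 * eta * t)) `^ 2^-1)%:E *
       rv_norm P (- 2^-1)%R (emb HH delta \o xi)
     <= rv_norm P (- r)%R (emb HH delta \o X t) < +oo)%E.
Proof.
have bE := basis_trig hb0 hbpos hbneg.
have hb m n : dot (b m) (b n) = (m == n)%:R by rewrite !bE; exact: dot_trig.
have lamE := eigval_laplacian hb hDA hA.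
have lam_le0 n : eigval b A n <= 0.
  by rewrite lamE mulNr oppr_le0 mulr_ge0 ?sqr_ge0// ltW.
(* One exponent low enough for H_q0 to contain [xi], X, the stochastic integral and the values of
   [B]; the entry -1 makes it negative and at most -1/2. *)
pose q0 := Num.min delta (Num.min (- r) (Num.min (- beta) (-1))).
have q0P x : x \in [:: delta; - r; - beta; -1] -> q0 <= x.
  by rewrite !inE /q0 => /or4P[]/eqP ->; rewrite !ge_min lexx ?orbT.
have q01 : q0 <= -1 by apply: q0P; rewrite !inE eqxx !orbT.
have q0_lt0 : q0 < 0 by rewrite (le_lt_trans q01)// oppr_lt0.
have q0_delta : q0 <= delta by apply: q0P; rewrite !inE eqxx.
have q0_r : q0 <= - r by apply: q0P; rewrite !inE eqxx !orbT.
have q0_beta : q0 <= - beta by apply: q0P; rewrite !inE eqxx !orbT.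
have q0_half : q0 <= - 2^-1 by rewrite (le_trans q01)// lerN2 invf_le1 ?ler1n.
have [c hc] := coordinates_exist hb heta lam_le0 HH q0_lt0.
split.
  exact: (xi_range hT heta hnu hr hF hW bE lamE hS hxi hBmul hX hXH hint hmild
    q0_lt0 q0_delta q0_r q0_beta q0_half hc).
move=> t; exact: (rv_norm_bounds hT heta hnu hr hF hW bE lamE hS hxi hBmul hX hXH
  hint hmild q0_lt0 q0_delta q0_r q0_beta q0_half hc).
Qed.
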